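(* For every integer $p$, $$Q_{p,1}(a^{-p})\cdot 1=\Psi^{(p-1)},$$ where $\Psi^{(p)}=\sum_\lambda q^{p\kappa_\lambda/2}s_\lambda(q^\rho)s_\lambda(x)$ is the one-leg topological vertex in framing $p$.
   Context: Let $R=\mathbb C[q^{\pm1/2},a^{\pm1},(q^{k/2}-q^{-k/2})^{-1}:k\ge1]$, $\{k\}=q^{k/2}-q^{-k/2}$. The skein algebra $\mathrm{Sk}(T^2)$ is the $R$-algebra generated by $P_{\mathbf x}$, $\mathbf x\in\mathbb Z^2\setminus\{0\}$, with $[P_{\mathbf x},P_{\mathbf y}]=\{\det(\mathbf x|\mathbf y)\}P_{\mathbf x+\mathbf y}$. The positive part of the skein module of the solid torus is identified with the ring of symmetric functions in $x_1,x_2,\dots$ over $R$, completed by degree, with basis $W_\lambda=s_\lambda(x)$ (Schur functions) indexed by partitions; $1=W_\varnothing$. The relevant elements act as follows (Morton–Samuelson). $P_{(0,n)}$, $n>0$, acts by multiplication by the power sum $p_n(x)$. For $n>0$ and $m\ne0$, $$P_{(m,n)}\cdot W_\lambda=a^m\frac{\{m\}}{\{mn\}}\sum_{\mu\in\lambda+n}(-1)^{\mathrm{ht}(\mu-\lambda)}\Big(\sum_{\square\in\mu-\lambda}q^{m\,c(\square)}\Big)W_\mu,$$ where $\lambda+n$ is the set of partitions obtained from $\lambda$ by adding a border strip (connected skew shape with no $2\times2$ square) with $n$ boxes, $\mathrm{ht}$ is the number of rows of the strip minus 1, and $c(\square)=j-i$ is the content of the box in row $i$, column $j$. The Baxter operator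 is $$Q_{p,1}(t)=\exp\Big(\sum_{n\ge1}\frac{-(-t)^n}{n\{n\}}P_{(pn,n)}\Big).$$ Further, $\kappa_\lambda=\sum_i\lambda_i(\lambda_i-2i+1)$, the sum defining $\Psi^{(p)}$ is over all partitions, and $q^\rho=(q^{-1/2},q^{-3/2},q^{-5/2},\dots)$, so that $s_\lambda(q^\rho)$ is the value of $s_\lambda$ under the specialization $p_m\mapsto 1/\{m\}$. *)

(* Defs.v *)
From HB Require Import structures.
From mathcomp Require Import all_boot all_order all_algebra finmap.
From mathcomp Require Import mathcomp_extra boolp classical_sets functions.
From mathcomp Require Import cardinality fsbigop reals complex monalg zify.

Set Implicit Arguments.
Unset Strict Implicit.
Unset Printing Implicit Defensive.

Import Order.TTheory GRing.Theory Num.Theory.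

Local Open Scope classical_set_scope.
Local Open Scope ring_scope.

(* The variables are x_0, x_1, x_2, ... and [al : monom] stands for the
   monomial prod_i x_i ^ (al i). *)
Notation monom := (cmonom nat).

Definition splits (al : monom) : set (monom * monom) :=
  [set bc | mulcm bc.1 bc.2 = al].

Lemma finite_splits al : finite_set (splits al).
Proof.
pose G (h : {ffun finsupp al -> 'I_(mdeg al).+1}) :=
  let be := mkcmonom [fsfun i : finsupp al => (h i : nat) | 0%N] in
  (be, divcm al be).
apply: (@sub_finite_set _ _ (G @` setT)); last first.
  by apply: finite_image; exact: finite_finset.
move=> [b c] /= bc; have bcE i : (b i + c i = al i)%N by rewrite -bc mulcmE.
have le i : (b i <= al i)%N by rewrite -bcE leq_addr.
exists [ffun i : finsupp al => inord (b (val i))] => //=.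
have bE : mkcmonom [fsfun i : finsupp al =>
    ([ffun i : finsupp al => inord (b (val i)) : 'I_(mdeg al).+1] i : nat)
    | 0%N] = b.
  apply/eqP/cmP => i; rewrite cmE /= fsfun_ffun.
  case: insubP => [u _ <-|iN]; last first.
    by move: (le i); rewrite (fsfun_dflt iN) leqn0 => /eqP.
  rewrite /= ffunE inordK // ltnS (leq_trans (le _)) //.
  by rewrite mdegE (big_fsetD1 (val u)) ?leq_addr //; exact: valP.
by rewrite /G bE; congr pair; apply/eqP/cmP => i; rewrite divcmE -bcE addKn.
Qed.

Lemma mem_splits al bc : (bc \in fset_set (splits al)) = (mulcm bc.1 bc.2 == al).
Proof.
rewrite in_fset_set; last exact: finite_splits.
by apply/idP/eqP; rewrite inE.
Qed.

Definition perm_monom (s s' : nat -> nat) (sK : cancel s s') (al : monom) : monom :=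
  mkcmonom [fsfun i in [fset s' j | j in finsupp al]%fset => al (s i) | 0%N].

Lemma perm_monomE s s' (sK : cancel s s') al i : perm_monom sK al i = al (s i).
Proof.
rewrite cmE /= fsfun_fun; case: ifPn => // /imfsetP h; apply/esym/eqP.
by rewrite cmE_eq0; apply/negP => si; apply: h; exists (s i).
Qed.

Lemma perm_monomM s s' (sK : cancel s s') al be :
  perm_monom sK (mulcm al be) = mulcm (perm_monom sK al) (perm_monom sK be).
Proof. by apply/eqP/cmP => i; rewrite mulcmE !perm_monomE mulcmE. Qed.

Section PSeries.
Variable A : comNzRingType.

(* R[[x_0, x_1, ...]], by coefficients. The alias keeps the pointwise product of
   functions from being inferred. *)
Definition pseries := monom -> A.

HB.instance Definition _ := GRing.Zmodule.on pseries.

Implicit Types (f g h : pseries) (al be : monom).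

Definition ps_one : pseries := fun al => (al == onecm nat)%:R.

Definition ps_mul f g : pseries := fun al =>
  \sum_(bc \in splits al) f bc.1 * g bc.2.

Definition ps_scale (a : A) f : pseries := fun al => a * f al.

Lemma ps_mulE f g al :
  ps_mul f g al = \sum_(bc <- fset_set (splits al)) f bc.1 * g bc.2.
Proof. by rewrite /ps_mul fsbig_finite //; exact: finite_splits. Qed.

Lemma ps_mulC : commutative ps_mul.
Proof.
move=> f g; apply/funext => al; rewrite !ps_mulE.
pose sw (x : monom * monom) := (x.2, x.1).
rewrite (perm_big (map sw (fset_set (splits al)))) /=; last first.
  apply: uniq_perm; rewrite ?fset_uniq //.
    by rewrite map_inj_uniq ?fset_uniq // => -[? ?] [? ?] [-> ->].
  move=> [b c]; apply/idP/mapP => [|[[b' c']]] /=.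
    by rewrite mem_splits /= mulcmC => e; exists (c, b); rewrite ?mem_splits.
  by rewrite mem_splits /= => e [-> ->]; rewrite mem_splits /= mulcmC.
by rewrite big_map; apply: eq_bigr => -[b c] _ /=; rewrite mulrC.
Qed.

Lemma ps_mulA : associative ps_mul.
Proof.
move=> f g h; apply/funext => al; rewrite !ps_mulE.
under eq_bigr do rewrite ps_mulE big_distrr /=.
under [RHS]eq_bigr do rewrite ps_mulE big_distrl /=.
pose tr1 (x y : monom * monom) := (x.1, y.1, y.2).
pose tr2 (x y : monom * monom) := (y.1, y.2, x.2).
pose F (t : monom * monom * monom) := f t.1.1 * g t.1.2 * h t.2.
transitivity (\sum_(t <- [seq tr1 x y | x <- fset_set (splits al),
                                     y <- fset_set (splits x.2)]) F t).
  rewrite big_allpairs_dep /=; apply: eq_bigr => x _; apply: eq_bigr => y _.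
  by rewrite /F /= mulrA.
transitivity (\sum_(t <- [seq tr2 x y | x <- fset_set (splits al),
                                     y <- fset_set (splits x.1)]) F t); last first.
  by rewrite big_allpairs_dep.
apply: perm_big; apply: uniq_perm.
- apply: allpairs_uniq_dep => [|x _|]; rewrite ?fset_uniq //.
  move=> ? ? /allpairsPdep[[b c] [[d e] [xa yx ->]]].
  move=> /allpairsPdep[[b' c'] [[d' e'] [xa' yx' ->]]] /=.
  move: yx yx'; rewrite !mem_splits /tr1 /= => /eqP <- /eqP <-.
  by case=> -> -> ->.
- apply: allpairs_uniq_dep => [|x _|]; rewrite ?fset_uniq //.
  move=> ? ? /allpairsPdep[[b c] [[d e] [xa yx ->]]].
  move=> /allpairsPdep[[b' c'] [[d' e'] [xa' yx' ->]]] /=.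
  move: yx yx'; rewrite !mem_splits /tr2 /= => /eqP <- /eqP <-.
  by case=> -> -> ->.
move=> [[b c] d]; apply/allpairsPdep/allpairsPdep.
  move=> [[x1 x2] [[y1 y2] []]]; rewrite !mem_splits /tr1 /= => /eqP x /eqP y.
  case=> -> -> ->; exists (mulcm x1 y1, y2), (x1, y1).
  by rewrite !mem_splits /= -mulcmA y x !eqxx.
move=> [[x1 x2] [[y1 y2] []]]; rewrite !mem_splits /tr2 /= => /eqP x /eqP y.
case=> -> -> ->; exists (y1, mulcm y2 x2), (y2, x2).
by rewrite !mem_splits /= mulcmA y x !eqxx.
Qed.

Lemma ps_mul1 : left_id ps_one ps_mul.
Proof.
move=> f; apply/funext => al; rewrite ps_mulE.
have m : (onecm nat, al) \in fset_set (splits al).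
  by rewrite mem_splits mul0cm.
rewrite (big_fsetD1 _ m) /= /ps_one eqxx mul1r big_seq big1 ?addr0 // => -[b c].
rewrite !inE mem_splits /= => /andP[]; case: (eqVneq b (onecm nat)) => [->|_ _ _].
  by rewrite mul0cm xpair_eqE eqxx /= => /negPf ->.
by rewrite mul0r.
Qed.

Lemma ps_mulDl : left_distributive ps_mul +%R.
Proof.
move=> f g h; apply/funext => al; rewrite -[RHS]/(ps_mul f h al + ps_mul g h al).
rewrite !ps_mulE -big_split /=; by apply: eq_bigr => bc _; rewrite -mulrDl.
Qed.

Lemma ps_oner_neq0 : ps_one != 0.
Proof.
apply/eqP => /(congr1 (fun f => f (onecm nat))); rewrite /ps_one eqxx => /eqP.
by rewrite oner_eq0.
Qed.

HB.instance Definition _ := GRing.Zmodule_isComNzRing.Build pseries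
  ps_mulA ps_mulC ps_mul1 ps_mulDl ps_oner_neq0.

Lemma ps_scalerA a b f : ps_scale a (ps_scale b f) = ps_scale (a * b) f.
Proof. by apply/funext => al; rewrite /ps_scale mulrA. Qed.

Lemma ps_scale1 : left_id 1 ps_scale.
Proof. by move=> f; apply/funext => al; rewrite /ps_scale mul1r. Qed.

Lemma ps_scalerDr : right_distributive ps_scale +%R.
Proof. by move=> a f g; apply/funext => al; rewrite /ps_scale mulrDr. Qed.

Lemma ps_scalerDl f : {morph ps_scale^~ f : a b / a + b}.
Proof. by move=> a b; apply/funext => al; rewrite /ps_scale mulrDl. Qed.

HB.instance Definition _ := GRing.Zmodule_isLmodule.Build A pseries
  ps_scalerA ps_scale1 ps_scalerDr ps_scalerDl.

Lemma ps_scalerAl (a : A) (f g : pseries) : a *: (f * g) = (a *: f) * g.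
Proof.
apply/funext => al; rewrite -[LHS]/(a * ps_mul f g al) [RHS]ps_mulE ps_mulE.
by rewrite big_distrr /=; apply: eq_bigr => bc _; rewrite mulrA.
Qed.

HB.instance Definition _ := GRing.Lmodule_isLalgebra.Build A pseries ps_scalerAl.

Definition symmetric_series : {pred pseries} := fun f =>
  `[< forall (s : nat -> nat) (al be : monom), bijective s ->
        (forall i, be i = al (s i)) -> f be = f al >].

Lemma symmetric_subalg : subalg_closed symmetric_series.
Proof.
split.
- apply/asboolP => s al be [s' sK s'K] E; congr (_%:R); congr nat_of_bool.
  apply/idP/idP => /eqP e; apply/eqP; last first.
    by apply/eqP/cmP => i; rewrite E e !onecmE.
  by apply/eqP/cmP => i; rewrite -(s'K i) -E e !onecmE.
- move=> a f g /asboolP fP /asboolP gP; apply/asboolP => s al be bs E.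
  by congr (a * _ + _); [exact: (fP s) | exact: (gP s)].
- move=> f g /asboolP fP /asboolP gP; apply/asboolP => s al be [s' sK s'K] E.
  have Ka b : perm_monom sK (perm_monom s'K b) = b.
    by apply/eqP/cmP => i; rewrite !perm_monomE sK.
  have Kb b : perm_monom s'K (perm_monom sK b) = b.
    by apply/eqP/cmP => i; rewrite !perm_monomE s'K.
  have inv (h : pseries) b : (forall s al be, bijective s ->
      (forall i, be i = al (s i)) -> h be = h al) -> h (perm_monom sK b) = h b.
    move=> hP; apply: (hP s); first by exists s'.
    by move=> i; rewrite perm_monomE.
  have beE : be = perm_monom sK al by apply/eqP/cmP => i; rewrite perm_monomE E.
  rewrite [LHS]ps_mulE [RHS]ps_mulE beE.
  pose pp (x : monom * monom) := (perm_monom sK x.1, perm_monom sK x.2).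
  rewrite (perm_big (map pp (fset_set (splits al)))) /=.
    by rewrite big_map; apply: eq_bigr => x _ /=; rewrite !inv.
  apply: uniq_perm; rewrite ?fset_uniq //.
    rewrite map_inj_uniq ?fset_uniq // => -[b c] [b' c'] [/(congr1 (perm_monom s'K))].
    by rewrite !Kb => -> /(congr1 (perm_monom s'K)); rewrite !Kb => ->.
  move=> [b c]; apply/idP/mapP => [|[[b' c']]] /=.
    rewrite mem_splits /= => /eqP bc; exists (perm_monom s'K b, perm_monom s'K c).
      by rewrite mem_splits /= -perm_monomM bc Kb.
    by rewrite /pp /= !Ka.
  rewrite mem_splits /= => /eqP <- [-> ->].
  by rewrite mem_splits /= perm_monomM.
Qed.

HB.instance Definition _ := GRing.isSubalgClosed.Build A pseries symmetric_series
  symmetric_subalg.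

(* The degree completion of the ring of symmetric functions over A: all
   power series (of possibly unbounded degree) that are invariant under every
   permutation of the variables. *)
Record symfun := Symfun {
  symfun_series : pseries;
  _ : symfun_series \in symmetric_series }.

HB.instance Definition _ := [isSub for symfun_series].
HB.instance Definition _ := [Choice of symfun by <:].
HB.instance Definition _ := [SubChoice_isSubComNzRing of symfun by <:].
HB.instance Definition _ := [SubZmodule_isSubLmodule of symfun by <:].
HB.instance Definition _ := [SubNzRing_SubLmodule_isSubLalgebra of symfun by <:].

End PSeries.

Local Open Scope nat_scope.

(* Partitions are weakly decreasing lists of positive integers. *)
Definition is_partition (s : seq nat) : bool := sorted geq s && (0 \notin s).

Record partition := Partition {
  parts :> seq nat;
  partsP : is_partition parts }.

HB.instance Definition _ := [isSub for parts].
HB.instance Definition _ := [Countable of partition by <:].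

Definition trow (T : seq (seq nat)) (i : nat) : seq nat := nth [::] T i.

(* Semistandard fillings of the diagram of la, given as the list of their rows;
   the entry k stands for the variable x_k. *)
Definition is_ssyt (la : seq nat) (T : seq (seq nat)) : Prop :=
  [/\ shape T = la, all (sorted leq) T &
      forall i j, j < nth 0 la i.+1 -> nth 0 (trow T i) j < nth 0 (trow T i.+1) j].

Definition weight (T : seq (seq nat)) : monom :=
  \big[@mulcm nat/onecm nat]_(k <- flatten T) ucm k.

Lemma weightE T i : weight T i = count_mem i (flatten T).
Proof.
rewrite /weight; elim: (flatten T) => [|k s IHs]; first by rewrite big_nil onecmE.
by rewrite big_cons mulcmE IHs ucmE.
Qed.

Lemma nth_lt_count (s : seq nat) x j : sorted leq s -> j < size s ->
  (nth 0 s j < x) = (j < count (fun y => y < x) s).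
Proof.
elim: s j => // a s IHs j pas; have ss := path_sorted pas.
have : all (leq a) s by move: pas; rewrite /= (path_sortedE leq_trans) => /andP[].
case: j => [|j] /= le.
  move=> _; case: ltnP => //= xa; rewrite add0n; apply/esym/negbTE.
  rewrite -leqNgt leqn0 -[_ == _]negbK -lt0n -has_count -all_predC.
  by apply: sub_all le => y /= ay; rewrite -leqNgt (leq_trans xa).
rewrite ltnS => js; rewrite (IHs _ ss js); case: (ltnP a x) => //= xa.
have -> : count (fun y => y < x) s = 0; last by rewrite !ltn0.
apply/eqP; rewrite -[_ == _]negbK -lt0n -has_count -all_predC.
by apply: sub_all le => y /= ay; rewrite -leqNgt (leq_trans xa).
Qed.

Lemma nth_parts_le (la : partition) i : nth 0 la i.+1 <= nth 0 la i.
Proof.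
have /andP[so _] := partsP la; case: (ltnP i.+1 (size la)) => [il|?]; last first.
  by rewrite nth_default.
exact: (sortedP 0 so).
Qed.

Lemma size_trow T i : size (trow T i) = nth 0 (shape T) i.
Proof.
case: (ltnP i (size T)) => iT; first by rewrite (nth_map [::]).
by rewrite /trow !nth_default ?size_map.
Qed.

Lemma sorted_trow T i : all (sorted leq) T -> sorted leq (trow T i).
Proof.
move=> /allP so; case: (ltnP i (size T)) => iT; last by rewrite /trow nth_default.
by apply: so; rewrite mem_nth.
Qed.

Lemma is_ssytE (la : partition) T : is_ssyt la T <->
  [/\ shape T = la, all (sorted leq) T & forall i x,
    count (fun y => y <= x) (trow T i.+1) <= count (fun y => y < x) (trow T i)].
Proof.
split=> -[shT so col]; split=> //.
  move=> i x; rewrite leqNgt; apply/negP => lt; set d := count _ (trow T i) in lt.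
  have d1 : d < size (trow T i.+1) by apply: leq_trans lt (count_size _ _).
  have d0 : d < size (trow T i).
    by apply: leq_trans d1 _; rewrite !size_trow shT nth_parts_le.
  have e0 : x <= nth 0 (trow T i) d.
    by rewrite leqNgt (nth_lt_count _ (sorted_trow _ so) d0) -/d ltnn.
  have e1 : nth 0 (trow T i.+1) d < x.+1 by rewrite (nth_lt_count _ (sorted_trow _ so) d1).
  have : nth 0 (trow T i) d < nth 0 (trow T i.+1) d.
    by apply: col; rewrite -shT -size_trow.
  by move/(leq_ltn_trans e0); rewrite ltnNge -ltnS e1.
move=> i j; rewrite -shT -size_trow => j1.
have j0 : j < size (trow T i) by apply: leq_trans j1 _; rewrite !size_trow shT nth_parts_le.
rewrite (nth_lt_count _ (sorted_trow i so) j0); apply: leq_trans (col _ _).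
by rewrite -[leqRHS]/(count (fun y => y < _.+1) _) -nth_lt_count ?ltnS // sorted_trow.
Qed.

(* The Bender-Knuth involution exchanging the numbers of entries k and k+1, used
   to prove that Schur functions are symmetric. In a row with c entries < k and
   h entries <= k+1, [bk_row m] makes the number of entries <= k equal to m. *)
Section BenderKnuth.
Variable k : nat.

Let cl (r : seq nat) := count (fun y => y < k) r.
Let cm (r : seq nat) := count (fun y => y <= k) r.
Let ch (r : seq nat) := count (fun y => y <= k.+1) r.

Definition bk_row (m : nat) (r : seq nat) : seq nat :=
  [seq y <- r | y < k] ++ nseq (m - cl r) k ++ nseq (ch r - m) k.+1
    ++ [seq y <- r | k.+1 < y].

Lemma cl_le_cm r : cl r <= cm r.
Proof. by apply: sub_count => y /= /ltnW. Qed.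

Lemma cm_le_ch r : cm r <= ch r.
Proof. by apply: sub_count => y /= /leqW. Qed.

Lemma bk_row_id r : sorted leq r -> bk_row (cm r) r = r.
Proof.
rewrite /bk_row /cl /cm /ch; elim: r => //= a r IHr.
rewrite (path_sortedE leq_trans) => /andP[le so]; rewrite -[in RHS](IHr so) {IHr}.
have cnt (P : pred nat) : (forall y, a <= y -> ~~ P y) -> count P r = 0.
  move=> h; apply/eqP; rewrite -[_ == _]negbK -lt0n -has_count -all_predC.
  by apply: sub_all le => y /= /h.
have fil (P : pred nat) : (forall y, a <= y -> ~~ P y) -> [seq y <- r | P y] = [::].
  by move=> h; apply/eqP; rewrite -size_eq0 size_filter cnt.
case: (ltngtP a k) => ak /=.
- have -> : (k.+1 < a) = false by lia.
  by have -> : a <= k.+1 by lia; rewrite !add1n !subSS.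
- rewrite !(fil (fun y => y < k)) ?(cnt (fun y => y < k)) ?(cnt (fun y => y <= k)) //=;
    try by move=> y; lia.
  rewrite !add0n !subn0; case: (eqVneq a k.+1) => [->|ak1].
    by rewrite leqnn ltnn add1n.
  have -> : (k.+1 < a) by lia.
  have -> : (a <= k.+1) = false by lia.
  by rewrite (cnt (fun y => y <= k.+1)) //= => y; lia.
- rewrite ak !(fil (fun y => y < k)) ?(cnt (fun y => y < k)) //=; try by move=> y; lia.
  have -> : (k.+1 < k) = false by lia.
  have -> : k <= k.+1 by lia.
  by rewrite !add0n !add1n !subn0 subSS.
Qed.

Lemma count_bk_row P m r : cl r <= m <= ch r -> count P (bk_row m r) =
  count (fun y => P y && (y < k)) r + P k * (m - cl r) + P k.+1 * (ch r - m)
  + count (fun y => P y && (k.+1 < y)) r.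
Proof. by move=> _; rewrite !count_cat !count_nseq !count_filter !addnA. Qed.

Lemma ch_decomp r : sorted leq r -> forall P, count P r =
  count (fun y => P y && (y < k)) r + P k * (cm r - cl r) + P k.+1 * (ch r - cm r)
  + count (fun y => P y && (k.+1 < y)) r.
Proof.
by move=> so P; rewrite -count_bk_row ?bk_row_id // cl_le_cm cm_le_ch.
Qed.

Lemma count_bk_row_neq (P : pred nat) m r : sorted leq r -> cl r <= m <= ch r ->
  P k = P k.+1 -> count P (bk_row m r) = count P r.
Proof.
move=> so mr e; rewrite count_bk_row // (ch_decomp so P) e.
by have := cl_le_cm r; have := cm_le_ch r; case: (P k.+1); lia.
Qed.

Lemma cl_bk_row m r : sorted leq r -> cl r <= m <= ch r -> cl (bk_row m r) = cl r.
Proof. by move=> so mr; apply: count_bk_row_neq; rewrite // ltnn ltnNge leqnSn. Qed.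

Lemma ch_bk_row m r : sorted leq r -> cl r <= m <= ch r -> ch (bk_row m r) = ch r.
Proof. by move=> so mr; apply: count_bk_row_neq; rewrite // leqnn leqnSn. Qed.

Lemma cm_bk_row m r : cl r <= m <= ch r -> cm (bk_row m r) = m.
Proof.
move=> mr; rewrite /cm count_bk_row // leqnn ltnn.
have -> : count (fun y => (y <= k) && (y < k)) r = cl r by apply: eq_count => y; lia.
have -> : count (fun y => (y <= k) && (k.+1 < y)) r = 0.
  by rewrite -(count_pred0 r); apply: eq_count => y /=; lia.
lia.
Qed.

Lemma size_bk_row m r : sorted leq r -> cl r <= m <= ch r ->
  size (bk_row m r) = size r.
Proof. by move=> so mr; rewrite -!count_predT; apply: count_bk_row_neq. Qed.

Lemma sorted_bk_row m r : sorted leq r -> sorted leq (bk_row m r).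
Proof.
move=> so; rewrite (sorted_pairwise leq_trans) /bk_row !pairwise_cat.
have nseqP n x : pairwise leq (nseq n x).
  by elim: n => //= n ->; rewrite andbT all_nseq leqnn orbT.
rewrite !nseqP -!(sorted_pairwise leq_trans) !(sorted_filter leq_trans) //= !andbT.
rewrite !allrel_catr -!andbA; apply/and5P; split.
all: try apply/andP; try split.
all: apply/allrelP => x y; rewrite ?mem_filter ?mem_nseq; lia.
Qed.

Lemma bk_row_bk_row m1 m2 r : sorted leq r -> cl r <= m1 <= ch r ->
  bk_row m2 (bk_row m1 r) = bk_row m2 r.
Proof.
move=> so mr; have e (P Q : pred nat) : (forall y, P y ==> Q y) ->
    [seq y <- [seq y <- r | P y] | Q y] = [seq y <- r | P y].
  move=> h; rewrite -filter_predI; apply: eq_filter => y /=.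
  by have := h y; rewrite andbC; case: (P y) => //= ->.
have n (P Q : pred nat) : (forall y, P y ==> ~~ Q y) ->
    [seq y <- [seq y <- r | P y] | Q y] = [::].
  move=> h; rewrite -filter_predI -[RHS](filter_pred0 r); apply: eq_filter => y /=.
  by have := h y; rewrite andbC; case: (P y) => //= /negPf ->.
have f1 : [seq y <- bk_row m1 r | y < k] = [seq y <- r | y < k].
  rewrite !filter_cat !filter_nseq ltnn ltnNge leqnSn /= e ?n ?cats0 //= => y;
    apply/implyP; lia.
have f2 : [seq y <- bk_row m1 r | k.+1 < y] = [seq y <- r | k.+1 < y].
  rewrite !filter_cat !filter_nseq ltnn ltnNge leqnSn /= n ?e //= => y;
    apply/implyP; lia.
by rewrite /(bk_row m2 (bk_row m1 r)) f1 f2 cl_bk_row // ch_bk_row.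
Qed.

Definition bk_mid (T : seq (seq nat)) (i : nat) : nat :=
  maxn (cl (trow T i)) (ch (trow T i.+1))
  + minn (ch (trow T i)) (if i is i'.+1 then cl (trow T i') else ch (trow T 0))
  - cm (trow T i).

Definition bk (T : seq (seq nat)) : seq (seq nat) :=
  mkseq (fun i => bk_row (bk_mid T i) (trow T i)) (size T).

Variable la : partition.

Lemma bk_bounds T i : is_ssyt la T ->
  maxn (cl (trow T i)) (ch (trow T i.+1)) <= cm (trow T i)
  <= minn (ch (trow T i)) (if i is i'.+1 then cl (trow T i') else ch (trow T 0)).
Proof.
move=> /is_ssytE[_ _ col]; have := cl_le_cm (trow T i); have := cm_le_ch (trow T i).
rewrite geq_max leq_min => -> -> /=; rewrite (col i k.+1) /=.
case: i => [|i]; first exact: cm_le_ch.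
exact: (col i k).
Qed.

Lemma bk_mid_bounds T i : is_ssyt la T ->
  cl (trow T i) <= bk_mid T i <= ch (trow T i).
Proof. by move=> /(bk_bounds i); rewrite /bk_mid; lia. Qed.

Lemma trow_bk T i : trow (bk T) i = bk_row (bk_mid T i) (trow T i).
Proof.
case: (ltnP i (size T)) => iT; first by rewrite /trow /bk nth_mkseq.
have e : trow T i = [::] by rewrite /trow nth_default.
have e1 : trow T i.+1 = [::] by rewrite /trow nth_default // ltnW.
have -> : bk_mid T i = 0 by rewrite /bk_mid e e1 /= min0n.
by rewrite e /trow nth_default ?size_mkseq.
Qed.

Lemma is_ssyt_bk T : is_ssyt la T -> is_ssyt la (bk T).
Proof.
move=> sT; have mT i := bk_mid_bounds i sT; have bT i := bk_bounds i sT.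
have /is_ssytE[shT so col] := sT; have soi i := sorted_trow i so.
apply/is_ssytE; split.
- rewrite -shT; apply: (@eq_from_nth _ 0); first by rewrite !size_map size_iota.
  by move=> i _; rewrite -!size_trow trow_bk size_bk_row.
- by apply/allP => r /mapP[i _ ->]; exact: sorted_bk_row.
move=> i x; rewrite !trow_bk.
case: (ltngtP x k) => xk.
- by rewrite !(count_bk_row_neq (soi _) (mT _)) ?col //; lia.
- case: (ltngtP x k.+1) => xk1; first by lia.
    by rewrite !(count_bk_row_neq (soi _) (mT _)) ?col //; lia.
  rewrite xk1 -[leqLHS]/(ch _) -[leqRHS]/(cm _) ch_bk_row // cm_bk_row //.
  by have := bT i; rewrite /bk_mid; lia.
rewrite xk -[leqLHS]/(cm _) -[leqRHS]/(cl _) cm_bk_row // cl_bk_row //.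
by have := bT i.+1; rewrite /bk_mid; lia.
Qed.

Lemma bk_mid_bk T i : is_ssyt la T -> bk_mid (bk T) i = cm (trow T i).
Proof.
move=> sT; have mT i := bk_mid_bounds i sT; have bT := bk_bounds i sT.
have /is_ssytE[shT so col] := sT; have soi i := sorted_trow i so.
rewrite {1}/bk_mid !trow_bk !cl_bk_row // !ch_bk_row // cm_bk_row //.
have -> : (if i is i'.+1 then cl (trow (bk T) i') else ch (trow T 0)) =
          (if i is i'.+1 then cl (trow T i') else ch (trow T 0)).
  by case: (i) => // i'; rewrite trow_bk cl_bk_row.
by rewrite /bk_mid; lia.
Qed.

Lemma bkK T : is_ssyt la T -> bk (bk T) = T.
Proof.
move=> sT; have mT i := bk_mid_bounds i sT.
have /is_ssytE[shT so col] := sT; have soi i := sorted_trow i so.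
apply: (@eq_from_nth _ [::]); first by rewrite !size_mkseq.
move=> i _; rewrite -!/(trow _ i) trow_bk bk_mid_bk // trow_bk bk_row_bk_row //.
exact: bk_row_id.
Qed.

Lemma count_flatten_row P (T : seq (seq nat)) :
  count P (flatten T) = \sum_(i < size T) count P (trow T i).
Proof.
rewrite count_flatten sumnE big_map (big_nth [::]) big_mkord.
by [].
Qed.

Lemma bk_sum T : is_ssyt la T ->
  \sum_(i < size T) bk_mid T i + \sum_(i < size T) cm (trow T i) =
  \sum_(i < size T) cl (trow T i) + \sum_(i < size T) ch (trow T i).
Proof.
move=> sT.
pose a i := maxn (cl (trow T i)) (ch (trow T i.+1)).
pose b i := minn (ch (trow T i)) (if i is i'.+1 then cl (trow T i') else ch (trow T 0)).
have E n : \sum_(i < n) (a i + b i) + b n =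
    \sum_(i < n) (cl (trow T i) + ch (trow T i)) + ch (trow T n).
  elim: n => [|n IHn]; first by rewrite !big_ord0 /b; lia.
  rewrite !big_ord_recr /=; have : a n + b n.+1 = cl (trow T n) + ch (trow T n.+1).
    by rewrite /a /b; lia.
  move: IHn; move: (\sum_(i < n) _) (\sum_(i < n) _) => u v.
  by move: (a n) (b n) (b n.+1) (cl _) (ch (trow T n)) (ch (trow T n.+1)) => *; lia.
rewrite -!big_split /=; transitivity (\sum_(i < size T) (a i + b i)).
  by apply: eq_bigr => i _; have := bk_bounds i sT; rewrite /bk_mid /a /b; lia.
have := E (size T); have e : ch (trow T (size T)) = 0 by rewrite /trow nth_default.
have -> : b (size T) = 0 by rewrite /b e min0n.
by rewrite e !addn0.
Qed.

Lemma count_bk T x : is_ssyt la T -> count_mem x (flatten (bk T)) =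
  count_mem (if x == k then k.+1 else if x == k.+1 then k else x) (flatten T).
Proof.
move=> sT; have mT i := bk_mid_bounds i sT; have bT i := bk_bounds i sT.
have /is_ssytE[shT so col] := sT; have soi i := sorted_trow i so.
have cmk r : sorted leq r -> count_mem k r = cm r - cl r.
  move=> sr; rewrite (ch_decomp sr) /= eqxx.
  have -> : (k.+1 == k) = false by lia.
  have h P : (forall y, ~~ P y) -> count P r = 0.
    by move=> hP; rewrite -(count_pred0 r); apply: eq_count => y; apply/negbTE.
  by rewrite !h; [lia|move=> y /=; lia..].
have chk r : sorted leq r -> count_mem k.+1 r = ch r - cm r.
  move=> sr; rewrite (ch_decomp sr) /= eqxx.
  have -> : (k == k.+1) = false by lia.
  have h P : (forall y, ~~ P y) -> count P r = 0.
    by move=> hP; rewrite -(count_pred0 r); apply: eq_count => y; apply/negbTE.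
  by rewrite !h; [lia|move=> y /=; lia..].
have S := bk_sum sT.
rewrite !count_flatten_row size_mkseq.
case: (eqVneq x k) => [->|xk].
  apply/eqP; rewrite -(eqn_add2r (\sum_(i < size T) cl (trow T i))).
  rewrite -(eqn_add2r (\sum_(i < size T) cm (trow T i))) -!addnA; apply/eqP.
  rewrite (addnC (\sum_(i < size T) cl (trow T i))).
  transitivity (\sum_(i < size T) bk_mid T i + \sum_(i < size T) cm (trow T i)).
    rewrite -!big_split /=; apply: eq_bigr => i _; rewrite trow_bk cmk ?sorted_bk_row //.
    rewrite cm_bk_row // cl_bk_row //; have := mT i; have := bT i; lia.
  rewrite S addnC -!big_split /=; apply: eq_bigr => i _; rewrite chk //.
  by have := bT i; lia.
case: (eqVneq x k.+1) => [->|xk1].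
  apply/eqP; rewrite -(eqn_add2r (\sum_(i < size T) bk_mid T i + \sum_(i < size T) cm (trow T i))).
  rewrite {2}S; apply/eqP; rewrite -!big_split /=; apply: eq_bigr => i _.
  rewrite trow_bk chk ?sorted_bk_row // cmk // cm_bk_row // ch_bk_row //.
  by have := mT i; have := bT i; lia.
apply: eq_bigr => i _; rewrite trow_bk; apply: count_bk_row_neq => //=.
by rewrite !(eq_sym _ x) (negPf xk) (negPf xk1).
Qed.

End BenderKnuth.

Local Open Scope ring_scope.

Section SymFun.
Variable A : comNzRingType.

Definition ps_monom (al : monom) : pseries A := fun be => (be == al)%:R.

(* Infinite sums are taken coefficientwise, each coefficient being a sum over the
   finite support of the summands (0 if that support is infinite, which never
   happens below). *)
Definition ps_sum (I : choiceType) (D : set I) (F : I -> pseries A) : pseries A :=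
  fun al => \sum_(i \in D) F i al.

Lemma ps_sum_sym (I : choiceType) (D : set I) (F : I -> pseries A) :
  (forall i, F i \in @symmetric_series A) -> ps_sum D F \in @symmetric_series A.
Proof.
move=> symF; apply/asboolP => s al be bs E; apply: eq_fsbigr => i _.
by have /asboolP h := symF i; exact: (h s).
Qed.

Lemma expcmnE (al : monom) n i : expcmn al n i = (al i * n)%N.
Proof.
rewrite /expcmn; case: n => [|n]; first by rewrite onecmE muln0.
rewrite iteropS; elim: n => [|n IHn]; first by rewrite muln1.
by rewrite iterS mulcmE IHn -mulnS.
Qed.

Definition powersum_series (n : nat) : pseries A :=
  ps_sum [set: nat] (fun i => ps_monom (expcmn (ucm i) n)).

Lemma powersum_sym n : powersum_series n \in @symmetric_series A.
Proof.
apply/asboolP => s al be bs E; have [s' sK s'K] := bs.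
rewrite /powersum_series /ps_sum (reindex_fsbigT s'); last by exists s.
apply: eq_fsbigr => i _.
congr (_%:R); congr nat_of_bool; apply/eqP/eqP => e; apply/eqP/cmP => j.
  by rewrite -{1}(s'K j) -E e !expcmnE !ucmE (inj_eq (can_inj s'K)).
by rewrite E e !expcmnE !ucmE -[j in RHS]sK (inj_eq (can_inj s'K)).
Qed.

Definition schur_series (la : partition) : pseries A :=
  ps_sum [set T | is_ssyt la T] (fun T => ps_monom (weight T)).

Definition adj_swap (k x : nat) : nat :=
  if x == k then k.+1 else if x == k.+1 then k else x.

Lemma schur_adj la k (al be : monom) : (forall i, be i = al (adj_swap k i)) ->
  schur_series la be = schur_series la al.
Proof.
move=> E; rewrite /schur_series /ps_sum.
have adjK i : adj_swap k (adj_swap k i) = i.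
  rewrite /adj_swap; case: (eqVneq i k) => [->|ik].
    by rewrite eqxx; have -> : (k.+1 == k) = false by lia.
  case: (eqVneq i k.+1) => [->|ik1]; first by rewrite eqxx.
  by rewrite (negPf ik) (negPf ik1).
rewrite (reindex_fsbig (bk k) [set T | is_ssyt la T]); last first.
  split.
  - by move=> T /= sT; exact: is_ssyt_bk.
  - move=> T T'; rewrite !inE => /= sT sT' /(congr1 (bk k)).
    by rewrite (bkK k sT) (bkK k sT').
  - by move=> T /= sT; exists (bk k T); [exact: is_ssyt_bk|exact: (bkK k sT)].
apply: eq_fsbigr => T; rewrite inE => /= sT.
congr (_%:R); congr nat_of_bool; apply/eqP/eqP => e; apply/eqP/cmP => i.
  by rewrite -(adjK i) -E e !weightE (count_bk _ _ sT) -/(adj_swap k _).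
by rewrite E e !weightE (count_bk _ _ sT).
Qed.

Definition mon_of_seq (u : seq nat) : monom :=
  mkcmonom [fsfun i in seq_fset tt (iota 0 (size u)) => nth 0%N u i | 0%N].

Lemma mon_of_seqE u i : mon_of_seq u i = nth 0%N u i.
Proof.
rewrite cmE fsfun_fun seq_fsetE mem_iota /= add0n; case: ltnP => // iu.
by rewrite nth_default.
Qed.

Lemma adj_sym (f : pseries A) :
  (forall k (al be : monom), (forall i, be i = al (adj_swap k i)) -> f be = f al) ->
  f \in @symmetric_series A.
Proof.
move=> fP; pose g u := f (mon_of_seq u).
have g_adj u x y w : g (u ++ x :: y :: w) = g (u ++ y :: x :: w).
  apply: (fP (size u)) => i; rewrite !mon_of_seqE /adj_swap !nth_cat.
  case: (eqVneq i (size u)) => [->|iu].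
    by rewrite ltnn subnn ltnNge leqnSn /= subSnn.
  case: (eqVneq i (size u).+1) => [->|iu1].
    by rewrite ltnn subnn ltnNge leqnSn /= subSnn.
  case: ltnP => // ui; have -> : (i - size u = (i - (size u).+2).+2)%N by lia.
  by [].
have g_front u s1 x s2 : g (u ++ s1 ++ x :: s2) = g (u ++ x :: s1 ++ s2).
  elim: s1 u => //= a s1 IHs u.
  by rewrite -g_adj -cat_rcons IHs cat_rcons.
have g_perm s t : perm_eq s t -> forall u, g (u ++ s) = g (u ++ t).
  elim: t s => [|x t IHt] s st u; first by rewrite (perm_nilP st).
  have xs : x \in s by rewrite (perm_mem st) mem_head.
  case/splitPr: xs st => s1 s2 st; rewrite g_front -!cat_rcons; apply: IHt.
  by move: st; rewrite -cat1s perm_catCA /= perm_cons.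
apply/asboolP => s al be [s' sK s'K] E.
have [N alN beN] : exists2 N, (forall i, N <= i -> al i = 0)%N &
                              (forall i, N <= i -> be i = 0)%N.
  pose m := (\max_(i <- (finsupp al `|` finsupp be)%fset) i)%N.
  have mP i : i \in (finsupp al `|` finsupp be)%fset -> (i <= m)%N.
    by move=> ?; apply: leq_bigmax_seq.
  exists m.+1 => i mi; apply/eqP; rewrite cmE_eq0; apply/negP => h; move: mi.
    by rewrite ltnNge mP // in_fsetU h.
  by rewrite ltnNge mP // in_fsetU h orbT.
have toseq (ga : monom) : (forall i, N <= i -> ga i = 0)%N -> f ga = g ([::] ++ mkseq ga N).
  move=> gaN; congr f; apply/eqP/cmP => i; rewrite mon_of_seqE /=.
  by case: (ltnP i N) => iN; [rewrite nth_mkseq|rewrite gaN // nth_default ?size_mkseq].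
rewrite !toseq //; apply: g_perm.
have nz (ga : monom) : (forall i, N <= i -> ga i = 0)%N ->
    perm_eq [seq x <- mkseq ga N | x != 0%N] [seq ga i | i <- finsupp ga].
  move=> gaN; rewrite /mkseq filter_map; apply: perm_map; apply: uniq_perm.
  - by rewrite filter_uniq ?iota_uniq.
  - exact: fset_uniq.
  move=> i; rewrite mem_filter mem_iota /= cmE_neq0 add0n.
  by case: (ltnP i N) => iN; rewrite ?andbT ?andbF // -cmE_neq0 gaN.
have nzp : perm_eq [seq x <- mkseq be N | x != 0%N] [seq x <- mkseq al N | x != 0%N].
  rewrite (permPl (nz _ beN)) perm_sym (permPl (nz _ alN)).
  have -> : [seq be i | i <- finsupp be] = [seq al i | i <- [seq s i | i <- finsupp be]].
    by rewrite -map_comp; apply: eq_map => i; rewrite E.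
  apply: perm_map; apply: uniq_perm.
  - exact: fset_uniq.
  - by rewrite map_inj_uniq ?fset_uniq //; exact: can_inj sK.
  move=> i; apply/idP/mapP => [ial|[j jbe ->]].
    by exists (s' i); rewrite ?s'K // -cmE_neq0 E s'K cmE_neq0.
  by rewrite -cmE_neq0 -E cmE_neq0.
rewrite -(perm_filterC (fun x => x != 0%N)) perm_sym -(perm_filterC (fun x => x != 0%N)) perm_sym.
apply: perm_cat => //.
have zs t : [seq x <- t | predC (fun x => x != 0%N) x] =
    nseq (size t - size [seq x <- t | x != 0%N]) 0%N.
  have /all_pred1P -> : all (pred1 0%N) [seq x <- t | predC (fun x => x != 0%N) x].
    by rewrite all_filter; apply/allP => x _ /=; rewrite negbK; apply/implyP.
  congr nseq; rewrite !size_filter -(count_predC (fun x => x != 0%N) t).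
  by rewrite addKn.
by rewrite !zs !size_mkseq (perm_size nzp).
Qed.

Lemma schur_sym la : schur_series la \in @symmetric_series A.
Proof. by apply: adj_sym => k al be; exact: schur_adj. Qed.

Definition sf_sum (I : choiceType) (D : set I) (F : I -> symfun A) : symfun A :=
  Symfun (ps_sum_sym D (fun i => valP (F i))).
Definition powersum (n : nat) : symfun A := Symfun (powersum_sym n).
Definition schur (la : partition) : symfun A := Symfun (schur_sym la).

End SymFun.

(* {k} = q^{k/2} - q^{-k/2}, where v is q^{1/2}. *)
Definition qint (A : unitRingType) (v : A) (k : int) : A := v ^ k - v ^ (- k).

Section SkeinRing.
Variable K : realType.

(* The field C(q^{1/2}, a): the inner variable is q^{1/2}, the outer one is a. *)
Definition coef_frac := {fraction {poly {poly K[i]}}}.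
HB.instance Definition _ := GRing.Field.on coef_frac.

Definition cst_frac (c : K[i]) : coef_frac := FracField.tofrac c%:P%:P.
Definition qhalf_frac : coef_frac := FracField.tofrac 'X%:P.
Definition a_frac : coef_frac := FracField.tofrac 'X.

(* C[q^{+-1/2}, a^{+-1}, {k}^{-1} : k >= 1], as the subring of C(q^{1/2}, a)
   generated by the indicated elements. *)
Inductive in_skein_ring : coef_frac -> Prop :=
| In_cst c : in_skein_ring (cst_frac c)
| In_qhalf : in_skein_ring qhalf_frac
| In_qhalfV : in_skein_ring qhalf_frac^-1
| In_a : in_skein_ring a_frac
| In_aV : in_skein_ring a_frac^-1
| In_qintV k : (0 < k)%N -> in_skein_ring (qhalf_frac ^+ k - qhalf_frac ^- k)^-1
| In_sub x y : in_skein_ring x -> in_skein_ring y -> in_skein_ring (x - y)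
| In_mul x y : in_skein_ring x -> in_skein_ring y -> in_skein_ring (x * y).

Definition skein_ring_pred : {pred coef_frac} := fun x => `[< in_skein_ring x >].

Lemma skein_ring_subring : subring_closed skein_ring_pred.
Proof.
split=> [|x y /asboolP xR /asboolP yR|x y /asboolP xR /asboolP yR]; apply/asboolP.
- by have := In_cst 1; rewrite /cst_frac !rmorph1.
- exact: In_sub.
- exact: In_mul.
Qed.

HB.instance Definition _ :=
  GRing.isSubringClosed.Build coef_frac skein_ring_pred skein_ring_subring.

Record skein_ring := SkeinRing {
  skein_ring_val : coef_frac;
  skein_ringP : skein_ring_val \in skein_ring_pred }.

HB.instance Definition _ := [isSub for skein_ring_val].
HB.instance Definition _ := [Choice of skein_ring by <:].
HB.instance Definition _ := [SubChoice_isSubComNzRing of skein_ring by <:].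

(* Units and inverses of the subring itself (not of its field of fractions). *)
Definition skein_ring_unit : {pred skein_ring} := fun x =>
  (val x != 0) && ((val x)^-1 \in skein_ring_pred).

Definition skein_ring_inv (x : skein_ring) : skein_ring :=
  if x \in skein_ring_unit then insubd x (val x)^-1 else x.

Lemma skein_ring_mulVr : {in skein_ring_unit, left_inverse 1 skein_ring_inv *%R}.
Proof.
move=> x xU; rewrite /skein_ring_inv xU; apply: val_inj.
have /andP[x0 xV] := xU.
by rewrite [LHS]rmorphM /= /insubd insubT /= mulVf // rmorph1.
Qed.

Lemma skein_ring_unitPl (x y : skein_ring) : y * x = 1 -> x \in skein_ring_unit.
Proof.
move=> /(congr1 val); rewrite rmorphM rmorph1 /= => yx.
have x0 : val x != 0 by apply: contra_eq_neq yx => ->; rewrite mulr0 eq_sym oner_eq0.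
apply/andP; split=> //; suff -> : (val x)^-1 = val y by exact: valP.
by apply: (mulIf x0); rewrite yx mulVf.
Qed.

Lemma skein_ring_inv_out : {in [predC skein_ring_unit], skein_ring_inv =1 id}.
Proof. by move=> x /negPf xU; rewrite /skein_ring_inv xU. Qed.

HB.instance Definition _ := GRing.ComNzRing_hasMulInverse.Build skein_ring
  skein_ring_mulVr skein_ring_unitPl skein_ring_inv_out.

Lemma skein_ring_mulf_eq0 (x y : skein_ring) : x * y = 0 -> (x == 0) || (y == 0).
Proof.
move=> /(congr1 val); rewrite rmorphM rmorph0 => /eqP.
by rewrite mulf_eq0 -!(rmorph0 (\val : skein_ring -> _)) !(inj_eq val_inj).
Qed.

HB.instance Definition _ :=
  GRing.ComUnitRing_isIntegral.Build skein_ring skein_ring_mulf_eq0.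

Definition qhalf : skein_ring := SkeinRing (asboolT In_qhalf).
Definition avar : skein_ring := SkeinRing (asboolT In_a).

Lemma qhalf_frac_neq0 : qhalf_frac != 0.
Proof. by rewrite /qhalf_frac tofrac_eq0 polyC_eq0 polyX_eq0. Qed.

Lemma a_frac_neq0 : a_frac != 0.
Proof. by rewrite /a_frac tofrac_eq0 polyX_eq0. Qed.

Lemma qhalf_unit : qhalf \is a GRing.unit.
Proof. by apply/andP; split; [exact: qhalf_frac_neq0|exact/asboolT/In_qhalfV]. Qed.

Lemma avar_unit : avar \is a GRing.unit.
Proof. by apply/andP; split; [exact: a_frac_neq0|exact/asboolT/In_aV]. Qed.

Lemma val_skein_ringV (x : skein_ring) : x \is a GRing.unit -> val x^-1 = (val x)^-1.
Proof.
exact: (rmorphV (\val : {rmorphism skein_ring -> coef_frac})).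
Qed.

Lemma qint_unit (k : int) : k != 0 -> qint qhalf k \is a GRing.unit.
Proof.
have pos (n : nat) : (0 < n)%N -> qint qhalf n \is a GRing.unit.
  move=> n0; have vE : val (qint qhalf n) = qhalf_frac ^+ n - qhalf_frac ^- n.
    have vX : val (qhalf ^+ n) = qhalf_frac ^+ n by rewrite rmorphXn.
    transitivity (val (qhalf ^+ n) - val (qhalf ^- n)).
      by rewrite /qint -exprnN rmorphB.
    by rewrite val_skein_ringV ?unitrX ?qhalf_unit // vX.
  apply/andP; rewrite vE; split; last by apply/asboolT/In_qintV.
  rewrite subr_eq0; apply/eqP => /(congr1 ( *%R (qhalf_frac ^+ n))).
  rewrite mulfV ?expf_neq0 ?qhalf_frac_neq0 // -exprD => e.
  have {}e : ('X ^+ (n + n) : {poly K[i]}) = 1.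
    apply: polyC_inj; apply/eqP; rewrite -tofrac_eq !rmorphXn /= rmorph1.
    by apply/eqP; rewrite -[LHS]/(qhalf_frac ^+ _) e.
  have := congr1 (fun p : {poly _} => size p) e; rewrite size_polyXn size_poly1.
  by case: (n) n0.
case: k => n; first by move=> n0; apply: pos; rewrite lt0n.
move=> _; have -> : qint qhalf (Negz n) = - qint qhalf n.+1.
  by rewrite /qint NegzE opprK opprB.
by rewrite unitrN pos.
Qed.

Lemma skein_natr_unit (n : nat) : (0 < n)%N -> (n%:R : skein_ring) \is a GRing.unit.
Proof.
move=> n0; apply/unitrPr; exists (SkeinRing (asboolT (In_cst n%:R^-1))).
apply: val_inj; rewrite rmorphM rmorph1 rmorph_nat /= /cst_frac.
rewrite -[n%:R]/(n%:R : coef_frac) -(rmorph_nat (@FracField.tofrac _)) -rmorphM /=.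
rewrite -(rmorph_nat (@polyC _)) -polyCM -(rmorph_nat (@polyC _)) -polyCM.
by rewrite divff ?rmorph1 // pnatr_eq0 -lt0n.
Qed.

End SkeinRing.

(* Boxes are (row, column) pairs numbered from 0; contents are not affected by
   the shift. *)
Definition skew_boxes (mu la : seq nat) : seq (nat * nat) :=
  [seq (i, j) | i <- iota 0 (size mu),
                j <- iota (nth 0 la i) (nth 0 mu i - nth 0 la i)]%N.

Definition content (b : nat * nat) : int := b.2%:Z - b.1%:Z.

Definition adjacent (b c : nat * nat) : bool :=
  (b.1 == c.1) && ((b.2 == c.2.+1) || (c.2 == b.2.+1))
  || (b.2 == c.2) && ((b.1 == c.1.+1) || (c.1 == b.1.+1)).

Definition connected_boxes (s : seq (nat * nat)) : Prop :=
  forall b c, b \in s -> c \in s -> exists w : seq (nat * nat),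
    [/\ path adjacent b w, {subset w <= s} & last b w = c].

Definition no_square (s : seq (nat * nat)) : Prop := forall i j,
  ~~ [&& (i, j) \in s, (i.+1, j) \in s, (i, j.+1) \in s & (i.+1, j.+1) \in s].

(* The set la + n. *)
Definition add_strip (la : partition) (n : nat) : set partition :=
  [set mu | [/\ forall i, (nth 0 la i <= nth 0 mu i)%N,
                size (skew_boxes mu la) = n,
                connected_boxes (skew_boxes mu la) &
                no_square (skew_boxes mu la)]].

Definition height (s : seq (nat * nat)) : nat := (size (undup (unzip1 s))).-1.

Definition kappa (la : partition) : int :=
  \sum_(i < size la) (nth 0%N la i)%:Z * ((nth 0%N la i)%:Z - 2 * i.+1%:Z + 1).

Section SkeinAction.
Variables (A : comUnitRingType) (v a : A).
Local Notation q := (v ^+ 2).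
Local Notation "{[ k ]}" := (qint v k).
Local Notation W := (schur A).

(* The coordinates of f in the (topological) basis of Schur functions. *)
Definition schur_coord (f : symfun A) : partition -> A :=
  xget (fun=> 0) [set c | f = sf_sum setT (fun la => c la *: W la)].

Definition skein_W (m : int) (n : nat) (la : partition) : symfun A :=
  (a ^ m * ({[m]} / {[m * n%:Z]})) *:
    \sum_(mu \in add_strip la n)
      ((-1) ^+ height (skew_boxes mu la)
       * \sum_(b <- skew_boxes mu la) q ^ (m * content b)) *: W mu.

(* The operator P_{(m, n)}, n > 0; for m <> 0 it is extended from the basis to
   the completed module by linearity and continuity. *)
Definition skein_P (m : int) (n : nat) (f : symfun A) : symfun A :=
  if m == 0 then powersum A n * f
  else sf_sum setT (fun la => schur_coord f la *: skein_W m n la).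

Definition sf_exp (T : symfun A -> symfun A) (f : symfun A) : symfun A :=
  sf_sum setT (fun k : nat => (k`!%:R)^-1 *: iter k T f).

(* The operator by which Q_{p,1}(t) acts. *)
Definition baxter (p : int) (t : A) : symfun A -> symfun A :=
  sf_exp (fun f => sf_sum [set n | (0 < n)%N] (fun n =>
    (- (- t) ^+ n / (n%:R * {[n%:Z]})) *: skein_P (p * n%:Z) n f)).

(* [specializes c f r]: writing the symmetric function f as a polynomial in the
   power sums p_k, k >= 1 (a list of coefficients and monomials), the
   substitution p_k |-> c k gives r. *)
Definition specializes (c : nat -> A) (f : symfun A) (r : A) : Prop :=
  exists e : seq (A * seq nat),
    [/\ forall t, t \in e -> 0%N \notin t.2,
        f = \sum_(t <- e) t.1 *: \prod_(k <- t.2) powersum A k &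
        r = \sum_(t <- e) t.1 * \prod_(k <- t.2) c k].

(* f(q^rho) *)
Definition at_qrho (f : symfun A) : A :=
  xget 0 [set r | specializes (fun k => {[k%:Z]}^-1) f r].

(* Psi^{(p)} *)
Definition vertex (p : int) : symfun A :=
  sf_sum setT (fun la => (v ^ (p * kappa la) * at_qrho (W la)) *: W la).

End SkeinAction.

(* Main.v *)
(* Extend a function c of partitions to an alternating function alt c of tuples l
   of N naturals through beta numbers l_k = la_k + N - 1 - k. Adding or removing a
   border strip of n boxes adds n to, or subtracts n from, one entry of l, the sign
   (-1)^ht being that of the sorting permutation; the contents of the strip are
   consecutive, starting at the smaller value of that entry up to a shift. So the
   operators E_n^x (remove a strip, weighted by x to its smallest content) are
   one-body operators and [E_n^x, E_m^y] = (x^m - y^n) E_(n+m)^(xy); moreover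
   M_n = E_n^1 and its transpose satisfy the Heisenberg relations, and M_n is
   multiplication by p_n on Schur functions (from the recursion on the largest
   entry of semistandard tableaux).

   For n > 0, P_(pn,n) is a^(pn) times the conjugate of p_n by W_la |-> v^(p kappa) W_la, with
   v = q^(1/2), so Q_(p,1)(a^-p) 1 = sum_la v^(p kappa) F_la W_la where
   F = exp(sum_n (-1)^(n-1)/(n {n}) M_n) 1. On the other hand s_la(q^rho) = G_la
   where G = exp(sum_n 1/(n {n}) M_n) 1, because G is an eigenvector of every
   transpose of M_n with eigenvalue 1/{n}. It remains to see F_la = v^(-kappa) G_la. With
   D_la the sum of q^c over the contents c of la, the commutation relations give
   {1} D F = M_1 F and {1} D G = E_1^q G; both are first order recursions, exchanged
   by the conjugation, and D_la is nonzero for la nonempty. *)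

From mathcomp Require Import all_boot all_order all_fingroup all_algebra finmap.
From mathcomp Require Import boolp classical_sets.
From mathcomp Require Import cardinality fsbigop reals complex monalg.
From mathcomp Require Import zify ring.
Require Import Defs.

Set Implicit Arguments.
Unset Strict Implicit.
Unset Printing Implicit Defensive.

Import Order.TTheory GRing.Theory Num.Theory.

(** * Border strips and beta numbers *)

Local Open Scope nat_scope.

(** Exponentials are handled only through the degree operator: deg Ex = (sum_n c_n M_n) Ex
    determines Ex from its value at the empty partition, so identities between images of Ex follow
    by comparing such Euler equations. With c_n = 1/{n} the commutators leave source terms v^n
    E_(n+1)^q that match after a shift of n, and the recursion for G is immediate. With c_n =
    (-1)^(n-1)/{n} they leave the sum of all (-v)^(n-1) E_n^q F, and the recursion for F needs the
    separate fact that this sum is M_1 F; the difference J satisfies (deg - 1) J = (sum_n c_n M_n)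
    J, so only degrees 0 and 1 need inspection. The obstacle in the one-body picture is the finite
    length of the tuples: removing a strip needs no new rows, but adding n boxes may need n of them.
    Hence the length is chosen anew in each lemma so that enough bottom rows are empty, and the
    intermediate tuples either keep such a bottom or have a repeated entry. The empty rows also
    carry the central term of the Heisenberg relations: they hold the entries too small to be
    lowered. *)

Lemma mem_skew_boxes (mu la : seq nat) r c :
  ((r, c) \in skew_boxes mu la) = (nth 0 la r <= c < nth 0 mu r).
Proof.
apply/allpairsPdep/idP => [[i [j [_ jin [-> ->]]]]|rc].
  by move: jin; rewrite mem_iota; lia.
exists r, c; split=> //; last by rewrite mem_iota; lia.
rewrite mem_iota /= add0n ltnNge; apply/negP => rs.
by move: rc; rewrite (nth_default _ rs) ltn0 andbF.
Qed.

Lemma big_skew_boxes (V : nmodType) (g : nat * nat -> V) (mu la : seq nat) N :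
    size mu <= N ->
  (\sum_(b <- skew_boxes mu la) g b =
   \sum_(k < N) \sum_(nth 0%N la k <= c < nth 0%N mu k) g (k : nat, c))%R.
Proof.
move=> muN; rewrite big_allpairs_dep /= -(big_mkord xpredT
  (fun k => \sum_(nth 0%N la k <= c < nth 0%N mu k) g (k, c)))%R.
rewrite (big_cat_nat (n := size mu)) //= [X in _ = (_ + X)%R]big_nat_cond
  [X in _ = (_ + X)%R]big1 ?addr0.
  by rewrite /index_iota subn0.
by move=> k; rewrite andbT => /andP[ks _]; rewrite (nth_default _ ks) big_geq.
Qed.

Definition beta N (la : seq nat) : {ffun 'I_N -> nat} :=
  [ffun k : 'I_N => nth 0 la k + (N.-1 - k)].

Definition addn_at N (l : {ffun 'I_N -> nat}) (i : 'I_N) n : {ffun 'I_N -> nat} :=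
  [ffun k => l k + (k == i) * n].

Definition permf N (l : {ffun 'I_N -> nat}) (s : {perm 'I_N}) : {ffun 'I_N -> nat} :=
  [ffun k => l (s k)].

Lemma permf1 N (l : {ffun 'I_N -> nat}) : permf l 1%g = l.
Proof. by apply/ffunP => k; rewrite ffunE perm1. Qed.

Lemma permfM N (l : {ffun 'I_N -> nat}) s t : permf l (s * t)%g = permf (permf l t) s.
Proof. by apply/ffunP => k; rewrite !ffunE permM. Qed.

Lemma permf_sum N (l : {ffun 'I_N -> nat}) s (V : nmodType) (g : nat -> V) :
  (\sum_k g (permf l s k) = \sum_k g (l k))%R.
Proof.
rewrite [RHS](reindex_inj (@perm_inj _ s)).
by apply: eq_bigr => k _; rewrite ffunE.
Qed.

Lemma addn_at_sum N (l : {ffun 'I_N -> nat}) i n (V : zmodType) (g : nat -> V) :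
  (\sum_k g (addn_at l i n k) = \sum_k g (l k) + (g (l i + n)%N - g (l i)))%R.
Proof.
rewrite (bigD1 i) //= [in RHS](bigD1 i) //= ffunE eqxx mul1n.
rewrite (eq_bigr (fun k => g (l k))) => [|k ki].
  by rewrite addrAC [X in _ = (X + _)%R]addrC subrK.
by rewrite ffunE (negPf ki) mul0n addn0.
Qed.

Lemma permf_addn_at N (l : {ffun 'I_N -> nat}) i n (s : {perm 'I_N}) :
  permf (addn_at l (s i) n) s = addn_at (permf l s) i n.
Proof. by apply/ffunP => k; rewrite !ffunE (inj_eq perm_inj). Qed.

(* [la] and [mu] differ by the border strip occupying the rows [j..i]. *)
Definition strip_rows (la mu : seq nat) n i j :=
  [/\ j <= i, forall k, (k < j) || (i < k) -> nth 0 mu k = nth 0 la k,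
      forall k, j <= k < i -> nth 0 mu k.+1 = (nth 0 la k).+1 &
      nth 0 mu j + (i - j) = nth 0 la i + n].

(** Raising the entry of row i by n makes it overtake exactly the rows j, ..., i-1, so the sorting
    permutation is the cycle [lift_perm i j 1], which sends i to j, keeps the order of the other
    indices and has sign (-1)^(i-j). *)
Lemma strip_rows_beta N (la mu : seq nat) n (i j : 'I_N.+1) :
  strip_rows la mu n i j ->
  addn_at (beta N.+1 la) i n = permf (beta N.+1 mu) (lift_perm i j 1%g).
Proof.
case=> ji out mid top; apply/ffunP => k; rewrite !ffunE.
have iN := ltn_ord i.
case: (unliftP i k) => [k' ->|->]; last by rewrite lift_perm_id eqxx; lia.
rewrite lift_perm_lift perm1 [_ == i]eq_sym (negPf (neq_lift _ _)).
have k'N : k' < N := ltn_ord k'; rewrite /= /bump !mul0n addn0.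
case: (leqP i k') => ik; case: (leqP j k') => jk; rewrite ?add1n ?add0n; try lia.
- by rewrite out // ltnS ik orbT.
- by rewrite mid ?jk // addSnnS subnSK.
- by rewrite out // jk.
Qed.

(* Moving from [mu] to [la] telescopes because both beta sequences agree up to order. *)
Lemma big_strip_contents (V : zmodType) (g : int -> V) N (la mu : seq nat) n i s :
    size mu <= N -> (forall k, nth 0 la k <= nth 0 mu k) ->
    addn_at (beta N la) i n = permf (beta N mu) s ->
  (\sum_(b <- skew_boxes mu la) g (content b) =
   \sum_(beta N la i <= x < beta N la i + n) g (x%:Z - N.-1%:Z))%R.
Proof.
move=> muN lamu E; rewrite (big_skew_boxes _ _ muN).
pose Ga x := (\sum_(0 <= y < x) g (y%:Z - N.-1%:Z))%R.
have GaB x y : x <= y -> (\sum_(x <= z < y) g (z%:Z - N.-1%:Z) = Ga y - Ga x)%R.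
  move=> xy; rewrite /Ga (big_cat_nat (n := x) (m := 0) (p := y)) //=.
  by rewrite [X in (X - _)%R]addrC addrK.
transitivity (\sum_(k < N) (Ga (beta N mu k) - Ga (beta N la k)))%R.
  apply: eq_bigr => k _; have kN := ltn_ord k; rewrite -GaB; last first.
    by rewrite !ffunE leq_add2r.
  rewrite !ffunE big_addn addnK; apply: eq_bigr => x _.
  by congr g; rewrite /content /=; lia.
rewrite GaB ?leq_addr // sumrB -(permf_sum _ s) -E addn_at_sum.
by rewrite addrAC subrr add0r.
Qed.

Lemma incr_ord_id n (t : 'I_n -> 'I_n) :
  (forall a b : 'I_n, a < b -> t a < t b) -> t =1 id.
Proof.
have le (u : 'I_n -> 'I_n) : (forall a b : 'I_n, a < b -> u a < u b) ->
    forall k : 'I_n, k <= u k.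
  move=> ui [k kn] /=; elim: k kn => // k IHk kn.
  have /= lt := ui (Ordinal (ltnW kn)) (Ordinal kn) (ltnSn _).
  exact: leq_ltn_trans (IHk _) lt.
move=> ti k; apply/val_inj/eqP; rewrite /= eqn_leq le // andbT.
(* [le] for the conjugate of [t] by the reversal is the opposite bound [t k <= k]. *)
have h : rev_ord k <= rev_ord (t (rev_ord (rev_ord k))).
  apply: (le (fun k => rev_ord (t (rev_ord k)))) => a b ab /=.
  have := ti (rev_ord b) (rev_ord a); have := ltn_ord (t (rev_ord a)).
  have /= := ltn_ord b; move: (t (rev_ord a)) (t (rev_ord b)) => x y.
  by case: x y a b ab => [x ?] [y ?] [a ?] [b ?] /=; lia.
move: h; rewrite rev_ordK /=; move: (t k) => x.
by case: x k => [x ?] [k ?] /=; lia.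
Qed.

Lemma nth_parts_mono (la : Defs.partition) i j : i <= j -> nth 0 la j <= nth 0 la i.
Proof.
move=> /subnK <-; elim: (j - i) => // k IHk.
exact: leq_trans (nth_parts_le _ _) IHk.
Qed.

Lemma beta_lt N (la : Defs.partition) (a b : 'I_N) :
  (beta N la b < beta N la a) = (a < b).
Proof.
rewrite !ffunE; case: a b => [a aN] [b bN] /=.
case: (leqP b a) => ab; have := nth_parts_mono la ab; first by lia.
by have := nth_parts_mono la (ltnW ab); lia.
Qed.

(** Once the raised entry is deleted on both sides, the permutation matches two strictly decreasing
    sequences, so it preserves the order of the remaining indices; comparing entries then gives the
    row description. *)
Lemma beta_perm_strip_rows N (la mu : Defs.partition) n (i : 'I_N.+1) s :
    size la <= N.+1 -> size mu <= N.+1 -> 0 < n ->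
    addn_at (beta N.+1 la) i n = permf (beta N.+1 mu) s ->
  strip_rows la mu n i (s i) /\ s = lift_perm i (s i) 1%g.
Proof.
move=> laN muN n0 E; pose j := s i.
have lm k : beta N.+1 la (lift i k) = beta N.+1 mu (s (lift i k)).
  move/ffunP/(_ (lift i k)): E; rewrite !ffunE eq_sym (negPf (neq_lift _ _)).
  by rewrite mul0n addn0.
have mj : beta N.+1 mu j = beta N.+1 la i + n.
  by move/ffunP/(_ i): E; rewrite !ffunE eqxx mul1n.
have ex k : exists t, s (lift i k) == lift j t.
  case: (unliftP j (s (lift i k))) => [t ->|/perm_inj/eqP]; first by exists t.
  by rewrite eq_sym (negPf (neq_lift _ _)).
pose t k := xchoose (ex k); have tE k : s (lift i k) = lift j (t k).
  exact/eqP/(xchooseP (ex k)).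
have liftlt (h : 'I_N.+1) (a b : 'I_N) : (lift h a < lift h b) = (a < b).
  by rewrite /= !ltnNge leq_bump2.
have t_id : t =1 id.
  apply: incr_ord_id => a b ab; rewrite -(liftlt j) -!tE.
  by rewrite -(beta_lt mu) -!lm beta_lt liftlt.
have sE : s = lift_perm i j 1%g.
  apply/permP => k; case: (unliftP i k) => [k' ->|->]; last by rewrite lift_perm_id.
  by rewrite tE t_id lift_perm_lift perm1.
split=> //; rewrite -/j.
have {}lm (k : 'I_N) : beta N.+1 la (lift i k) = beta N.+1 mu (lift j k).
  by rewrite lm tE t_id.
(* If i < j, entry i of [beta mu] would be entry i+1 of [beta la], smaller than the raised entry
   that stands at the later position j. *)
have ji : j <= i.
  rewrite leqNgt; apply/negP => ij.
  have iN : i < N by apply: leq_trans ij _; rewrite -ltnS.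
  have := lm (Ordinal iN); have -> : lift j (Ordinal iN) = i.
    by apply/val_inj; rewrite /= /bump leqNgt ij.
  have : beta N.+1 mu j < beta N.+1 mu i by rewrite beta_lt.
  rewrite mj => lt e; move: lt; rewrite -e => /(leq_ltn_trans (leq_addr _ _)).
  by rewrite beta_lt /= /bump leqnn ltnNge leqnSn.
have [iN jN] := (ltn_ord i, ltn_ord j).
split=> //.
- move=> k kji; case: (ltnP k N.+1) => kN; last first.
    by rewrite !nth_default // (leq_trans _ kN).
  case: (ltnP k j) => kj.
    have kN' : k < N by rewrite -ltnS (leq_trans _ jN).
    move: (lm (Ordinal kN')); rewrite !ffunE /= /bump leqNgt (leq_trans kj ji) /=.
    by rewrite leqNgt kj /= !add0n => /eqP; rewrite eqn_add2r => /eqP.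
  case: k kji kN kj => [|k]; first by lia.
  move=> ik kN jk; have {}ik : i <= k by lia.
  move: (lm (Ordinal (kN : k < N))); rewrite !ffunE /= /bump ik (leq_trans ji ik).
  by rewrite add1n => /eqP; rewrite eqn_add2r => /eqP.
- move=> k /andP[jk ki]; have kN : k < N by apply: leq_trans ki _; rewrite -ltnS.
  move: (lm (Ordinal kN)); rewrite !ffunE /= /bump leqNgt ki jk /= add0n add1n.
  by rewrite -(subnSK kN) addnS -addSn => /eqP; rewrite eqn_add2r => /eqP.
- by move: mj; rewrite !ffunE; lia.
Qed.

(** * Border strips as connected skew shapes without squares *)

Definition conn (S : seq (nat * nat)) b c := exists w : seq (nat * nat),
  [/\ path adjacent b w, {subset w <= S} & last b w = c].

Lemma conn_refl S b : conn S b b.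
Proof. by exists [::]. Qed.

Lemma conn_trans S b c d : conn S b c -> conn S c d -> conn S b d.
Proof.
move=> [w1 [p1 s1 <-]] [w2 [p2 s2 <-]]; exists (w1 ++ w2); rewrite cat_path p1 last_cat.
split=> // x; rewrite mem_cat => /orP[]; [exact: s1|exact: s2].
Qed.

Lemma conn1 S b c : adjacent b c -> c \in S -> conn S b c.
Proof.
move=> bc cS; exists [:: c]; rewrite /= bc; split=> // x.
by rewrite inE => /eqP ->.
Qed.

Lemma adjacentC b c : adjacent b c = adjacent c b.
Proof.
rewrite /adjacent (eq_sym b.1 c.1) (eq_sym b.2 c.2).
by congr ((_ && _) || (_ && _)); exact: orbC.
Qed.

Lemma conn_sym S b c : b \in S -> conn S b c -> conn S c b.
Proof.
move=> bS [w [p s <-]]; exists (rev (belast b w)); split.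
- by rewrite rev_path; apply: sub_path p => x y; rewrite adjacentC.
- move=> x; rewrite mem_rev => /mem_belast; rewrite inE => /orP[/eqP ->//|].
  exact: s.
- by case: w {p s} => //= x w; rewrite rev_cons last_rcons.
Qed.

Section Strip.
Variables (la mu : Defs.partition) (n i j : nat).
Hypotheses (n0 : 0 < n) (st : strip_rows la mu n i j).

Lemma strip_rows_occupied k : (nth 0 la k < nth 0 mu k) = (j <= k <= i).
Proof.
have [ji out mid top] := st; apply/idP/idP => [lt|/andP[jk ki]].
  apply: contraLR lt => h; rewrite -leqNgt out //.
  by move: h; rewrite negb_and -!ltnNge.
case: (ltngtP j k) jk => // [jk _|ejk _].
  case: k jk ki => // k jk ki; rewrite mid ?ltnS ?(nth_parts_le la) //.
  by rewrite -ltnS jk.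
case: (ltngtP j i) ji => // [ji _|eji _].
  by rewrite -ejk; apply: leq_trans (nth_parts_le mu j); rewrite mid ?leqnn.
by rewrite -ejk; move: top; rewrite eji subnn addn0 => ->; rewrite -addn1 leq_add2l.
Qed.

Lemma strip_rows_sub k : nth 0 la k <= nth 0 mu k.
Proof.
have [_ out _ _] := st; case: (boolP (j <= k <= i)) => h.
  by apply: ltnW; rewrite strip_rows_occupied.
by rewrite out //; move: h; rewrite negb_and -!ltnNge.
Qed.

Lemma height_strip_rows : height (skew_boxes mu la) = i - j.
Proof.
have [ji _ _ _] := st.
rewrite /height (perm_size (s2 := iota j (i - j).+1)) ?size_iota //.
apply: uniq_perm; rewrite ?undup_uniq ?iota_uniq // => r; rewrite mem_undup.
rewrite mem_iota addnS ltnS subnKC // -strip_rows_occupied.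
apply/mapP/idP => [[[r' c] + ->]|lt]; first by rewrite mem_skew_boxes => /=; lia.
by exists (r, nth 0 la r); rewrite ?mem_skew_boxes ?leqnn.
Qed.

(** Walk right to the end of the row, then up: the last box of row r+1 lies below the first box of
    row r. The induction is on the number of steps left to the last box of row j. *)
Lemma strip_rows_conn_top (r c : nat) : (r, c) \in skew_boxes mu la ->
  conn (skew_boxes mu la) (r, c) (j, (nth 0 mu j).-1).
Proof.
have [ji out mid top] := st.
have [d dE] : exists d, (nth 0 mu j).-1 - c + (r - j) = d by eexists.
elim: d => [|d IHd] in r c dE *; rewrite mem_skew_boxes => rc.
  have /andP[jr ri] : j <= r <= i by rewrite -strip_rows_occupied; lia.
  have rj : r = j by lia.
  have -> : c = (nth 0 mu j).-1 by rewrite rj in rc; lia.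
  by rewrite rj; exact: conn_refl.
have /andP[jr ri] : j <= r <= i by rewrite -strip_rows_occupied; lia.
have mono := nth_parts_mono mu jr.
case: (ltnP c.+1 (nth 0 mu r)) => cr.
  have c1S : (r, c.+1) \in skew_boxes mu la by rewrite mem_skew_boxes; lia.
  apply: conn_trans (IHd r c.+1 _ c1S); last by lia.
  by apply: conn1 => //; rewrite /adjacent /= !eqxx orbT.
case: (ltngtP j r) jr => // jr _; last first.
  have -> : r = j by []; have -> : c = (nth 0 mu j).-1 by rewrite jr; lia.
  exact: conn_refl.
case: r => // r in dE rc ri mono cr jr *.
have occ : nth 0 la r < nth 0 mu r by rewrite strip_rows_occupied; lia.
have m : nth 0 mu r.+1 = (nth 0 la r).+1 by rewrite mid; lia.
have c1S : (r, c) \in skew_boxes mu la by rewrite mem_skew_boxes; lia.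
apply: conn_trans (IHd r c _ c1S); last by lia.
by apply: conn1 => //; rewrite /adjacent /= !eqxx /= !orbT.
Qed.

Lemma strip_rows_size : size (skew_boxes mu la) = n.
Proof.
have [ji out mid top] := st; pose N := maxn (size mu) i.
have [iN muN] : i < N.+1 /\ size mu <= N.+1 by rewrite /N; lia.
have jN : j < N.+1 by apply: leq_ltn_trans ji iN.
have := strip_rows_beta (i := Ordinal iN) (j := Ordinal jN) st.
(* Counting boxes is the content sum of the constant 1. *)
move/(big_strip_contents (fun=> 1%R : int) muN strip_rows_sub).
rewrite big_const_seq count_predT iter_addr addr0 sumr_const_nat addKn => /eqP.
by rewrite eqr_nat => /eqP.
Qed.

Lemma strip_rows_add_strip : add_strip la n mu.
Proof.
split.
- exact: strip_rows_sub.
- exact: strip_rows_size.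
- move=> [r c] [r' c'] rc rc'.
  apply: conn_trans (strip_rows_conn_top rc) _.
  by apply: conn_sym rc' (strip_rows_conn_top rc').
have [ji out mid top] := st.
move=> r c; apply/negP; rewrite !mem_skew_boxes => /and4P[h1 h2 h3 h4].
have o1 : j <= r <= i by rewrite -strip_rows_occupied; lia.
have o2 : j <= r.+1 <= i by rewrite -strip_rows_occupied; lia.
by have := mid r; lia.
Qed.

End Strip.

(** A walk from below row k to row k or above has a vertical step from row k+1 to row k, whose two
    boxes share the column x. *)
Lemma conn_cross S b c k : b \in S -> conn S b c -> c.1 <= k < b.1 ->
  exists2 x, (k, x) \in S & (k.+1, x) \in S.
Proof.
move=> bS [w [p s <-]]; elim: w b bS p s => [|d w IHw] b bS /=; first by lia.
move=> /andP[bd p] s lk; have dS : d \in S by apply: s; rewrite mem_head.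
case: (ltnP k d.1) => kd.
  apply: (IHw d dS p) => [x xw|]; first by apply: s; rewrite inE xw orbT.
  by rewrite kd; case/andP: lk => ->.
case: b d bd bS dS kd lk {IHw p s} => [r x] [r' x'] /=; rewrite /adjacent /=.
move=> bd bS dS kd lk; exists x.
  by have [-> ->] : k = r' /\ x = x' by lia.
by have -> : k.+1 = r by lia.
Qed.

(** Rows j and i are the first and the last row that gain boxes. Between them connectedness forces
    consecutive rows to share a column, and the absence of squares makes it the only one; the number
    of boxes is then determined. *)
Lemma add_strip_rows (la mu : Defs.partition) n : 0 < n -> add_strip la n mu ->
  exists i j, strip_rows la mu n i j.
Proof.
move=> n0 lamu; have [sub sz co sq] := lamu.
pose occ k := nth 0 la k < nth 0 mu k.
have exocc : exists k, occ k.
  case E : (skew_boxes mu la) sz n0 => [|[r c] S] /=; first by move=> <-.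
  have : (r, c) \in skew_boxes mu la by rewrite E mem_head.
  by rewrite mem_skew_boxes => rc _ _; exists r; rewrite /occ; lia.
have ubocc k : occ k -> k <= size mu.
  by case: (leqP k (size mu)) => // /ltnW sk; rewrite /occ (nth_default _ sk).
have [j oj minj] := ex_minnP exocc; have [i oi maxi] := ex_maxnP exocc ubocc.
have ji : j <= i by apply: minj.
have out k : (k < j) || (i < k) -> nth 0 mu k = nth 0 la k.
  move=> h; apply/eqP; rewrite eqn_leq sub andbT leqNgt; apply/negP => ok.
  by have := minj _ ok; have := maxi _ ok; lia.
have mid k : j <= k < i -> nth 0 mu k.+1 = (nth 0 la k).+1.
  move=> /andP[jk ki]; apply/eqP; rewrite eqn_leq; apply/andP; split; last first.
    have iS : (i, nth 0 la i) \in skew_boxes mu la by rewrite mem_skew_boxes leqnn.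
    have jS : (j, nth 0 la j) \in skew_boxes mu la by rewrite mem_skew_boxes leqnn.
    have [|x] := conn_cross (k := k) iS (co _ _ iS jS); first by rewrite jk.
    by rewrite !mem_skew_boxes; lia.
  rewrite leqNgt; apply/negP => lt; have /negP := sq k (nth 0 la k); apply.
  have := nth_parts_le la k; have := nth_parts_le mu k.
  by rewrite !mem_skew_boxes; lia.
have le : nth 0 la i <= nth 0 mu j + (i - j).
  by apply: leq_trans (sub i) (leq_trans (nth_parts_mono mu ji) (leq_addr _ _)).
pose n' := nth 0 mu j + (i - j) - nth 0 la i.
have st : strip_rows la mu n' i j by split=> //; rewrite /n' subnKC.
exists i, j; suff -> : n = n' by [].
rewrite -sz; apply: (strip_rows_size (i := i) (j := j)) => //.
rewrite /n' subn_gt0; apply: leq_trans oi _.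
exact: leq_trans (nth_parts_mono mu ji) (leq_addr _ _).
Qed.

(** * Alternating extensions *)

Lemma nth_filter_pos (s : seq nat) k : sorted geq s ->
  nth 0 [seq x <- s | 0 < x] k = nth 0 s k.
Proof.
have geqT : transitive geq by move=> ? ? ? /= ? ?; lia.
elim: s k => // x s IHs k xs; have ss := path_sorted xs.
have le : all (geq x) s by move: xs; rewrite /= (path_sortedE geqT) => /andP[].
rewrite /=; case: ltnP => [_|]; first by case: k => //= k; rewrite IHs.
rewrite leqn0 => /eqP x0; rewrite x0 in le *.
have s0 : s = nseq (size s) 0.
  by apply/all_pred1P; apply: sub_all le => y /=; rewrite leqn0.
have -> : [seq y <- s | 0 < y] = [::] by rewrite s0; elim: (size s).
by rewrite nth_nil s0; case: k => //= k; rewrite nth_nseq if_same.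
Qed.

Lemma partition_ext (la mu : Defs.partition) :
  (forall k, nth 0 la k = nth 0 mu k) -> la = mu.
Proof.
have size_le (al be : Defs.partition) : (forall k, nth 0 al k = nth 0 be k) ->
    size al <= size be.
  move=> h; rewrite leqNgt; apply/negP => lt; have := h (size be).
  have /andP[_] := partsP al; rewrite (nth_default 0 (leqnn (size be))) => /negP n0 e0.
  by apply: n0; rewrite -e0 mem_nth.
move=> e; apply/val_inj => /=; apply: (@eq_from_nth _ 0) => [|k _]; last exact: e.
by apply/eqP; rewrite eqn_leq; apply/andP; split; apply: size_le => k; rewrite e.
Qed.

(** * Partitions and strictly decreasing tuples *)

Section Beta.
Variable N : nat.
Implicit Types (g l : {ffun 'I_N -> nat}) (la mu : Defs.partition).

Definition decr g : bool := [forall a : 'I_N, forall b : 'I_N, (a < b) ==> (g b < g a)].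

Lemma decrP g : reflect (forall a b : 'I_N, a < b -> g b < g a) (decr g).
Proof.
apply: (iffP forallP) => h a; last by apply/forallP => b; apply/implyP; exact: h.
by move=> b; move/forallP/(_ b)/implyP: (h a).
Qed.

Lemma decr_beta la : decr (beta N la).
Proof. by apply/decrP => a b; rewrite beta_lt. Qed.

Lemma decr_ge g (k : 'I_N) : decr g -> N.-1 - k <= g k.
Proof.
move/decrP => dg; case: k => k kN /=.
have [d] : exists d, N.-1 - k = d by eexists.
elim: d => [|d IHd] in k kN * => dE; first by rewrite dE.
have k1N : k.+1 < N by lia.
have := IHd k.+1 k1N; have /= := dg (Ordinal kN) (Ordinal k1N) (ltnSn k).
by move: (g (Ordinal kN)) (g (Ordinal k1N)) => x y; lia.
Qed.

Lemma decr_inj g : decr g -> injective g.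
Proof.
move=> /decrP dg a b e; apply/val_inj; case: (ltngtP a b) => // /dg; lia.
Qed.

Definition empty_partition : Defs.partition := Partition (isT : is_partition [::]).

(** Zero rows are dropped because partitions store positive parts only. For [decr g] the list is a
    partition, so the default value does not enter. *)
Definition unbeta g : Defs.partition := insubd empty_partition
  [seq x <- [seq g k - (N.-1 - k) | k <- enum 'I_N] | 0 < x].

Lemma unbetaP g : decr g -> size (unbeta g) <= N /\ beta N (unbeta g) = g.
Proof.
move=> dg; have sg : sorted geq [seq g k - (N.-1 - k) | k <- enum 'I_N].
  apply/(sortedP 0) => i; rewrite size_map size_enum_ord => iN /=.
  have iN' : i < N by exact: ltnW.
  rewrite (nth_map (Ordinal iN')) ?size_enum_ord // (nth_map (Ordinal iN')) ?size_enum_ord //.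
  have /decrP/(_ (Ordinal iN') (Ordinal iN) (ltnSn i)) := dg.
  have -> : nth (Ordinal iN') (enum 'I_N) i = Ordinal iN'.
    by apply/val_inj; rewrite /= nth_enum_ord.
  have -> : nth (Ordinal iN') (enum 'I_N) i.+1 = Ordinal iN.
    by apply/val_inj; rewrite /= nth_enum_ord.
  by move: (g _) (g _) => x y /=; lia.
have vE : unbeta g = [seq x <- [seq g k - (N.-1 - k) | k <- enum 'I_N] | 0 < x] :> seq nat.
  rewrite /unbeta val_insubd ifT // /is_partition mem_filter /= andbT.
  by apply: sorted_filter sg => ? ? ? /= ? ?; lia.
split; first by rewrite vE size_filter (leq_trans (count_size _ _)) // size_map size_enum_ord.
apply/ffunP => k; rewrite ffunE vE nth_filter_pos //.
rewrite (nth_map k) ?size_enum_ord // nth_ord_enum.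
by have := decr_ge k dg; move: (g k) => x; lia.
Qed.

Lemma beta_inj la mu : size la <= N -> size mu <= N -> beta N la = beta N mu -> la = mu.
Proof.
move=> laN muN /ffunP e; apply: partition_ext => k.
case: (ltnP k N) => kN; last by rewrite !nth_default // (leq_trans _ kN).
by move: (e (Ordinal kN)); rewrite !ffunE => /eqP; rewrite eqn_add2r => /eqP.
Qed.

Lemma unbetaK la : size la <= N -> unbeta (beta N la) = la.
Proof. by move=> laN; have [s e] := unbetaP (decr_beta la); exact: beta_inj e. Qed.

Lemma decr_permf g s : decr g -> decr (permf g s) -> s = 1%g.
Proof.
move=> /decrP dg /decrP dgs; apply/permP => k; rewrite perm1.
apply: (incr_ord_id (t := s)) => a b ab; have := dgs a b ab; rewrite !ffunE.
by case: (ltngtP (s a) (s b)) => // [/dg|/val_inj ->]; lia.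
Qed.

Lemma inj_beta g : injective g ->
  exists la s, size la <= N /\ g = permf (beta N la) s.
Proof.
move=> gi; pose t := [tuple g k | k < N].
have /tuple_permP[s sE] : perm_eq (sort geq t) t by rewrite perm_sort.
have geqT : transitive geq by move=> ? ? ? /= ? ?; lia.
have dgs : decr (permf g s).
  apply/decrP => a b ab; rewrite !ffunE.
  have so : sorted geq (sort geq t) by apply: sort_sorted => x y /=; lia.
  have sz : size (sort geq t) = N by rewrite size_sort size_tuple.
  have nE (k : 'I_N) : nth 0 (sort geq t) k = g (s k).
    by rewrite sE -tnth_nth !tnth_mktuple.
  have := sorted_leq_nth geqT (fun x => leqnn x) 0 so a b.
  rewrite !inE sz !ltn_ord !nE => /(_ isT isT (ltnW ab)) /= le.
  rewrite ltn_neqAle le andbT; apply/eqP => /gi/perm_inj e.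
  by rewrite e ltnn in ab.
have [sz e] := unbetaP dgs; exists (unbeta (permf g s)), s^-1%g; split=> //.
by rewrite e -permfM mulVg permf1.
Qed.

Lemma beta_sum la : size la <= N -> \sum_k beta N la k = sumn la + 'C(N, 2).
Proof.
move=> laN; under eq_bigr do rewrite ffunE.
rewrite big_split /=; congr (_ + _).
  rewrite sumnE (big_nth 0) -(big_mkord xpredT (fun k => nth 0 la k)).
  rewrite (big_cat_nat (n := size la)) //= [X in _ + X]big_nat_cond [X in _ + X]big1 ?addn0 //.
  by move=> k; rewrite andbT => /andP[h _]; rewrite nth_default.
rewrite -(bin2_sum N) big_mkord [RHS](reindex_inj rev_ord_inj) /=.
by apply: eq_bigr => k _; have := ltn_ord k; lia.
Qed.

Lemma addn_at_nat_sum g i n : \sum_k addn_at g i n k = \sum_k g k + n.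
Proof.
rewrite (bigD1 i) //= [in RHS](bigD1 i) //= ffunE eqxx mul1n addnAC; congr (_ + _ + _).
by apply: eq_bigr => k ki; rewrite ffunE (negPf ki) addn0.
Qed.

Definition subn_at g i n : {ffun 'I_N -> nat} := [ffun k => g k - (k == i) * n].

Lemma subn_at_nat_sum g i n : n <= g i -> \sum_k subn_at g i n k = \sum_k g k - n.
Proof.
move=> le; have -> : g = addn_at (subn_at g i n) i n; last first.
  rewrite addn_at_nat_sum addnK; apply: eq_bigr => k _.
  by rewrite !ffunE addnK.
apply/ffunP => k; rewrite !ffunE subnK //.
by case: eqP => [->|_]; rewrite ?mul1n ?mul0n.
Qed.

End Beta.

Local Open Scope ring_scope.

(** A partition of d has at most d parts, each at most d, so padding with zeros encodes it as a
    d-tuple over ['I_d.+1]. *)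
Lemma finite_parts d : finite_set [set la : Defs.partition | sumn la = d]%classic.
Proof.
pose G (t : d.-tuple 'I_d.+1) : Defs.partition :=
  insubd empty_partition [seq x <- [seq nat_of_ord k | k <- t] | (0 < x)%N].
apply: (@sub_finite_set _ _ (G @` setT)%classic); last by apply: finite_image; exact: finite_finset.
move=> la /= lad; have /andP[so n0] := partsP la.
have pos x : x \in parts la -> (0 < x)%N.
  by case: x => // h; rewrite h in n0.
have sz (s : seq nat) : (forall x, x \in s -> 0 < x)%N -> (size s <= sumn s)%N.
  elim: s => //= x s IHs h; have := h x (mem_head _ _).
  by have := IHs (fun y ys => h y (mem_behead (s := x :: s) ys)); lia.
have le x : x \in parts la -> (x <= d)%N.
  by move=> xl; rewrite -lad (perm_sumn (perm_to_rem xl)) /= leq_addr.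
exists [tuple (inord (nth 0%N la k) : 'I_d.+1) | k < d] => //.
have nle k : (nth 0%N la k <= d)%N.
  by case: (ltnP k (size la)) => kl; [rewrite le ?mem_nth|rewrite nth_default].
have E : [seq nat_of_ord k | k <- [tuple (inord (nth 0%N la k) : 'I_d.+1) | k < d]] =
    la ++ nseq (d - size la) 0%N.
  have szd : (size la <= d)%N by rewrite -lad sz.
  apply: (@eq_from_nth _ 0%N); rewrite size_map size_tuple.
    by rewrite size_cat size_nseq subnKC.
  move=> k kd; rewrite (nth_map ord0) ?size_tuple //.
  rewrite -[k]/(nat_of_ord (Ordinal kd)) -tnth_nth tnth_mktuple inordK ?ltnS //.
  rewrite nth_cat nth_nseq if_same /=; case: ltnP => // ?.
  by rewrite nth_default.
apply/val_inj; rewrite /G /= E filter_cat.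
have -> : [seq x <- nseq (d - size la) 0%N | (0 < x)%N] = [::] by elim: (d - _)%N.
rewrite cats0; have -> : [seq x <- parts la | (0 < x)%N] = la.
  by apply/all_filterP/allP => x; exact: pos.
by rewrite val_insubd ifT //; exact: partsP.
Qed.

Definition parts_of d : seq Defs.partition :=
  fset_set [set la : Defs.partition | sumn la = d]%classic.

Lemma mem_parts_of d la : (la \in parts_of d) = (sumn la == d).
Proof.
rewrite in_fset_set; last exact: finite_parts.
by apply/idP/eqP; rewrite inE.
Qed.

Lemma parts_of_uniq d : uniq (parts_of d).
Proof. exact: fset_uniq. Qed.

Lemma big_parts_of_eq (V : nmodType) d la (F : Defs.partition -> V) :
  \sum_(mu <- parts_of d | mu == la) F mu = if sumn la == d then F la else 0.
Proof.
rewrite -mem_parts_of; case: ifP => lad.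
  rewrite big_mkcond (bigD1_seq la) ?parts_of_uniq //= eqxx big1 ?addr0 //.
  by move=> mu /negPf ->.
rewrite big_seq_cond big1 // => mu /andP[+ /eqP e]; by rewrite e lad.
Qed.

Section Alt.
Variable (A : comUnitRingType) (N : nat).
Implicit Types (c : Defs.partition -> A) (g l : {ffun 'I_N -> nat}).
Implicit Types (la mu : Defs.partition).

(* The alternating extension of a function of partitions, via beta sequences. *)
Definition alt c g : A :=
  \sum_(s : {perm 'I_N})
    (-1) ^+ (odd_perm s) * (if decr (permf g s) then c (unbeta (permf g s)) else 0).

Lemma alt_perm c g t : alt c (permf g t) = (-1) ^+ (odd_perm t) * alt c g.
Proof.
rewrite /alt big_distrr [RHS](reindex_inj (mulIg t)) /=.
apply: eq_bigr => s _; rewrite permfM mulrA; congr (_ * _).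
by rewrite odd_permM addbC signr_addb mulrA -signr_addb addbb mul1r.
Qed.

Lemma alt_beta c la : (size la <= N)%N -> alt c (beta N la) = c la.
Proof.
move=> laN; rewrite /alt (bigD1 1%g) //= big1 ?addr0.
  by rewrite permf1 decr_beta unbetaK // odd_perm1 mul1r.
move=> s s1; rewrite ifF ?mulr0 //; apply: contraNF s1 => ds.
by apply/eqP; apply: decr_permf ds; exact: decr_beta.
Qed.

Lemma alt_noninj c g : ~ injective g -> alt c g = 0.
Proof.
move=> ng; rewrite /alt big1 // => s _; rewrite ifF ?mulr0 //; apply/negP => ds.
apply: ng => a b e; apply: (@perm_inj _ s^-1%g); apply: (decr_inj ds).
by rewrite !ffunE !permKV.
Qed.

Lemma alt_eq c g a b : a != b -> g a = g b -> alt c g = 0.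
Proof. by move=> /eqP ab e; apply: alt_noninj => /(_ _ _ e). Qed.

Lemma alt_ext c c' g : (forall la, (sumn la + 'C(N, 2) = \sum_k g k)%N -> c la = c' la) ->
  alt c g = alt c' g.
Proof.
move=> e; apply: eq_bigr => s _; congr (_ * _); case: ifP => // ds; apply: e.
have [sz b] := unbetaP ds; rewrite -(beta_sum sz) b.
rewrite [RHS](reindex_inj (@perm_inj _ s)).
by apply: eq_bigr => k _; rewrite ffunE.
Qed.

(** Expanding [alt] over indicators of beta tuples allows the coefficient of each [c mu] to be
    compared with [strip_sum]. *)
Lemma altE c g d : (\sum_k g k = d + 'C(N, 2))%N ->
  alt c g = \sum_(mu <- parts_of d | (size mu <= N)%N)
    c mu * \sum_(s : {perm 'I_N}) (-1) ^+ (odd_perm s) * (permf g s == beta N mu)%:R.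
Proof.
move=> gd; under eq_bigr do rewrite big_distrr /=.
rewrite exchange_big /=; apply: eq_bigr => s _.
under eq_bigr do rewrite mulrCA.
rewrite -big_distrr /=; congr (_ * _); case: ifPn => [ds|nds]; last first.
  rewrite big1 // => mu _; case: eqP => [e|_]; last by rewrite mulr0.
  by rewrite e decr_beta in nds.
have [sz b] := unbetaP ds.
transitivity (\sum_(mu <- parts_of d | mu == unbeta (permf g s)) c mu).
  rewrite big_parts_of_eq ifT //; apply/eqP.
  apply/eqP; rewrite -(eqn_add2r 'C(N, 2)) -gd -(beta_sum sz) b.
  apply/eqP; rewrite [RHS](reindex_inj (@perm_inj _ s)).
  by apply: eq_bigr => k _; rewrite ffunE.
rewrite [RHS]big_mkcond [LHS]big_mkcond /=; apply: eq_bigr => mu _.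
case: (eqVneq mu (unbeta (permf g s))) => [->|ne]; first by rewrite sz b eqxx mulr1.
case: leqP => // muN; case: eqP => [e|]; last by rewrite mulr0.
by rewrite e unbetaK ?eqxx in ne.
Qed.

(** An injective tuple is a rearrangement of a beta tuple, so the three properties leave no freedom.
    This carries formulas proved at beta tuples over to all tuples. *)
Lemma alt_unique c (f : {ffun 'I_N -> nat} -> A) :
    (forall g s, f (permf g s) = (-1) ^+ (odd_perm s) * f g) ->
    (forall g, ~ injective g -> f g = 0) ->
    (forall la, (size la <= N)%N -> c la = f (beta N la)) ->
  forall g, alt c g = f g.
Proof.
move=> fp f0 fb g; case: (pselect (injective g)) => [gi|gn]; last first.
  by rewrite alt_noninj // f0.
have [la [s [sz ->]]] := inj_beta gi.
by rewrite alt_perm fp alt_beta // fb.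
Qed.

End Alt.

(** * Strip operators and their commutation relations *)

(* The smallest content of a box of the border strip [mu - la] with [n] boxes,
   whose contents are consecutive. *)
Definition cmin n (la mu : Defs.partition) : int :=
  ((\sum_(b <- skew_boxes mu la) content b - 'C(n, 2)%:Z) %/ n%:Z)%Z.

Lemma sum_cmin N (la mu : Defs.partition) n (i : 'I_N.+1) s (V : zmodType) (g : int -> V) :
    (size mu <= N.+1)%N -> (forall k, nth 0 la k <= nth 0 mu k)%N -> (0 < n)%N ->
    addn_at (beta N.+1 la) i n = permf (beta N.+1 mu) s ->
  cmin n la mu = (beta N.+1 la i)%:Z - N%:Z /\
  \sum_(b <- skew_boxes mu la) g (content b) = \sum_(t < n) g (cmin n la mu + t%:Z).
Proof.
move=> muN sub n0 E.
have shift (W : zmodType) (h : int -> W) :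
    \sum_(b <- skew_boxes mu la) h (content b) =
    \sum_(t < n) h ((beta N.+1 la i)%:Z - N%:Z + t%:Z).
  rewrite (big_strip_contents _ muN sub E) -{1}[beta N.+1 la i]add0n big_addn addKn.
  rewrite big_mkord; apply: eq_bigr => t _; congr h.
  by move: (beta _ _ _) => x /=; lia.
have cE : cmin n la mu = (beta N.+1 la i)%:Z - N%:Z.
  rewrite /cmin (shift _ id) big_split /= sumr_const card_ord.
  have -> : \sum_(t < n) (t : nat)%:Z = 'C(n, 2)%:Z.
    by rewrite -bin2_sum big_mkord (big_morph Posz PoszD (erefl _)).
  by rewrite addrK -mulr_natr natz mulzK // eqz_nat -lt0n.
by split=> //; rewrite cE shift.
Qed.

(** Every row of mu beyond the rows of la meets the strip, and the strip has at least one box in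
    each of its rows. *)
Lemma strip_rows_size_add (la mu : Defs.partition) n i j : (0 < n)%N ->
  strip_rows la mu n i j -> (i < size mu <= size la + n)%N.
Proof.
move=> n0 st; have occ := strip_rows_occupied n0 st; have [ji out mid top] := st.
have lt_size k : (0 < nth 0 mu k)%N -> (k < size mu)%N.
  by case: (ltnP k (size mu)) => // h; rewrite nth_default.
have oi : (nth 0 la i < nth 0 mu i)%N by rewrite occ ji leqnn.
rewrite lt_size ?(leq_ltn_trans (leq0n _) oi) //=.
case: (leqP (size mu) (size la)) => [h|lt]; first by rewrite (leq_trans h) ?leq_addr.
have /andP[_ mu0] := partsP mu.
have last0 k : (size la <= k < size mu)%N -> (j <= k <= i)%N.
  move=> /andP[lk km]; rewrite -occ (nth_default _ lk) lt0n.
  by apply: contra mu0 => /eqP <-; rewrite mem_nth.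
have h1 := last0 (size la); have h2 := last0 (size mu).-1.
have : nth 0%N la i = 0%N by rewrite nth_default //; lia.
have : (0 < nth 0 mu j)%N by apply: (@leq_ltn_trans (nth 0%N la j)); rewrite // occ leqnn.
by move: (nth 0%N mu j) (nth 0%N la i) top => x y; lia.
Qed.

Lemma permf_nat_sum N (g : {ffun 'I_N -> nat}) s :
  (\sum_k permf g s k = \sum_k g k)%N.
Proof.
rewrite [RHS](reindex_inj (@perm_inj _ s)).
by apply: eq_bigr => k _; rewrite ffunE.
Qed.

Lemma permf_subn_at N (l m : {ffun 'I_N -> nat}) n i (s : {perm 'I_N}) :
    (n <= l (s i))%N ->
  (permf (subn_at l (s i) n) s == m) = (addn_at m i n == permf l s).
Proof.
move=> il; apply/eqP/eqP => [<-|E]; apply/ffunP => k; last first.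
  move/ffunP/(_ k): E; rewrite !ffunE (inj_eq perm_inj).
  by move: (l (s k)) (m k) (k == i) => x y b; lia.
rewrite !ffunE (inj_eq perm_inj); case: (eqVneq k i) => [->|_]; last by lia.
by move: (l (s i)) il => x; lia.
Qed.

Section Operators.
Variable A : comUnitRingType.
Implicit Types (c : Defs.partition -> A) (la mu : Defs.partition).

Definition strip n la mu : A :=
  if `[< add_strip la n mu >] then (-1) ^+ height (skew_boxes mu la) else 0.

(** At most one pair (i, s) satisfies the equation: i is the bottom row of the strip and s the cycle
    that sorts the raised tuple. Its sign is (-1)^ht, and entry i minus N is the smallest
    content. *)
Lemma strip_sum N la mu n (f : int -> A) :
    (size la <= N.+1)%N -> (size mu <= N.+1)%N -> (0 < n)%N ->
  \sum_(i < N.+1) \sum_(s : {perm 'I_N.+1})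
    (-1) ^+ (odd_perm s) * (addn_at (beta N.+1 la) i n == permf (beta N.+1 mu) s)%:R
      * f ((beta N.+1 la i)%:Z - N%:Z) =
  strip n la mu * f (cmin n la mu).
Proof.
move=> laN muN n0; rewrite /strip; case: asboolP => [h|nh]; last first.
  rewrite mul0r big1 // => i _; rewrite big1 // => s _.
  case: eqP => [E|_]; last by rewrite mulr0 mul0r.
  have [st _] := beta_perm_strip_rows laN muN n0 E.
  by case: nh; exact: (strip_rows_add_strip n0 st).
have [i [j st]] := add_strip_rows n0 h; have [ji _ _ _] := st.
have /andP[imu _] := strip_rows_size_add n0 st.
have iN : (i < N.+1)%N := leq_trans imu muN.
have jN : (j < N.+1)%N := leq_ltn_trans ji iN.
pose i0 := Ordinal iN; pose j0 := Ordinal jN; pose s0 := lift_perm i0 j0 1%g.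
have E0 : addn_at (beta N.+1 la) i0 n = permf (beta N.+1 mu) s0.
  exact: (@strip_rows_beta N la mu n i0 j0 st).
have uniq_is i' s : addn_at (beta N.+1 la) i' n = permf (beta N.+1 mu) s ->
    i' = i0 /\ s = s0.
  move=> /(beta_perm_strip_rows laN muN n0) [st' sE].
  have [ji' _ _ _] := st'.
  have occ' := strip_rows_occupied n0 st'; have occ := strip_rows_occupied n0 st.
  have ii' : i' = i0.
    apply/val_inj/eqP; rewrite eqn_leq /=.
    have := occ i'; rewrite occ' ji' leqnn /= => /esym/andP[_ ->].
    by have := occ i; rewrite occ' ji leqnn /= => /andP[_ ->].
  split=> //; rewrite sE ii'; congr (lift_perm _ _ _).
  apply/val_inj/eqP; rewrite eqn_leq /= -ii'.
  have := occ j; rewrite occ' ji leqnn /= => /andP[-> _].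
  by have := occ (s i'); rewrite occ' ji' leqnn /= => /esym/andP[-> _].
rewrite (bigD1 i0) //= [X in _ + X]big1 ?addr0; last first.
  move=> i' ii'; rewrite big1 // => s _; case: eqP => [/uniq_is[e _]|_].
    by rewrite e eqxx in ii'.
  by rewrite mulr0 mul0r.
rewrite (bigD1 s0) //= [X in _ + X]big1 ?addr0; last first.
  move=> s ss; case: eqP => [/uniq_is[_ e]|_]; last by rewrite mulr0 mul0r.
  by rewrite e eqxx in ss.
have sub := strip_rows_sub n0 st.
have [-> _] := sum_cmin (fun=> 0 : A) muN sub n0 E0.
rewrite E0 eqxx mulr1 odd_lift_perm odd_perm1 addbF (height_strip_rows n0 st).
by rewrite -[in RHS]signr_odd oddB.
Qed.

Lemma strip_neq0 n la mu : (0 < n)%N -> strip n la mu != 0 ->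
  [/\ (size la <= size mu)%N, (size mu <= size la + n)%N & sumn mu = (sumn la + n)%N].
Proof.
move=> n0; rewrite /strip; case: asboolP => [h _|]; last by rewrite eqxx.
have [i [j st]] := add_strip_rows n0 h.
have /andP[imu mula] := strip_rows_size_add n0 st; have [ji _ _ _] := st.
have sub := strip_rows_sub n0 st.
have lamu : (size la <= size mu)%N.
  rewrite leqNgt; apply/negP => lt; have := sub (size mu).
  have /andP[_] := partsP la; rewrite (nth_default 0 (leqnn (size mu))) leqn0.
  by move=> /negP la0 /eqP e; apply: la0; rewrite -e mem_nth.
split=> //; pose N := size mu.
have muN : (size mu <= N.+1)%N by rewrite leqnSn.
have laN : (size la <= N.+1)%N := leq_trans lamu muN.
have iN : (i < N.+1)%N := leq_trans imu muN.
have jN : (j < N.+1)%N := leq_ltn_trans ji iN.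
have := strip_rows_beta (i := Ordinal iN) (j := Ordinal jN) st.
set s := lift_perm _ _ _ => E.
have := permf_nat_sum (beta N.+1 mu) s; rewrite -E addn_at_nat_sum !beta_sum // => /eqP.
by rewrite addnAC eqn_add2r => /eqP.
Qed.

(* [x = 1] gives the matrix of multiplication by a power sum in the Schur basis. *)
Definition rem_strips n (x : A) c la : A :=
  \sum_(mu <- parts_of (sumn la - n)) strip n mu la * x ^ cmin n mu la * c mu.

Definition add_strips n c la : A :=
  \sum_(mu <- parts_of (sumn la + n)) strip n la mu * c mu.

Lemma rem_strips_alt N n x c la : (0 < n)%N -> (size la <= N.+1)%N ->
  rem_strips n x c la = \sum_(i < N.+1 | (n <= beta N.+1 la i)%N)
    x ^ ((beta N.+1 la i)%:Z - n%:Z - N%:Z) * alt c (subn_at (beta N.+1 la) i n).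
Proof.
move=> n0 laN; set l := beta N.+1 la.
have lsum := beta_sum laN; rewrite -/l in lsum.
(* For n > |la| the index [sumn la - n] is truncated to 0, so this case is separate: there is no
   strip on the left, and on the right an injective lowered tuple would have too small a sum. *)
case: (leqP n (sumn la)) => nla; last first.
  rewrite /rem_strips big1 => [|mu _]; last first.
    have -> : strip n mu la = 0; last by rewrite !mul0r.
    by apply: contraTeq nla => /(strip_neq0 n0)[_ _ ->]; rewrite -leqNgt leq_addl.
  rewrite big1 // => i il; rewrite alt_noninj ?mulr0 // => inj.
  have [mu [s [muN e]]] := inj_beta inj.
  have := subn_at_nat_sum il; rewrite e permf_nat_sum beta_sum // lsum.
  have : (n <= \sum_k l k)%N by rewrite (bigD1 i) //= (leq_trans il) ?leq_addr.
  by rewrite lsum; lia.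
rewrite /rem_strips.
have altE' i : (n <= l i)%N -> alt c (subn_at l i n) =
    \sum_(mu <- parts_of (sumn la - n) | (size mu <= N.+1)%N) c mu *
      \sum_s (-1) ^+ odd_perm s * (permf (subn_at l i n) s == beta N.+1 mu)%:R.
  by move=> il; apply: altE; rewrite subn_at_nat_sum // lsum; lia.
under [RHS]eq_bigr => i il do rewrite altE' // big_distrr /=.
rewrite exchange_big [LHS](bigID (fun mu : Defs.partition => (size mu <= N.+1)%N)) /=.
rewrite [X in _ + X]big1 ?addr0 => [|mu /negP muN]; last first.
  have -> : strip n mu la = 0; last by rewrite !mul0r.
  by apply/eqP; apply: contraPT laN => /(strip_neq0 n0)[h _ _] /(leq_trans h).
apply: eq_bigr => mu muN.
rewrite -(strip_sum (N := N) (fun z => x ^ z)) // exchange_big /=.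
under [RHS]eq_bigr => i il do rewrite mulrCA big_distrr /=.
rewrite -big_distrr /= mulrC; congr (_ * _); rewrite [RHS]exchange_big /=.
apply: eq_bigr => s _; rewrite [RHS](reindex_inj (@perm_inj _ s)) /=.
rewrite [RHS]big_mkcond; apply: eq_bigr => i _ /=.
case: ifP => il; last first.
  case: eqP => [/ffunP/(_ i)|_]; last by rewrite mulr0 mul0r.
  by rewrite [LHS]ffunE [RHS]ffunE eqxx mul1n => e; rewrite -e leq_addl in il.
rewrite -permf_subn_at // -/l mulrC; case: eqP => [<-|_]; last by rewrite !mulr0.
rewrite ffunE ffunE eqxx mul1n; congr (x ^ _ * _).
by move: (l (s i)) il => y; lia.
Qed.

(** A strip of n boxes can reach n new rows, hence the bound on [size la + n]: shorter tuples would
    miss the partitions mu that are too long. *)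
Lemma add_strips_alt N n c la : (0 < n)%N -> (size la + n <= N.+1)%N ->
  add_strips n c la = \sum_(i < N.+1) alt c (addn_at (beta N.+1 la) i n).
Proof.
move=> n0 laN; set l := beta N.+1 la.
have laN' : (size la <= N.+1)%N := leq_trans (leq_addr _ _) laN.
have lsum := beta_sum laN'; rewrite -/l in lsum.
have altE' i : alt c (addn_at l i n) =
    \sum_(mu <- parts_of (sumn la + n) | (size mu <= N.+1)%N) c mu *
      \sum_s (-1) ^+ odd_perm s * (permf (addn_at l i n) s == beta N.+1 mu)%:R.
  by apply: altE; rewrite addn_at_nat_sum lsum addnAC.
under [RHS]eq_bigr => i _ do rewrite altE' /=.
rewrite exchange_big [LHS](bigID (fun mu : Defs.partition => (size mu <= N.+1)%N)) /=.
rewrite [X in _ + X]big1 ?addr0 => [|mu /negP muN]; last first.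
  have -> : strip n la mu = 0; last by rewrite !mul0r.
  by apply/eqP; apply: contraPT laN => /(strip_neq0 n0)[_ h _] /(leq_trans h).
apply: eq_bigr => mu muN; rewrite -big_distrr mulrC /=; congr (_ * _).
rewrite -[LHS]mulr1 -(strip_sum (N := N) (fun=> 1)) //.
apply: eq_bigr => i _; rewrite [RHS](reindex_inj invg_inj).
apply: eq_bigr => s _; rewrite mulr1 odd_permV; congr (_ * (nat_of_bool _)%:R).
apply/eqP/eqP => [->|<-]; by rewrite -permfM ?mulgV ?mulVg permf1.
Qed.

End Operators.

(** * Strip operators on all tuples and their commutators *)

Section Commutators.
Variable A : comUnitRingType.
Hypothesis two_unit : (2%:R : A) \is a GRing.unit.
Implicit Types (c : Defs.partition -> A) (la mu : Defs.partition).

Lemma opp_eq0 (x : A) : x = - x -> x = 0.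
Proof.
move=> /eqP; rewrite -addr_eq0 -mulr2n -mulr_natl => /eqP e.
by rewrite -(mulKr two_unit x) e mulr0.
Qed.

(** Swapping two equal entries fixes the tuple and changes the sign, so the value is its own
    opposite and vanishes because 2 is invertible. *)
Lemma noninj_perm_eq0 N (f : {ffun 'I_N -> nat} -> A)
    (g : {ffun 'I_N -> nat}) :
    (forall (g : {ffun 'I_N -> nat}) s, f (permf g s) = (-1) ^+ (odd_perm s) * f g) ->
  ~ injective g -> f g = 0.
Proof.
move=> fp ng; have /injectivePn[a [b ab e]] : ~~ injectiveb g by apply/injectiveP.
apply: opp_eq0.
have {1}-> : g = permf g (tperm a b).
  by apply/ffunP => k; rewrite ffunE; case: tpermP => [->|->|//].
by rewrite fp odd_tperm ab expr1 mulN1r.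
Qed.

Lemma subn_at_permf N (g : {ffun 'I_N -> nat}) i n (s : {perm 'I_N}) :
  subn_at (permf g s) i n = permf (subn_at g (s i) n) s.
Proof. by apply/ffunP => k; rewrite !ffunE (inj_eq perm_inj). Qed.

Lemma alt_rem_strips N n x c (g : {ffun 'I_N.+1 -> nat}) : (0 < n)%N ->
  alt (rem_strips n x c) g = \sum_(i | (n <= g i)%N)
    x ^ ((g i)%:Z - n%:Z - N%:Z) * alt c (subn_at g i n).
Proof.
move=> n0; move: g.
pose f (g : {ffun 'I_N.+1 -> nat}) := \sum_(i | (n <= g i)%N)
  x ^ ((g i)%:Z - n%:Z - N%:Z) * alt c (subn_at g i n).
have fp (g : {ffun 'I_N.+1 -> nat}) s : f (permf g s) = (-1) ^+ (odd_perm s) * f g.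
  rewrite /f big_distrr [RHS](reindex_inj (@perm_inj _ s)) /=.
  apply: eq_big => [i|i _]; first by rewrite ffunE.
  by rewrite subn_at_permf alt_perm ffunE mulrCA.
apply: (alt_unique fp) => [g|la laN]; first exact: (noninj_perm_eq0 fp).
exact: rem_strips_alt.
Qed.

(** The formula needs k empty rows at the bottom of the sorted partition. The inequality asks the
    last k entries of [g] to be at most those of the staircase; for injective [g] they are then
    exactly k-1, ..., 0, and these values can only come from empty rows. For other [g] both sides
    vanish by antisymmetry. *)
Lemma alt_add_strips N k c (g : {ffun 'I_N.+1 -> nat}) : (0 < k)%N ->
    ~ injective g \/ ((k <= N.+1)%N /\ forall i : 'I_N.+1, (N < i + k)%N -> (g i + i <= N)%N) ->
  alt (add_strips k c) g = \sum_i alt c (addn_at g i k).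
Proof.
move=> k0; pose f g := \sum_i alt c (@addn_at N.+1 g i k); rewrite -/(f g).
have fp (h : {ffun 'I_N.+1 -> nat}) s : f (permf h s) = (-1) ^+ (odd_perm s) * f h.
  rewrite /f big_distrr [RHS](reindex_inj (@perm_inj _ s)) /=.
  by apply: eq_bigr => i _; rewrite -permf_addn_at alt_perm.
case: (pselect (injective g)) => [gi|gn _]; last first.
  by rewrite alt_noninj // (noninj_perm_eq0 fp).
case=> [//|[kN gb]]; have [la [s [laN gE]]] := inj_beta gi.
rewrite gE fp alt_perm; congr (_ * _); rewrite alt_beta //; apply: add_strips_alt => //.
have gb_eq (i : 'I_N.+1) : (N < i + k)%N -> (g i + i = N)%N.
  have [d] : exists d, (N - i)%N = d by eexists.
  elim/ltn_ind: d i => d IHd i dE ki; have iN := ltn_ord i.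
  have := gb i ki; rewrite leq_eqVlt => /orP[/eqP //|lt].
  (* If [g i] were smaller than N - i, the later index N - g i would already carry this value. *)
  have jN : (N - g i < N.+1)%N by rewrite ltnS leq_subr.
  pose j : 'I_N.+1 := Ordinal jN.
  have e : g j = g i.
    have := IHd (g i) _ j; have : nat_of_ord j = (N - g i)%N by [].
    by move: (nat_of_ord j) (g j) (g i) lt => z x y /=; lia.
  have /(congr1 (@nat_of_ord _)) /= := gi _ _ e.
  by move: (g i) lt => x; lia.
have lb t : (t < k)%N -> nth 0%N la (N - t) = 0%N.
  elim/ltn_ind: t => t IHt tk.
  have jN : (N - t < N.+1)%N by rewrite ltnS leq_subr.
  have := gb_eq (Ordinal jN); rewrite gE !ffunE /= => E.
  have {E} E : (nth 0 la (s (Ordinal jN)) + (N - s (Ordinal jN)) = t)%N by lia.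
  have := ltn_ord (s (Ordinal jN)); move: (s _) E => [a aN] /= E _.
  case: (eqVneq (N - a)%N t) => [e|ne]; first by rewrite -e subKn //; lia.
  have at_ : (N - a < t)%N by lia.
  by have := IHt (N - a)%N at_; rewrite subKn //; lia.
rewrite leqNgt; apply/negP => lt.
have h : (N.+1 - k < size la)%N by lia.
have := lb k.-1; have -> : (N - k.-1 = N.+1 - k)%N by lia.
have /andP[_ /negP la0] := partsP la; move=> e; apply: la0.
by rewrite -e ?mem_nth //; lia.
Qed.

Lemma subn_atC N (l : {ffun 'I_N -> nat}) i j n m :
  subn_at (subn_at l i n) j m = subn_at (subn_at l j m) i n.
Proof. by apply/ffunP => k; rewrite !ffunE subnAC. Qed.

Lemma subn_at2 N (l : {ffun 'I_N -> nat}) i n m :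
  subn_at (subn_at l i n) i m = subn_at l i (n + m).
Proof. by apply/ffunP => k; rewrite !ffunE -subnDA mulnDr. Qed.

Lemma rem_strips_comm n m x y c la : (0 < n)%N -> (0 < m)%N ->
    x \is a GRing.unit -> y \is a GRing.unit ->
  rem_strips n x (rem_strips m y c) la - rem_strips m y (rem_strips n x c) la =
  (x ^+ m - y ^+ n) * rem_strips (n + m) (x * y) c la.
Proof.
move=> n0 m0 xU yU; pose N := size la.
have laN : (size la <= N.+1)%N by rewrite leqnSn.
rewrite !(rem_strips_alt (N := N)) ?addn_gt0 ?n0 //; set l := beta N.+1 la.
pose T n m x y i j : A := if (n <= l i)%N && (m <= subn_at l i n j)%N then
  x ^ ((l i)%:Z - n%:Z - N%:Z) * (y ^ ((subn_at l i n j)%:Z - m%:Z - N%:Z) *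
    alt c (subn_at (subn_at l i n) j m)) else 0.
have E n' m' x' y' : (0 < m')%N ->
    \sum_(i < N.+1 | (n' <= l i)%N) x' ^ ((l i)%:Z - n'%:Z - N%:Z) *
       alt (rem_strips m' y' c) (subn_at l i n') = \sum_i \sum_j T n' m' x' y' i j.
  move=> m'0; rewrite big_mkcond; apply: eq_bigr => i _.
  case: ifP => il; last by rewrite big1 // => j _; rewrite /T il.
  rewrite alt_rem_strips // big_distrr big_mkcond; apply: eq_bigr => j _ /=.
  by rewrite /T il.
rewrite !E // [X in _ - X]exchange_big -sumrB big_distrr [RHS]big_mkcond /=.
(* Moves of two different entries do not interact, so only [j = i] survives. *)
apply: eq_bigr => i _; rewrite -sumrB (bigD1 i) //= big1 ?addr0 => [|j ji]; last first.
  apply/eqP; rewrite subr_eq0; apply/eqP; rewrite /T subn_atC.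
  have -> : subn_at l i n j = l j by rewrite ffunE (negPf ji) subn0.
  have -> : subn_at l j m i = l i by rewrite ffunE eq_sym (negPf ji) subn0.
  by rewrite andbC mulrCA.
rewrite /T !subn_at2 (addnC m).
have -> : subn_at l i n i = (l i - n)%N by rewrite ffunE eqxx mul1n.
have -> : subn_at l i m i = (l i - m)%N by rewrite ffunE eqxx mul1n.
have -> : (n <= l i)%N && (m <= l i - n)%N = (n + m <= l i)%N by lia.
have -> : (m <= l i)%N && (n <= l i - m)%N = (n + m <= l i)%N by lia.
case: ifP => // le; last by rewrite subr0.
rewrite !mulrA -mulrBl; congr (_ * _).
(* z is the smallest content of the whole strip of n + m boxes. In either order the second removal
   starts at z and the first at z + m or z + n, so the weights differ by x^m against y^n. *)
set z : int := (l i)%:Z - (n + m)%N%:Z - N%:Z.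
have -> : (l i)%:Z - n%:Z - N%:Z = m%:Z + z by rewrite /z; lia.
have -> : (l i)%:Z - m%:Z - N%:Z = n%:Z + z by rewrite /z; lia.
have -> : (l i - n)%N%:Z - m%:Z - N%:Z = z by rewrite /z; lia.
have -> : (l i - m)%N%:Z - n%:Z - N%:Z = z by rewrite /z; lia.
clearbody z; have -> : (x * y) ^ z = x ^ z * y ^ z by rewrite exprMz_comm //; apply: mulrC.
by rewrite !exprzDr // -!exprnP; ring.
Qed.

End Commutators.

(** * Heisenberg relations *)

Section Heisenberg.
Variable A : comUnitRingType.
Implicit Types (c : Defs.partition -> A) (la mu : Defs.partition).

Lemma beta_bottom N la (i : 'I_N.+1) : (size la <= i)%N -> beta N.+1 la i = (N - i)%N.
Proof. by move=> h; rewrite ffunE nth_default. Qed.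

(** An injective lowered tuple would be a rearrangement of a beta tuple and so have sum at least
    C(N+1, 2). *)
Lemma subn_at_noninj N n la (j : 'I_N.+1) : (size la <= N.+1)%N ->
  (n <= beta N.+1 la j)%N -> (sumn la < n)%N -> ~ injective (subn_at (beta N.+1 la) j n).
Proof.
move=> laN jl nla inj; have [mu [s [muN e]]] := inj_beta inj.
have := subn_at_nat_sum jl; rewrite e permf_nat_sum !beta_sum //.
have : (n <= \sum_k beta N.+1 la k)%N by rewrite (bigD1 j) //= (leq_trans jl) ?leq_addr.
by rewrite beta_sum //; lia.
Qed.

Lemma rem_strips_gt n x c la : (0 < n)%N -> (sumn la < n)%N -> rem_strips n x c la = 0.
Proof.
move=> n0 nla; rewrite /rem_strips big1 // => mu _.
have -> : strip A n mu la = 0; last by rewrite !mul0r.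
by apply: contraTeq nla => /(strip_neq0 n0)[_ _ ->]; rewrite -leqNgt leq_addl.
Qed.

Hypothesis two_unit : (2%:R : A) \is a GRing.unit.

Lemma alt_add_strips_subn N k c la (j : 'I_N.+1) n :
    (0 < k)%N -> (size la + k <= N.+1)%N ->
  alt (add_strips k c) (subn_at (beta N.+1 la) j n) =
  \sum_i alt c (addn_at (subn_at (beta N.+1 la) j n) i k).
Proof.
move=> k0 laN; apply: alt_add_strips => //; right; split=> [|i ki].
  by apply: leq_trans laN; rewrite leq_addl.
rewrite ffunE; have := ltn_ord i.
rewrite beta_bottom; last by lia.
by move: (i == j) => b; lia.
Qed.

Lemma add_rem_strips_comm k n c la : (0 < k)%N -> (0 < n)%N ->
  add_strips k (rem_strips n 1 c) la - rem_strips n 1 (add_strips k c) la =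
  (k == n)%:R * (k%:R * c la).
Proof.
(* With N + 1 = size la + k there are exactly k empty rows, and they hold exactly the entries
   smaller than k. Their number becomes the central term. *)
move=> k0 n0; pose N := (size la + k).-1.
have NE : N.+1 = (size la + k)%N by rewrite /N; lia.
have laN : (size la <= N.+1)%N by lia.
have laN2 : (size la + k <= N.+1)%N by rewrite NE.
rewrite (add_strips_alt _ k0 laN2) (rem_strips_alt _ _ n0 laN); set l := beta N.+1 la.
pose T1 i j : A := if (n <= addn_at l i k j)%N then
  alt c (subn_at (addn_at l i k) j n) else 0.
pose T2 i j : A := if (n <= l j)%N then alt c (addn_at (subn_at l j n) i k) else 0.
transitivity (\sum_i \sum_j (T1 i j - T2 i j)).
  under [RHS]eq_bigr do rewrite sumrB.
  rewrite sumrB; congr (_ - _).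
    apply: eq_bigr => i _; rewrite alt_rem_strips // big_mkcond; apply: eq_bigr => j _.
    by rewrite exp1rz mul1r.
  rewrite [RHS]exchange_big big_mkcond; apply: eq_bigr => j _ /=; rewrite /T2.
  case: ifP => jl; last by rewrite big1.
  by rewrite exp1rz mul1r alt_add_strips_subn.
transitivity (\sum_i (T1 i i - T2 i i)).
  apply: eq_bigr => i _; rewrite (bigD1 i) //= big1 ?addr0 // => j ji.
  have E1 : addn_at l i k j = l j by rewrite ffunE (negPf ji) addn0.
  rewrite /T1 /T2 E1; case: ifP => jl; last by rewrite subr0.
  apply/eqP; rewrite subr_eq0; apply/eqP; congr alt; apply/ffunP => a.
  rewrite !ffunE; case: (eqVneq a j) => [->|_]; last by rewrite !mul0n !subn0.
  by rewrite (negPf ji) !addn0.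
transitivity (\sum_(i < N.+1) (k == n)%:R * ((size la <= i)%N%:R * c la)).
  apply: eq_bigr => i _; rewrite /T1 /T2 ffunE eqxx mul1n.
  have iN := ltn_ord i; have lik : (l i < k)%N = (size la <= i)%N.
    rewrite ffunE; case: (leqP (size la) i) => h; first by rewrite nth_default //; lia.
    have : (0 < nth 0 la i)%N.
      have /andP[_ la0] := partsP la; rewrite lt0n.
      by apply: contra la0 => /eqP <-; rewrite mem_nth.
    by lia.
  (* If entry i can be lowered by n at once, both orders give the same tuple; otherwise only raising
     by k before lowering by n is possible. *)
  case: (leqP n (l i)) => nli.
    rewrite (leq_trans nli) ?leq_addr //.
    have -> : subn_at (addn_at l i k) i n = addn_at (subn_at l i n) i k.
      apply/ffunP => a; rewrite !ffunE; case: (eqVneq a i) => [->|_].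
        by move: nli; rewrite ffunE; lia.
      by rewrite !mul0n !subn0 !addn0.
    rewrite subrr; case: (eqVneq k n) => [e|]; last by rewrite mul0r.
    by rewrite -lik e ltnNge nli /= mul0r mulr0.
  rewrite subr0; case: (leqP n (l i + k)) => nk; last first.
    by case: (eqVneq k n) nk nli => [->|]; [lia|rewrite mul0r].
  case: (eqVneq k n) => [e|ne]; last first.
    (* The entry would end at l_i + k - n, which is below k and hence already the entry of the empty
       row b: the tuple has a repeated entry. *)
    rewrite mul0r; have wN : (N - (l i + k - n) < N.+1)%N by rewrite ltnS leq_subr.
    have le : (l i + k - n < k)%N by lia.
    pose b : 'I_N.+1 := Ordinal wN.
    have lb : l b = (l i + k - n)%N by rewrite beta_bottom /=; lia.
    have bi : b != i.
      by apply: contra_not_neq (_ : l b <> l i) => [->//|]; rewrite lb; lia.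
    apply: (alt_eq _ bi); rewrite !ffunE eqxx (negPf bi) !mul0n addn0 subn0 !mul1n.
    by move: lb; rewrite ![in RHS]ffunE ffunE.
  rewrite -lik e nli !mul1r; have -> : subn_at (addn_at l i n) i n = l.
    by apply/ffunP => a; rewrite !ffunE addnK.
  exact: alt_beta.
rewrite -big_distrr /= -big_distrl /= -natr_sum; congr (_ * (_%:R * _)).
rewrite -(big_mkord xpredT (fun i => nat_of_bool (size la <= i)%N)).
rewrite (big_cat_nat (n := size la)) //= big_nat_cond big1 ?add0n => [|i]; last first.
  by rewrite andbT => /andP[_]; rewrite ltnNge => /negPf ->.
rewrite big_nat_cond (eq_bigr (fun=> 1%N)) => [|i /andP[/andP[-> _] _] //].
by rewrite -big_nat_cond sum_nat_const_nat NE addKn muln1.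
Qed.

(* Together with [alt c l] the two sums run over all pairs of entries with sum
   [l i + l j], and this total vanishes by antisymmetry. *)
Lemma sum_moves N c (l : {ffun 'I_N -> nat}) (i j : 'I_N) : i != j ->
  \sum_(1 <= n < (l j).+1) alt c (addn_at (subn_at l j n) i n) +
  \sum_(1 <= n < (l i).+1) alt c (addn_at (subn_at l i n) j n) = - alt c l.
Proof.
move=> ij; pose s := (l i + l j)%N.
pose u k : {ffun 'I_N -> nat} :=
  [ffun a => if a == i then k else if a == j then (s - k)%N else l a].
have ul : u (l i) = l.
  apply/ffunP => a; rewrite ffunE; case: eqP => [->//|_].
  by case: eqP => [->|//]; rewrite /s addKn.
have S1 : \sum_(1 <= n < (l j).+1) alt c (addn_at (subn_at l j n) i n) =
    \sum_((l i).+1 <= k < s.+1) alt c (u k).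
  rewrite -[(l i).+1 in RHS]add1n big_addn; have -> : (s.+1 - l i = (l j).+1)%N by rewrite /s; lia.
  apply: eq_big_nat => n /andP[_ nj]; congr alt; apply/ffunP => a; rewrite !ffunE.
  case: (eqVneq a i) => [->|_]; first by rewrite (negPf ij) subn0 mul1n addnC.
  by rewrite mul0n addn0; case: eqP => [->|_]; rewrite ?subn0 // /s; lia.
have S2 : \sum_(1 <= n < (l i).+1) alt c (addn_at (subn_at l i n) j n) =
    \sum_(0 <= k < l i) alt c (u k).
  rewrite big_add1 /= [RHS]big_nat_rev /=; apply: eq_big_nat => n /andP[_ ni].
  congr alt; apply/ffunP => a; rewrite !ffunE add0n.
  case: (eqVneq a i) => [->|_]; first by rewrite (negPf ij) addn0 mul1n.
  by case: eqP => [->|_]; rewrite ?mul0n ?subn0 ?addn0 // /s; lia.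
have tot : \sum_(0 <= k < s.+1) alt c (u k) = 0.
  apply: (opp_eq0 two_unit); rewrite {1}big_nat_rev /= -sumrN.
  apply: eq_big_nat => k /andP[_ ks]; rewrite add0n subSS -mulN1r.
  have -> : u (s - k)%N = permf (u k) (tperm i j).
    apply/ffunP => a; rewrite !ffunE; case: (tpermP i j a) => [->|->|ai aj].
    - by rewrite eqxx eq_sym (negPf ij) eqxx.
    - by rewrite eqxx eq_sym (negPf ij) eqxx subKn.
    - by case: eqP ai => // _ _; case: eqP aj.
  by rewrite alt_perm odd_tperm ij expr1.
rewrite S1 S2; apply/eqP; rewrite -addr_eq0; apply/eqP.
apply: etrans tot; rewrite [RHS](big_cat_nat (n := l i)) //=; last by rewrite /s; lia.
rewrite [X in _ = _ + X]big_ltn; last by rewrite /s; lia.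
by rewrite ul; ring.
Qed.

(* In terms of the bosons, [sum_n p_n p_n^perp] is the degree operator. *)
Lemma rem_strips_add_sum L c la : (sumn la < L)%N ->
  \sum_(1 <= n < L) rem_strips n 1 (add_strips n c) la = (sumn la)%:R * c la.
Proof.
move=> laL; case: (posnP (sumn la)) => [s0|s0].
  rewrite s0 mul0r big_nat_cond big1 // => n; rewrite andbT => /andP[n0 _].
  by rewrite rem_strips_gt // s0.
pose N := (size la + sumn la).-1.
have NE : N.+1 = (size la + sumn la)%N by rewrite /N; lia.
have laN : (size la <= N.+1)%N by lia.
pose l := beta N.+1 la; pose M := (maxn L (\sum_k l k).+1).
have lM j : (l j < M)%N by rewrite /M leq_max ltnS (bigD1 j) //= leq_addr orbT.
transitivity (\sum_(1 <= n < M) rem_strips n 1 (add_strips n c) la).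
  rewrite [RHS](big_cat_nat (n := L)) ?leq_maxl //=; last by lia.
  rewrite [X in _ + X]big_nat_cond [X in _ + X]big1 ?addr0 // => n.
  by rewrite andbT => /andP[Ln _]; rewrite rem_strips_gt //; lia.
pose S i j := \sum_(1 <= n < (l j).+1) alt c (addn_at (subn_at l j n) i n).
transitivity (\sum_j \sum_i S i j).
  transitivity (\sum_(1 <= n < M) \sum_(j | (n <= l j)%N) \sum_i
      alt c (addn_at (subn_at l j n) i n)).
    apply: eq_big_nat => n /andP[n0 nM]; rewrite (rem_strips_alt (N := N)) //.
    apply: eq_bigr => j jl; rewrite exp1rz mul1r.
    (* For n > |la| there may be too few rows for the new strip, but then the lowered tuple has a
       repeated entry. *)
    case: (leqP n (sumn la)) => nla.
      by rewrite alt_add_strips_subn // NE leq_add2l.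
    by apply: alt_add_strips => //; left; exact: subn_at_noninj.
  rewrite (exchange_big_dep xpredT) //=; apply: eq_bigr => j _.
  by rewrite [RHS]exchange_big /= [RHS](big_nat_widen _ _ M) //.
rewrite exchange_big /=.
transitivity (\sum_i (S i i + \sum_(j | j != i) S i j)).
  by apply: eq_bigr => i _; rewrite (bigD1 i).
have lc : alt c l = c la by exact: alt_beta.
rewrite big_split /=.
have -> : \sum_i S i i = (\sum_i l i)%N%:R * c la.
  rewrite natr_sum big_distrl; apply: eq_bigr => i _ /=; rewrite /S.
  rewrite -lc mulr_natl; transitivity (\sum_(1 <= n < (l i).+1) alt c l);
    last by rewrite sumr_const_nat subSS subn0.
  apply: eq_big_nat => n /andP[_ ni]; congr alt; apply/ffunP => a; rewrite !ffunE.
  by case: (eqVneq a i) => [->|_]; [move: ni; rewrite ffunE; lia|rewrite subn0 addn0].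
(* By [sum_moves] each unordered pair of rows contributes - c la, which removes the staircase part
   C(N+1, 2) from the sum of the entries and leaves |la|. *)
suff -> : \sum_i \sum_(j | j != i) S i j = - ('C(N.+1, 2))%:R * c la.
  by rewrite beta_sum // natrD; ring.
apply: (mulrI two_unit); rewrite mulrA mulrN -natrM -mul_bin_diag bin1 /=.
transitivity (\sum_(i < N.+1) \sum_(j | j != i) (S i j + S j i)).
  under [RHS]eq_bigr do rewrite big_split /=.
  rewrite big_split /= [X in _ = _ + X](exchange_big_dep xpredT) //=.
  rewrite -[2%:R]/(1 + 1) mulrDl mul1r; congr (_ + _).
  by apply: eq_bigr => i _; apply: eq_bigl => j; rewrite eq_sym.
transitivity (\sum_(i < N.+1) \sum_(j < N.+1 | j != i) - c la).
  by apply: eq_bigr => i _; apply: eq_bigr => j ji; rewrite /S sum_moves ?lc // eq_sym.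
under eq_bigr => i _ do rewrite sumr_const cardC1 card_ord /=.
by rewrite sumr_const card_ord -mulrnA mulNr mulr_natl mulNrn mulnC.
Qed.

End Heisenberg.

(** * Kostka numbers *)

Local Open Scope nat_scope.

Definition letters (u : seq nat) : seq nat :=
  flatten (mkseq (fun i => nseq (nth 0 u i) i) (size u)).

Lemma count_letters u x : count_mem x (letters u) = nth 0 u x.
Proof.
rewrite /letters count_flatten -map_comp sumnE big_map.
rewrite (eq_bigr (fun i => (i == x) * nth 0 u i)) => [|i _]; last by rewrite /= count_nseq.
case: (ltnP x (size u)) => xu; last first.
  rewrite nth_default // big_seq big1 // => i; rewrite mem_iota => /andP[_].
  by case: eqP => // ->; rewrite add0n ltnNge xu.
rewrite (bigD1_seq x) ?iota_uniq ?mem_iota //= eqxx mul1n big1 ?addn0 //.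
by move=> i /negPf ->.
Qed.

Lemma letters_rcons u k : letters (rcons u k) = letters u ++ nseq k (size u).
Proof.
rewrite /letters size_rcons mkseqS flatten_rcons nth_rcons ltnn eqxx.
congr (flatten _ ++ _); apply/eq_in_map => i; rewrite mem_iota => /andP[_ iu].
by rewrite nth_rcons iu.
Qed.

Lemma letters_lt u x : x \in letters u -> x < size u.
Proof. by case/flatten_mapP => i; rewrite mem_iota => /andP[_ iu] /nseqP[-> _]. Qed.

Lemma size_letters u : size (letters u) = sumn u.
Proof.
elim/last_ind: u => // u k IHu.
by rewrite letters_rcons size_cat size_nseq IHu sumn_rcons.
Qed.

Lemma perm_count_mem (s t : seq nat) : perm_eq s t <-> forall x, count_mem x s = count_mem x t.
Proof.
by split=> [/seq.permP st x|st]; [exact: st|apply/allP => x _ /=; rewrite st].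
Qed.

Lemma weight_mon_of_seq T u :
  weight T = mon_of_seq u <-> perm_eq (flatten T) (letters u).
Proof.
rewrite perm_count_mem; split=> [e x|e].
  by rewrite -weightE e mon_of_seqE count_letters.
by apply/eqP/cmP => x; rewrite weightE e mon_of_seqE count_letters.
Qed.

(** A tableau is recovered from its flattening by [reshape], so the arrangements of a single word
    enumerate all candidates. *)
Definition ssyts (la u : seq nat) : seq (seq (seq nat)) :=
  undup [seq T <- [seq reshape la w | w <- permutations (letters u)] |
    `[< is_ssyt la T >] && perm_eq (flatten T) (letters u)].

Lemma ssytsP la u T :
  reflect (is_ssyt la T /\ perm_eq (flatten T) (letters u)) (T \in ssyts la u).
Proof.
rewrite mem_undup mem_filter; apply: (iffP andP) => [[/andP[/asboolP h p] _]//|[h p]].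
split; first by rewrite p andbT; apply/asboolP.
apply/mapP; exists (flatten T); first by rewrite mem_permutations.
by have [<- _ _] := h; rewrite flattenK.
Qed.

Lemma ssyts_size la u T : T \in ssyts la u -> sumn la = sumn u.
Proof.
case/ssytsP=> -[<- _ _] /perm_size.
by rewrite size_flatten size_letters.
Qed.

Lemma schur_ssyts (A : comNzRingType) (la : Defs.partition) u :
  (schur_series A la (mon_of_seq u) = (size (ssyts la u))%:R)%R.
Proof.
rewrite /schur_series /ps_sum (fsbigE (ssyts la u)) ?undup_uniq //=.
- rewrite -sum1_size natr_sum big_mkcond big_seq [RHS]big_seq.
  apply: eq_bigr => T /ssytsP[sT p]; rewrite ifT; last by rewrite inE.
  by rewrite /ps_monom (iffRL (weight_mon_of_seq _ _) p) eqxx.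
- by move=> T /ssytsP[].
move=> T sT /negP nT; rewrite /ps_monom; case: eqP => // e.
by case: nT; apply/ssytsP; split=> //; apply/weight_mon_of_seq.
Qed.

(** The condition that la/mu is a horizontal strip: no two of its boxes share a column. *)
Definition interlace (mu la : seq nat) : bool :=
  all (fun i => nth 0 la i.+1 <= nth 0 mu i <= nth 0 la i) (iota 0 (maxn (size la) (size mu))).

Lemma interlaceP mu la :
  reflect (forall i, nth 0 la i.+1 <= nth 0 mu i <= nth 0 la i) (interlace mu la).
Proof.
apply: (iffP allP) => h i => [|_]; last exact: h.
case: (ltnP i (maxn (size la) (size mu))) => [im|]; first by apply: h; rewrite mem_iota.
by rewrite geq_max => /andP[li mi]; rewrite !nth_default // ltnW.
Qed.

Lemma nth_nonempty (X : seq (seq nat)) k : sorted geq (shape X) ->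
  nth [::] [seq r <- X | 0 < size r] k = nth [::] X k.
Proof.
have geqT : transitive geq by move=> ? ? ? /= ? ?; lia.
elim: X k => // x X IHX k xs; have ss := path_sorted xs.
have le : all (geq (size x)) (shape X) by move: xs; rewrite /= (path_sortedE geqT) => /andP[].
rewrite /=; case: ltnP => [_|]; first by case: k => //= k; rewrite IHX.
rewrite leqn0 => /nilP x0; rewrite x0 in le *.
have e r : r \in X -> r = [::].
  by move=> rX; apply/nilP; rewrite /nilp -leqn0; apply: (allP le); apply: map_f.
have -> : [seq r <- X | 0 < size r] = [::].
  by apply/eqP; rewrite -[_ == _]negbK -has_filter -all_predC; apply/allP => r /e ->.
rewrite nth_nil; case: k => //= k; case: (ltnP k (size X)) => kX.
  by rewrite (e _ (mem_nth _ kX)).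
by rewrite nth_default.
Qed.

(** * Branching of semistandard tableaux on the largest letter *)

Section RemoveLargest.
Variables (la : Defs.partition) (u : seq nat) (k : nat).
Let B := size u.

Definition rem_largest (T : seq (seq nat)) : seq (seq nat) :=
  [seq r <- [seq [seq y <- r | y < B] | r <- T] | 0 < size r].

Definition add_largest (T : seq (seq nat)) : seq (seq nat) :=
  mkseq (fun i => trow T i ++ nseq (nth 0 la i - size (trow T i)) B) (size la).

Lemma ssyt_le T x : T \in ssyts la (rcons u k) -> x \in flatten T -> x <= B.
Proof. by case/ssytsP=> _ p; rewrite (perm_mem p) => /letters_lt; rewrite size_rcons. Qed.

Lemma mem_trow (T : seq (seq nat)) i x : x \in trow T i -> x \in flatten T.
Proof.
case: (ltnP i (size T)) => iT; last by rewrite /trow nth_default.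
by move=> xi; apply/flattenP; exists (trow T i); rewrite // mem_nth.
Qed.

Lemma count_le_size T i : T \in ssyts la (rcons u k) ->
  count (fun y => y <= B) (trow T i) = nth 0 la i.
Proof.
move=> TS; have /ssytsP[[sh _ _] _] := TS; rewrite -sh -size_trow.
by apply/eqP; rewrite -all_count; apply/allP => x /mem_trow; exact: ssyt_le.
Qed.

(** Row i+1 has no entry above [B], so by column strictness each of its entries lies below an entry
    smaller than [B]. *)
Lemma ssyt_interlace T i : T \in ssyts la (rcons u k) ->
  nth 0 la i.+1 <= count (fun y => y < B) (trow T i) <= nth 0 la i.
Proof.
move=> TS; have /ssytsP[/is_ssytE[_ _ col] _] := TS.
rewrite -(count_le_size i.+1 TS) col -(count_le_size i TS).
by apply: sub_count => y /= /ltnW.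
Qed.

Lemma nth_filter_rows (T : seq (seq nat)) i :
  nth [::] [seq [seq y <- r | y < B] | r <- T] i = [seq y <- trow T i | y < B].
Proof.
case: (ltnP i (size T)) => iT; first by rewrite (nth_map [::]).
by rewrite /trow !nth_default ?size_map.
Qed.

Lemma trow_rem T i : T \in ssyts la (rcons u k) ->
  trow (rem_largest T) i = [seq y <- trow T i | y < B].
Proof.
move=> TS; rewrite {1}/trow /rem_largest nth_nonempty ?nth_filter_rows //.
apply/(sortedP 0) => j; rewrite !size_map => jT.
have iT : j < size T by exact: ltnW.
have rowE i' : i' < size T -> nth 0 (shape [seq [seq y <- r | y < B] | r <- T]) i' =
    count (fun y => y < B) (trow T i').
  by move=> iT'; rewrite (nth_map [::]) ?size_map // nth_filter_rows size_filter.
rewrite !rowE //=.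
have /andP[_ h1] := ssyt_interlace j.+1 TS; have /andP[h2 _] := ssyt_interlace j TS.
exact: leq_trans h1 h2.
Qed.

Lemma rem_largest_shape T : T \in ssyts la (rcons u k) ->
  is_partition (shape (rem_largest T)).
Proof.
move=> TS; apply/andP; split; last first.
  by apply/mapP => -[r]; rewrite mem_filter => /andP[+ _] e; rewrite -e.
apply/(sortedP 0) => i _; rewrite -!size_trow !trow_rem // !size_filter /=.
have /andP[_ h1] := ssyt_interlace i.+1 TS; have /andP[h2 _] := ssyt_interlace i TS.
exact: leq_trans h1 h2.
Qed.

Definition rem_shape T : Defs.partition := insubd empty_partition (shape (rem_largest T)).

Lemma rem_shapeE T : T \in ssyts la (rcons u k) ->
  rem_shape T = shape (rem_largest T) :> seq nat.
Proof. by move=> TS; rewrite /rem_shape val_insubd rem_largest_shape. Qed.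

Lemma rem_interlace T : T \in ssyts la (rcons u k) -> interlace (rem_shape T) la.
Proof.
move=> TS; apply/interlaceP => i; rewrite rem_shapeE // -size_trow trow_rem //.
by rewrite size_filter; exact: ssyt_interlace.
Qed.

Lemma flatten_rem T : flatten (rem_largest T) = [seq y <- flatten T | y < B].
Proof.
rewrite filter_flatten /rem_largest; elim: T => //= r T IHT.
by case: ltnP => /= h; rewrite IHT //; move: h; rewrite leqn0 => /nilP ->.
Qed.

Lemma rem_largest_ssyts T : T \in ssyts la (rcons u k) ->
  rem_largest T \in ssyts (rem_shape T) u.
Proof.
move=> TS; have /ssytsP[/is_ssytE[sh so col] p] := TS; apply/ssytsP; split.
  apply/is_ssytE; split; first by rewrite rem_shapeE.
    apply/allP => r; rewrite mem_filter => /andP[_ /mapP[r' r'T ->]].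
    by apply: sorted_filter (allP so _ r'T); exact: leq_trans.
  move=> i x; rewrite !trow_rem // !count_filter; case: (ltnP x B) => xB.
    apply: leq_trans (leq_trans (col i x) _); apply: sub_count => y /=.
      by case/andP.
    by move=> yx; rewrite yx (ltn_trans yx xB).
  apply: leq_trans (_ : count (fun y => y < B) (trow T i) <= _); last first.
    by apply: sub_count => y /= yB; rewrite yB (leq_trans yB xB).
  have := ssyt_interlace i TS; rewrite -(count_le_size i.+1 TS) => /andP[h _].
  by apply: leq_trans h; apply: sub_count => y /= /andP[_ /ltnW].
rewrite flatten_rem; have := perm_filter (fun y => y < B) p => /perm_trans; apply.
rewrite letters_rcons filter_cat filter_nseq ltnn cats0.
by have /all_filterP -> : all (fun y => y < B) (letters u) by apply/allP => y /letters_lt.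
Qed.

Lemma rem_largestK T : T \in ssyts la (rcons u k) -> add_largest (rem_largest T) = T.
Proof.
move=> TS; have /ssytsP[[sh so _] _] := TS.
have szT : size T = size la by rewrite -sh size_map.
apply: (@eq_from_nth _ [::]); rewrite size_mkseq // => i il.
rewrite nth_mkseq // trow_rem // -sh -size_trow -/(trow T i).
have : sorted leq (trow T i) by apply: sorted_trow.
have : all (fun x => x <= B) (trow T i).
  by apply/allP => x /mem_trow; exact: ssyt_le.
elim: (trow T i) => // a r IHr /= /andP[aB rB] ar.
have le : all (leq a) r by move: ar; rewrite (path_sortedE leq_trans) => /andP[].
move: aB; rewrite leq_eqVlt => /predU1P[aE|aB].
  have -> : [seq y <- r | y < B] = [::].
    apply/eqP; rewrite -[_ == _]negbK -has_filter -all_predC; apply: sub_all le => y /=.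
    by rewrite aE -leqNgt.
  have {2}-> : r = nseq (size r) B.
    apply/all_pred1P/allP => y yr /=; rewrite eqn_leq (allP rB) //.
    by rewrite -aE (allP le).
  by rewrite aE ltnn.
by rewrite aB /= subSS IHr ?(path_sorted ar).
Qed.

Section Add.
Variables (mu : Defs.partition) (T : seq (seq nat)).
Hypotheses (mula : interlace mu la) (TS : T \in ssyts mu u).
Hypothesis lamu : sumn la = sumn mu + k.

Let sz_row i : size (trow T i) = nth 0 mu i.
Proof. by have /ssytsP[[<- _ _] _] := TS; rewrite size_trow. Qed.

Let row_lt i x : x \in trow T i -> x < B.
Proof. by move=> /mem_trow; have /ssytsP[_ /perm_mem ->] := TS; exact: letters_lt. Qed.

Let le_row i : nth 0 mu i <= nth 0 la i.
Proof. by have /interlaceP/(_ i)/andP[] := mula. Qed.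

Lemma trow_add i : trow (add_largest T) i = trow T i ++ nseq (nth 0 la i - nth 0 mu i) B.
Proof.
case: (ltnP i (size la)) => il; first by rewrite {1}/trow nth_mkseq // sz_row.
have e0 : nth 0 la i = 0 by rewrite nth_default.
have : size (trow T i) <= 0 by rewrite sz_row (leq_trans (le_row i)) ?e0.
by rewrite leqn0 => /nilP ->; rewrite e0 sub0n /trow nth_default // size_mkseq.
Qed.

Lemma size_interlace : size mu <= size la.
Proof.
rewrite leqNgt; apply/negP => lt; have := le_row (size la).
have /andP[_ mu0] := partsP mu; rewrite [X in _ <= X]nth_default // leqn0 => /eqP e.
by move/negP: mu0; apply; rewrite -e mem_nth.
Qed.

(** Interlacing puts the new letters [B] in distinct columns, so the entry above a new [B] is an
    old, smaller letter. *)
Lemma add_largest_ssyts : add_largest T \in ssyts la (rcons u k).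
Proof.
have /ssytsP[/is_ssytE[sh so col] p] := TS.
have shE : shape (add_largest T) = la.
  apply: (@eq_from_nth _ 0) => [|i]; rewrite size_map size_mkseq // => il.
  by rewrite -size_trow trow_add size_cat size_nseq sz_row subnKC.
apply/ssytsP; split.
  apply/is_ssytE; split=> //.
    apply/(all_nthP [::]) => i _; rewrite -/(trow _ i) trow_add.
    rewrite (sorted_pairwise leq_trans) pairwise_cat -!(sorted_pairwise leq_trans).
    rewrite sorted_trow //; apply/and3P; split=> //.
      by apply/allrelP => x y /row_lt xB /nseqP[-> _]; exact: ltnW.
    by rewrite (sorted_pairwise leq_trans); elim: (_ - _) => //= d ->; rewrite all_nseq leqnn orbT.
  move=> i x; rewrite !trow_add !count_cat !count_nseq.
  case: (leqP B x) => Bx; last by rewrite !mul0n !addn0 ltnNge (ltnW Bx) /= addn0 col.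
  have -> : count (fun y => y <= x) (trow T i.+1) = nth 0 mu i.+1.
    rewrite -sz_row; apply/eqP; rewrite -all_count; apply/allP => y /row_lt yB.
    exact: leq_trans (ltnW yB) Bx.
  have -> : count (fun y => y < x) (trow T i) = nth 0 mu i.
    rewrite -sz_row; apply/eqP; rewrite -all_count; apply/allP => y /row_lt yB.
    exact: leq_trans yB Bx.
  rewrite mul1n subnKC //; have /interlaceP/(_ i)/andP[h _] := mula.
  exact: leq_trans h (leq_addr _ _).
apply/perm_count_mem => x; rewrite letters_rcons count_cat.
have {p}p := iffLR (perm_count_mem _ _) p x; rewrite -p count_nseq.
have cT (S : seq (seq nat)) (P : pred nat) : size S <= size la ->
    count P (flatten S) = \sum_(i < size la) count P (trow S i).
  move=> Sl; rewrite count_flatten sumnE big_map (big_nth [::]).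
  rewrite -(big_mkord xpredT (fun i => count P (trow S i))).
  rewrite [RHS](big_cat_nat (n := size S)) //=.
  rewrite [X in _ = _ + X]big_nat_cond [X in _ = _ + X]big1 ?addn0 // => i.
  by rewrite andbT => /andP[Si _]; rewrite /trow nth_default.
rewrite !cT ?size_mkseq //; last by rewrite -(size_map size) [map _ _]sh size_interlace.
under eq_bigr do rewrite trow_add count_cat count_nseq.
rewrite big_split -big_distrr /=; congr (_ + _ * _).
apply/eqP; rewrite -(eqn_add2l (sumn mu)) -lamu; apply/eqP.
have sE (ka : Defs.partition) : size ka <= size la ->
    sumn ka = \sum_(i < size la) nth 0 ka i.
  move=> kl; rewrite sumnE (big_nth 0) -(big_mkord xpredT (fun i => nth 0 ka i)).
  rewrite [RHS](big_cat_nat (n := size ka)) //=.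
  rewrite [X in _ = _ + X]big_nat_cond [X in _ = _ + X]big1 ?addn0 // => i.
  by rewrite andbT => /andP[Si _]; rewrite nth_default.
rewrite !sE ?size_interlace // -big_split /=; apply: eq_bigr => i _.
by rewrite subnKC.
Qed.

Lemma add_largestK : rem_largest (add_largest T) = T.
Proof.
have /ssytsP[[sh _ _] _] := TS.
have TE := add_largest_ssyts.
have row i : trow (rem_largest (add_largest T)) i = trow T i.
  rewrite trow_rem // trow_add filter_cat filter_nseq ltnn cats0.
  by apply/all_filterP/allP => x /row_lt.
have shE : shape (rem_largest (add_largest T)) = mu.
  rewrite -(rem_shapeE TE); congr parts; apply: partition_ext => i.
  by rewrite rem_shapeE // -size_trow row sz_row.
apply: (@eq_from_nth _ [::]) => [|i _]; last exact: row.
by rewrite -(size_map size) [map _ _]shE -sh size_map.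
Qed.

Lemma rem_shape_add : rem_shape (add_largest T) = mu.
Proof.
apply/val_inj; rewrite /= rem_shapeE ?add_largest_ssyts // add_largestK.
by have /ssytsP[[]] := TS.
Qed.

End Add.

(** Branching rule: deleting the largest letter is a bijection inverted by [add_largest], as the
    intermediate shape records where that letter was. *)
Lemma size_ssyts_rcons : sumn la = sumn u + k ->
  size (ssyts la (rcons u k)) =
  \sum_(mu <- parts_of (sumn u) | interlace mu la) size (ssyts mu u).
Proof.
move=> lau; pose r := [seq mu : Defs.partition <- parts_of (sumn u) | interlace mu la].
rewrite (perm_size (s2 := [seq add_largest T | mu : Defs.partition <- r, T <- ssyts mu u])).
  by rewrite size_allpairs_dep sumnE big_map big_filter.
have memr (mu : Defs.partition) : mu \in r -> interlace mu la /\ sumn la = sumn mu + k.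
  by rewrite mem_filter mem_parts_of => /andP[-> /eqP ->].
apply: uniq_perm; rewrite ?undup_uniq //.
  apply: allpairs_uniq_dep => [|mu _|]; rewrite ?undup_uniq ?filter_uniq ?parts_of_uniq //.
  move=> ? ? /allpairsPdep[mu [T [/memr[mi ms] TS ->]]].
  move=> /allpairsPdep[mu' [T' [/memr[mi' ms'] TS' ->]]] /= e.
  have := add_largestK mi TS ms; have := rem_shape_add mi TS ms.
  rewrite e (add_largestK mi' TS' ms') (rem_shape_add mi' TS' ms').
  by move=> e1 e2; rewrite e1 e2 in TS *.
move=> T; apply/idP/allpairsPdep => [TS|[mu [T' [/memr[mi ms] TS' ->]]]]; last first.
  exact: add_largest_ssyts mi TS' ms.
have TS' := rem_largest_ssyts TS; exists (rem_shape T), (rem_largest T); split=> //.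
  by rewrite mem_filter (rem_interlace TS) mem_parts_of (ssyts_size TS') eqxx.
by rewrite rem_largestK.
Qed.

End RemoveLargest.

Local Open Scope ring_scope.

(** * Kostka numbers as sums over boxes of beta numbers *)

Section Box.
Variable N : nat.
Implicit Types (g l : {ffun 'I_N -> nat}).

(** The bound [(\sum_k l k).+1] only provides a finite type large enough for every entry. *)
Definition box l : seq {ffun 'I_N -> nat} :=
  [seq [ffun i => nat_of_ord ((h : {ffun 'I_N -> 'I_(\sum_k l k).+1}) i)] |
     h <- enum [pred h : {ffun 'I_N -> 'I_(\sum_k l k).+1} | [forall i, h i <= l i]%N]].

Lemma box_uniq l : uniq (box l).
Proof.
rewrite map_inj_uniq ?enum_uniq // => h h' /ffunP e; apply/ffunP => i.
by apply/val_inj; move: (e i); rewrite !ffunE.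
Qed.

Lemma mem_box l g : (g \in box l) = [forall i, g i <= l i]%N.
Proof.
apply/mapP/forallP => [[h + ->] i|gl].
  by rewrite mem_enum inE => /forallP/(_ i); rewrite ffunE.
exists [ffun i => inord (g i)].
  rewrite mem_enum inE; apply/forallP => i; rewrite ffunE inordK // ltnS.
  by apply: leq_trans (gl i) _; rewrite (bigD1 i) //= leq_addr.
apply/ffunP => i; rewrite !ffunE inordK // ltnS.
by apply: leq_trans (gl i) _; rewrite (bigD1 i) //= leq_addr.
Qed.

Lemma memP_box l g : reflect (forall i, g i <= l i)%N (g \in box l).
Proof. by rewrite mem_box; exact: forallP. Qed.

End Box.

Section Kostka.
Variable A : comUnitRingType.
Hypothesis two_unit : (2%:R : A) \is a GRing.unit.
Implicit Types (c : Defs.partition -> A) (la mu : Defs.partition) (u : seq nat).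

(** The swap permutes X and changes the sign of every term, so the sum is its own opposite. *)
Lemma alt_sum_swap N (f : {ffun 'I_N -> nat} -> A) (X : seq {ffun 'I_N -> nat}) (a b : 'I_N) :
    (forall (g : {ffun 'I_N -> nat}) s, f (permf g s) = (-1) ^+ (odd_perm s) * f g) ->
    uniq X -> a != b -> (forall g, g \in X -> permf g (tperm a b) \in X) ->
  \sum_(g <- X) f g = 0.
Proof.
move=> fp uX ab clX; apply: (opp_eq0 two_unit); pose h g := permf g (tperm a b).
have hK : involutive h by move=> g; rewrite /h -permfM tperm2 permf1.
have pX : perm_eq X (map h X).
  apply: uniq_perm; rewrite ?map_inj_uniq //; first exact: inv_inj.
  move=> g; apply/idP/mapP => [gX|[g' gX ->]]; last exact: clX.
  by exists (h g); rewrite ?hK //; exact: clX.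
rewrite {1}(perm_big _ pX) /= big_map -sumrN; apply: eq_bigr => g _.
by rewrite /h fp odd_tperm ab expr1 mulN1r.
Qed.

Lemma alt_degree N c d (g : {ffun 'I_N -> nat}) : (forall la, sumn la != d -> c la = 0) ->
  (\sum_k g k != d + 'C(N, 2))%N -> alt c g = 0.
Proof.
move=> cd gd; rewrite (@alt_ext _ _ c (fun=> 0)) => [|la e].
  by rewrite /alt big1 // => s _; rewrite if_same mulr0.
by apply: cd; apply: contraNneq gd => <-; rewrite e.
Qed.

(* The terms with [g_i <= l_(i+1)] cancel under the exchange of [g_i] and [g_(i+1)]. *)
Lemma box_interlace N (f : {ffun 'I_N.+1 -> nat} -> A) (l : {ffun 'I_N.+1 -> nat}) :
    (forall (g : {ffun 'I_N.+1 -> nat}) s, f (permf g s) = (-1) ^+ (odd_perm s) * f g) ->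
    decr l ->
  \sum_(g <- box l) f g =
  \sum_(g <- box l | [forall i : 'I_N.+1, forall j : 'I_N.+1,
      (j == i.+1 :> nat) ==> (l j < g i)%N]) f g.
Proof.
move=> fp /decrP dl.
pose P m (g : {ffun 'I_N.+1 -> nat}) :=
  [forall i : 'I_N.+1, forall j : 'I_N.+1, (i < m)%N && (j == i.+1 :> nat) ==> (l j < g i)%N].
have PP m (g : {ffun 'I_N.+1 -> nat}) :
    reflect (forall i j : 'I_N.+1, (i < m)%N -> j = i.+1 :> nat -> (l j < g i)%N) (P m g).
  apply: (iffP forallP) => h i => [j im ji|].
    by move/forallP/(_ j)/implyP: (h i); apply; rewrite im ji eqxx.
  by apply/forallP => j; apply/implyP => /andP[im /eqP]; exact: h.
transitivity (\sum_(g <- box l | P N g) f g); last first.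
  apply: eq_bigl => g; apply: eq_forallb => i; apply: eq_forallb => j.
  case: eqP => [ji|]; rewrite ?andbF // andbT.
  by have -> : (i < N)%N by have := ltn_ord j; rewrite ji ltnS.
have step : forall m, (m <= N)%N -> \sum_(g <- box l) f g = \sum_(g <- box l | P m g) f g;
  last exact: step.
elim=> [|m IHm] mN.
  by apply: eq_bigl => g; apply/esym/PP.
rewrite (IHm (ltnW mN)) (bigID (P m.+1)) /= [X in _ + X](_ : _ = 0) ?addr0.
  apply: eq_bigl => g; apply/andP/idP => [[]//|h]; split=> //.
  by apply/PP => i j im; move/PP: h; apply; rewrite ltnW.
have m1N : (m < N.+1)%N by rewrite ltnW.
pose a : 'I_N.+1 := Ordinal m1N; pose b : 'I_N.+1 := Ordinal (mN : (m.+1 < N.+1)%N).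
have ab : a != b by rewrite -val_eqE /= ltn_eqF.
rewrite -big_filter; apply: (alt_sum_swap fp _ ab); first by rewrite filter_uniq ?box_uniq.
have Xe g : g \in [seq g <- box l | P m g && ~~ P m.+1 g] <->
    [/\ g \in box l, P m g & (g a <= l b)%N].
  rewrite mem_filter; split=> [/andP[/andP[pm npm] gl]|[gl pm gb]].
    split=> //; rewrite leqNgt; apply: contra npm => lt; apply/PP => i j.
    rewrite ltnS leq_eqVlt => /predU1P[im ji|]; last by move/PP: pm; exact.
    have -> : i = a by apply/val_inj.
    by have -> : j = b by apply/val_inj; rewrite /= ji im.
  rewrite gl pm /= andbT; apply/negP => /PP/(_ a b (ltnSn m) erefl).
  by rewrite ltnNge gb.
move=> g /Xe[/memP_box gl /PP pm gb]; apply/Xe; split.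
- apply/memP_box => i; rewrite ffunE; case: tpermP => [->|->|_ _] //.
  by apply: leq_trans (gl b) _; apply/ltnW/dl => /=.
- apply/PP => i j im ji; rewrite ffunE tpermD ?pm //.
    by rewrite -val_eqE /= gtn_eqF.
  by rewrite -val_eqE /= gtn_eqF // ltnW.
- by rewrite ffunE tpermL.
Qed.

Definition kostka u la : A := schur_series A la (mon_of_seq u).

Lemma kostkaE u la : kostka u la = (size (ssyts la u))%:R.
Proof. exact: schur_ssyts. Qed.

Lemma kostka_size u la : sumn la != sumn u -> kostka u la = 0.
Proof.
rewrite kostkaE => ne; case E : (ssyts la u) => [|T s] //.
have TS : T \in ssyts la u by rewrite E mem_head.
by rewrite (ssyts_size TS) eqxx in ne.
Qed.

Lemma kostka_rcons u k la : sumn la = (sumn u + k)%N ->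
  kostka (rcons u k) la = \sum_(mu <- parts_of (sumn u) | interlace mu la) kostka u mu.
Proof.
move=> e; rewrite kostkaE (size_ssyts_rcons e) natr_sum.
by apply: eq_bigr => mu _; rewrite kostkaE.
Qed.

Lemma kostka_box_beta N u k la : (size la <= N.+1)%N -> sumn la = (sumn u + k)%N ->
  kostka (rcons u k) la = \sum_(g <- box (beta N.+1 la)) alt (kostka u) g.
Proof.
move=> laN e; rewrite kostka_rcons // box_interlace; first last.
- exact: decr_beta.
- by move=> g s; rewrite alt_perm.
set l := beta N.+1 la.
pose P (g : {ffun 'I_N.+1 -> nat}) :=
  [forall i : 'I_N.+1, forall j : 'I_N.+1, (j == i.+1 :> nat) ==> (l j < g i)%N].
rewrite -[RHS]/(\sum_(g <- box l | P g) alt (kostka u) g).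
have Pdecr g : g \in box l -> P g -> decr g.
  move=> /memP_box gl /forallP pg; apply/decrP.
  have step (i j : 'I_N.+1) : j = i.+1 :> nat -> (g j < g i)%N.
    move=> ji; apply: leq_ltn_trans (gl j) _.
    by move/forallP/(_ j)/implyP: (pg i); apply; rewrite ji.
  move=> a b; have [d] : exists d, (b - a = d.+1)%N \/ (b - a = 0)%N /\ d = 0%N.
    by case: (b - a)%N => [|d]; [exists 0%N; right|exists d; left].
  elim: d b => [|d IHd] b [dE|[dE ?]] ab; try lia.
    by apply: step; lia.
  have b1 : (b.-1 < N.+1)%N by have := ltn_ord b; lia.
  have := IHd (Ordinal b1); have := step (Ordinal b1) b.
  by move: (g _) (g _) (g _) => x y z /=; lia.
have z (ka : Defs.partition) j : (size ka <= N.+1)%N -> (N < j)%N -> nth 0%N ka j = 0%N.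
  by move=> h1 h2; rewrite nth_default // (leq_trans h1).
have memP mu : (size mu <= N.+1)%N ->
    (beta N.+1 mu \in box l) && P (beta N.+1 mu) = interlace mu la.
  move=> muN; apply/andP/interlaceP => [[/memP_box gl /forallP pg] i|h].
    case: (ltnP i N.+1) => iN; last first.
      by rewrite (z la i.+1) ?(z la i) ?(z mu i) // ltnW.
    have := gl (Ordinal iN); rewrite !ffunE leq_add2r => -> /=; rewrite andbT.
    case: (ltnP i.+1 N.+1) => iN1; last by rewrite nth_default // (leq_trans laN).
    have /forallP/(_ (Ordinal iN1)) := pg (Ordinal iN).
    by rewrite eqxx !ffunE /=; lia.
  split; first by apply/memP_box => i; rewrite !ffunE leq_add2r; have /andP[] := h i.
  apply/forallP => i; apply/forallP => j; apply/implyP => /eqP ji; rewrite !ffunE ji.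
  by have /andP[h1 _] := h i; have := ltn_ord j; rewrite ji; lia.
transitivity (\sum_(g <- box l | P g) \sum_(mu <- parts_of (sumn u) | (size mu <= N.+1)%N)
    (g == beta N.+1 mu)%:R * kostka u mu); last first.
  rewrite big_seq_cond [RHS]big_seq_cond; apply: eq_bigr => g /andP[gl pg].
  have [sz gE] := unbetaP (Pdecr g gl pg); set nu := unbeta g in sz gE.
  rewrite -{2}gE alt_beta //.
  transitivity (\sum_(mu <- parts_of (sumn u) | mu == nu) kostka u mu).
    rewrite [LHS]big_mkcond [RHS]big_mkcond; apply: eq_bigr => mu _ /=.
    case: (eqVneq mu nu) => [->|ne]; first by rewrite sz gE eqxx mul1r.
    case: leqP => // muN; case: eqP => [ge|]; last by rewrite mul0r.
    by rewrite -gE in ge; rewrite (beta_inj sz muN ge) eqxx in ne.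
  by rewrite big_parts_of_eq; case: eqP => // /eqP ne; rewrite kostka_size.
rewrite exchange_big [LHS](bigID (fun mu : Defs.partition => (size mu <= N.+1)%N)) /=.
rewrite [X in _ + X]big1 ?addr0 => [|mu /andP[mi /negP muN]]; last first.
  by case: muN; apply: leq_trans (size_interlace mi) laN.
rewrite [LHS]big_mkcond [RHS]big_mkcond; apply: eq_bigr => mu _ /=.
case: (leqP (size mu) N.+1) => muN; last by rewrite andbF.
rewrite andbT -memP // -big_distrl /=; case: ifP => [/andP[ml pm]|nm].
  rewrite big_mkcond (bigD1_seq (beta N.+1 mu)) ?box_uniq //= pm eqxx big1 ?addr0 ?mul1r //.
  by move=> g /negPf ->; rewrite if_same.
rewrite big_seq_cond big1 ?mul0r // => g /andP[gl pg].
by case: eqP => // ge; rewrite -ge gl pg in nm.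
Qed.

Lemma kostka_box N u k (g : {ffun 'I_N.+1 -> nat}) :
    (\sum_i g i = sumn u + k + 'C(N.+1, 2))%N ->
  alt (kostka (rcons u k)) g = \sum_(h <- box g) alt (kostka u) h.
Proof.
move=> gd; have altp (h : {ffun 'I_N.+1 -> nat}) s : alt (kostka u) (permf h s) =
    (-1) ^+ odd_perm s * alt (kostka u) h by exact: alt_perm.
case: (boolP (injectiveb g)) => [/injectiveP gi|/injectivePn[a [b ab e]]]; last first.
  rewrite (alt_eq _ ab e); apply/esym/(alt_sum_swap altp _ ab); first exact: box_uniq.
  move=> h /memP_box hg; apply/memP_box => i; rewrite ffunE.
  by case: tpermP => [->|->|_ _]; rewrite // ?e // -e.
have [la [s [sz gE]]] := inj_beta gi.
have lad : sumn la = (sumn u + k)%N.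
  by move: gd; rewrite gE permf_nat_sum beta_sum // => /eqP; rewrite eqn_add2r => /eqP.
rewrite gE alt_perm alt_beta // (kostka_box_beta sz lad).
have pE : perm_eq (box (permf (beta N.+1 la) s)) [seq permf h s | h <- box (beta N.+1 la)].
  have inj : injective (fun h : {ffun 'I_N.+1 -> nat} => permf h s).
    by move=> h h' e; rewrite -(permf1 h) -(mulVg s) permfM e -permfM mulVg permf1.
  apply: uniq_perm => [||h]; first exact: box_uniq.
    by rewrite (map_inj_uniq inj) box_uniq.
  apply/memP_box/mapP => [hl|[h' /memP_box hl ->] i]; last first.
    by rewrite ffunE [X in (_ <= X)%N]ffunE hl.
  exists (permf h s^-1%g); last by rewrite -permfM mulgV permf1.
  by apply/memP_box => i; rewrite ffunE (leq_trans (hl _)) // ffunE permKV.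
rewrite [RHS](perm_big _ pE) [RHS]big_map big_distrr; apply: eq_bigr => h _.
by rewrite altp.
Qed.

End Kostka.

(** * Adding strips and Kostka numbers *)

Section MurnaghanNakayama.
Variable A : comUnitRingType.
Implicit Types (c : Defs.partition -> A) (la mu : Defs.partition) (u : seq nat).

Lemma alt_sum N I (r : seq I) (P : pred I) (F : I -> Defs.partition -> A)
    (g : {ffun 'I_N -> nat}) :
  alt (fun la => \sum_(i <- r | P i) F i la) g = \sum_(i <- r | P i) alt (F i) g.
Proof.
rewrite /alt exchange_big /=; apply: eq_bigr => s _; rewrite -big_distrr; congr (_ * _).
by case: ifP => // _; rewrite big1.
Qed.

Definition decr_nth u j n : seq nat := set_nth 0%N u j (nth 0%N u j - n)%N.

Lemma sumn_decr_nth u j n : (j < size u)%N -> (n <= nth 0 u j)%N ->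
  (sumn (decr_nth u j n) + n = sumn u)%N.
Proof.
elim: u j => // x u IHu [|j] /= ju nu; first by rewrite /decr_nth /=; lia.
by rewrite /decr_nth /= -addnA -/(decr_nth u j n) IHu.
Qed.

Lemma decr_nth_rcons u k j n : (j < size u)%N ->
  decr_nth (rcons u k) j n = rcons (decr_nth u j n) k.
Proof.
move=> ju; rewrite /decr_nth nth_rcons ju; elim: u j ju => // x u IHu [|j] //= ju.
by rewrite IHu.
Qed.

Lemma decr_nth_last u k n : decr_nth (rcons u k) (size u) n = rcons u (k - n)%N.
Proof. by rewrite /decr_nth nth_rcons ltnn eqxx; elim: u => //= x u ->. Qed.

Lemma sum_box_addn N (f : {ffun 'I_N -> nat} -> A) (l : {ffun 'I_N -> nat}) i n :
  \sum_(g <- box (addn_at l i n) | (n <= g i)%N) f g = \sum_(g <- box l) f (addn_at g i n).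
Proof.
have inj : injective (fun g : {ffun 'I_N -> nat} => addn_at g i n).
  by move=> g g' /ffunP e; apply/ffunP => k; move: (e k); rewrite !ffunE => /addIn.
rewrite -big_filter -(big_map (fun g => addn_at g i n) xpredT f); apply: perm_big.
apply: uniq_perm; rewrite ?filter_uniq ?box_uniq // ?(map_inj_uniq inj) ?box_uniq // => g.
rewrite mem_filter; apply/andP/mapP => [[ng /memP_box gl]|[g' /memP_box gl ->]].
  exists (subn_at g i n).
    by apply/memP_box => k; have := gl k; rewrite !ffunE; lia.
  apply/ffunP => k; rewrite !ffunE subnK //.
  by case: (eqVneq k i) => [->|_]; rewrite ?mul1n ?mul0n.
rewrite ffunE eqxx mul1n leq_addl; split=> //.
by apply/memP_box => k; rewrite !ffunE leq_add2r.
Qed.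

Hypothesis two_unit : (2%:R : A) \is a GRing.unit.

(* Only the range [0 <= g_i < n] of the row [i] with [l_i = n - 1] is not already
   the range of another row, so the other contributions cancel. *)
Lemma sum_box_below N (f : {ffun 'I_N.+1 -> nat} -> A) la n :
    (forall (g : {ffun 'I_N.+1 -> nat}) s, f (permf g s) = (-1) ^+ (odd_perm s) * f g) ->
    (0 < n)%N -> (size la + n <= N.+1)%N ->
  \sum_i \sum_(g <- box (addn_at (beta N.+1 la) i n) | ~~ (n <= g i)%N) f g =
  \sum_(g <- box (beta N.+1 la)) f g.
Proof.
move=> fp n0 laN; set l := beta N.+1 la.
have bN : (N.+1 - n < N.+1)%N by lia.
pose b : 'I_N.+1 := Ordinal bN.
have lb : l b = n.-1 by rewrite /l beta_bottom /=; lia.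
have memX i (g : {ffun 'I_N.+1 -> nat}) :
    (g \in [seq g : {ffun 'I_N.+1 -> nat} <- box (addn_at l i n) | ~~ (n <= g i)%N]) <->
    (g i < n)%N /\ forall k, k != i -> (g k <= l k)%N.
  rewrite mem_filter -ltnNge; split=> [/andP[gi /memP_box gl]|[gi gl]].
    split=> // k ki; have := gl k.
    by rewrite [X in (_ <= X)%N]ffunE (negPf ki) mul0n addn0.
  rewrite gi; apply/memP_box => k; rewrite ffunE.
  by case: (eqVneq k i) => [->|ki]; [lia|rewrite addn0 gl].
rewrite (bigD1 b) //= [X in _ + X]big1 ?addr0 => [|i ib]; last first.
  rewrite -big_filter; have bi : b != i by rewrite eq_sym.
  apply: (alt_sum_swap two_unit fp _ ib); first by rewrite filter_uniq ?box_uniq.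
  move=> g /memX[gi gl]; apply/memX; split.
    by rewrite ffunE tpermL (leq_ltn_trans (gl b bi)) // lb prednK.
  move=> k ki; rewrite ffunE; case: tpermP ki => [->|-> _|_ kb ki]; rewrite ?eqxx //.
    by rewrite lb; lia.
  exact: gl.
rewrite -big_filter; apply: perm_big; apply: uniq_perm; rewrite ?filter_uniq ?box_uniq //.
move=> g; apply/idP/memP_box => [/memX[gb gl] k|gl].
  by case: (eqVneq k b) => [->|kb]; [rewrite lb; lia|exact: gl].
by apply/memX; split=> [|k _] //; have := gl b; rewrite lb; lia.
Qed.

Local Notation kostka := (@kostka A).

Lemma alt_add_strips_box N k c la (h : {ffun 'I_N.+1 -> nat}) :
    (0 < k)%N -> (size la + k <= N.+1)%N -> h \in box (beta N.+1 la) ->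
  alt (add_strips k c) h = \sum_i alt c (addn_at h i k).
Proof.
move=> k0 laN /memP_box hl; apply: alt_add_strips => //; right; split=> [|i ki].
  by apply: leq_trans laN; rewrite leq_addl.
have := hl i; have := ltn_ord i; rewrite beta_bottom; last by lia.
by move: (h i) => x; lia.
Qed.

(** The Murnaghan-Nakayama rule read at the coefficient of x^u, where multiplying by p_n lowers one
    exponent u_j by n. In the induction on the largest letter, the box enlarged by n in direction i
    splits into g_i >= n, a shifted copy of the old box that yields the terms of the smaller
    letters, and g_i < n, which together give the term of the last letter. *)
Lemma kostka_add_strips n u la : (0 < n)%N ->
  add_strips n (kostka u) la =
  \sum_(j < size u | (n <= nth 0 u j)%N) kostka (decr_nth u j n) la.
Proof.
move=> n0; elim/last_ind: u la => [|u k IHu] la.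
  rewrite big_ord0 /add_strips big_seq big1 // => mu; rewrite mem_parts_of => /eqP e.
  by rewrite kostka_size ?mulr0 // e /=; lia.
case: (eqVneq (sumn la + n) (sumn u + k))%N => [d|nd]; last first.
  rewrite /add_strips big_seq big1 => [|mu]; last first.
    rewrite mem_parts_of => /eqP e; rewrite kostka_size ?mulr0 //.
    by rewrite e sumn_rcons.
  rewrite big1 // => j nj; rewrite kostka_size //.
  by have := sumn_decr_nth (ltn_ord j) nj; rewrite sumn_rcons; lia.
pose N := (size la + n).-1.
have NE : N.+1 = (size la + n)%N by rewrite /N; lia.
have laN : (size la + n <= N.+1)%N by rewrite NE.
have laN' : (size la <= N.+1)%N by lia.
rewrite (add_strips_alt _ n0 laN); set l := beta N.+1 la.
have lsum : (\sum_i l i = sumn la + 'C(N.+1, 2))%N by exact: beta_sum.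
transitivity (\sum_i \sum_(g <- box (addn_at l i n)) alt (kostka u) g).
  by apply: eq_bigr => i _; rewrite kostka_box // addn_at_nat_sum lsum addnAC d.
transitivity (\sum_(g <- box l) alt (add_strips n (kostka u)) g +
    \sum_(g <- box l) alt (kostka u) g).
  under eq_bigr => i _ do rewrite (bigID (fun g : {ffun 'I_N.+1 -> nat} => n <= g i)%N) /=.
  rewrite big_split /=; congr (_ + _); last first.
    by apply: sum_box_below => // g s; rewrite alt_perm.
  under eq_bigr do rewrite sum_box_addn.
  rewrite exchange_big big_seq [RHS]big_seq; apply: eq_bigr => h hl.
  by rewrite (alt_add_strips_box _ n0 laN hl).
rewrite size_rcons [RHS]big_mkcond [RHS]big_ord_recr /=; congr (_ + _).
  rewrite -big_mkcond.
  transitivity (\sum_(g <- box l) \sum_(j < size u | (n <= nth 0 u j)%N)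
      alt (kostka (decr_nth u j n)) g).
    apply: eq_bigr => g _; rewrite -alt_sum; apply: alt_ext => mu _; exact: IHu.
  rewrite exchange_big /=; apply: eq_big => [j|j nj].
    by rewrite nth_rcons ltn_ord.
  rewrite decr_nth_rcons // -(alt_beta (N := N.+1) _ laN') kostka_box //.
  by have := sumn_decr_nth (ltn_ord j) nj; rewrite lsum; lia.
rewrite nth_rcons ltnn eqxx decr_nth_last; case: leqP => nk.
  rewrite -(alt_beta (N := N.+1) _ laN') kostka_box // lsum; lia.
(* Here k < n, hence |la| < |u|, and no tuple of the box has the sum required by content u. *)
rewrite big_seq big1 // => g /memP_box gl.
apply: (alt_degree (d := sumn u)) => [mu|]; first exact: kostka_size.
have : (\sum_i g i <= \sum_i l i)%N by apply: leq_sum => i _; exact: gl.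
rewrite lsum; move: (\sum_k g k)%N => x xl; apply/eqP => xE.
by move: d nk; rewrite xE in xl; lia.
Qed.

End MurnaghanNakayama.

(** * Exponentials of strip operators *)

Lemma big_skew_sub (V : nmodType) (g : nat * nat -> V) (la mu : seq nat) :
    (size la <= size mu)%N -> (forall k, nth 0 la k <= nth 0 mu k)%N ->
  \sum_(b <- skew_boxes mu [::]) g b =
  \sum_(b <- skew_boxes la [::]) g b + \sum_(b <- skew_boxes mu la) g b.
Proof.
move=> sz sub; rewrite (@big_skew_boxes _ g mu [::] (size mu)) //.
rewrite (@big_skew_boxes _ g la [::] (size mu)) //.
rewrite (@big_skew_boxes _ g mu la (size mu)) // -big_split.
by apply: eq_bigr => k _ /=; rewrite nth_nil (big_cat_nat (n := nth 0%N la k)).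
Qed.

Lemma kappa_contents (la : Defs.partition) :
  kappa la = 2 * \sum_(b <- skew_boxes la [::]) content b.
Proof.
rewrite (@big_skew_boxes _ content la [::] (size la)) // big_distrr; apply: eq_bigr => i _ /=.
rewrite nth_nil /content /=; move: (nth 0%N la i) => m.
elim: m => [|m IHm]; first by rewrite big_geq // !mulr0 mul0r.
by rewrite big_nat_recr //= [RHS]mulrDr -IHm; lia.
Qed.

Section ExpCoef.
Variable A : comUnitRingType.
Implicit Types (c : Defs.partition -> A) (la mu : Defs.partition) (y z : nat -> A).

Lemma strip_contents n la mu (V : zmodType) (g : int -> V) : (0 < n)%N -> strip A n la mu != 0 ->
  [/\ (size la <= size mu)%N, forall k, (nth 0 la k <= nth 0 mu k)%N &
      \sum_(b <- skew_boxes mu la) g (content b) = \sum_(t < n) g (cmin n la mu + t%:Z)].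
Proof.
move=> n0 s0; have [h1 h2 h3] := strip_neq0 n0 s0.
move: s0; rewrite /strip; case: asboolP => [h _|]; last by rewrite eqxx.
have [i [j st]] := add_strip_rows n0 h.
have sub := strip_rows_sub n0 st; split=> //.
have /andP[imu _] := strip_rows_size_add n0 st; have [ji _ _ _] := st.
have muN : (size mu <= (size mu).+1)%N by rewrite leqnSn.
have iN : (i < (size mu).+1)%N by rewrite ltnW.
have jN : (j < (size mu).+1)%N := leq_ltn_trans ji iN.
have E := @strip_rows_beta (size mu) la mu n (Ordinal iN) (Ordinal jN) st.
by have [_ ->] := sum_cmin g muN sub n0 E.
Qed.

Lemma rem_strips_ext n x c c' la :
  (forall mu, sumn mu = (sumn la - n)%N -> c mu = c' mu) ->
  rem_strips n x c la = rem_strips n x c' la.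
Proof.
move=> e; rewrite /rem_strips big_seq [RHS]big_seq; apply: eq_bigr => mu.
by rewrite mem_parts_of => /eqP /e ->.
Qed.

Lemma rem_strips_ext_lt n x c c' la : (0 < n)%N ->
  (forall mu, (sumn mu < sumn la)%N -> c mu = c' mu) ->
  rem_strips n x c la = rem_strips n x c' la.
Proof.
move=> n0 e; case: (ltnP (sumn la) n) => nla; first by rewrite !rem_strips_gt.
by apply: rem_strips_ext => mu mE; apply: e; lia.
Qed.

Lemma rem_strips_sum n x I (r : seq I) (P : pred I) (a : I -> A) (F : I -> Defs.partition -> A) la :
  rem_strips n x (fun mu => \sum_(i <- r | P i) a i * F i mu) la =
  \sum_(i <- r | P i) a i * rem_strips n x (F i) la.
Proof.
rewrite /rem_strips; under eq_bigr do rewrite big_distrr /=.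
rewrite exchange_big /=; apply: eq_bigr => i _; rewrite big_distrr /=.
by apply: eq_bigr => mu _; rewrite mulrCA.
Qed.

Lemma rem_stripsZ n x a c la : rem_strips n x (fun mu => a * c mu) la = a * rem_strips n x c la.
Proof. by rewrite /rem_strips big_distrr; apply: eq_bigr => mu _ /=; rewrite mulrCA. Qed.

Lemma rem_stripsB n x c c' la :
  rem_strips n x (fun mu => c mu - c' mu) la = rem_strips n x c la - rem_strips n x c' la.
Proof. by rewrite /rem_strips -sumrB; apply: eq_bigr => mu _; rewrite mulrBr. Qed.

Lemma add_strips_sum n I (r : seq I) (P : pred I) (a : I -> A) (F : I -> Defs.partition -> A) la :
  add_strips n (fun mu => \sum_(i <- r | P i) a i * F i mu) la =
  \sum_(i <- r | P i) a i * add_strips n (F i) la.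
Proof.
rewrite /add_strips; under eq_bigr do rewrite big_distrr /=.
rewrite exchange_big /=; apply: eq_bigr => i _; rewrite big_distrr /=.
by apply: eq_bigr => mu _; rewrite mulrCA.
Qed.

Definition degop c la : A := (sumn la)%:R * c la.

Lemma rem_strips_degop n x c la : (0 < n)%N ->
  (sumn la)%:R * rem_strips n x c la = rem_strips n x (degop c) la + n%:R * rem_strips n x c la.
Proof.
move=> n0; case: (ltnP (sumn la) n) => nla.
  by rewrite !rem_strips_gt // !mulr0 addr0.
rewrite -{1}(subnK nla) natrD mulrDl; congr (_ + _); rewrite -rem_stripsZ.
by apply: rem_strips_ext => mu muE; rewrite /degop muE.
Qed.

Lemma add_strips_degop n c la : add_strips n (degop c) la = (sumn la + n)%:R * add_strips n c la.
Proof.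
rewrite /add_strips big_distrr big_seq [RHS]big_seq; apply: eq_bigr => mu /=.
by rewrite mem_parts_of => /eqP e; rewrite /degop e mulrCA.
Qed.

(** Multiplication by the sum of y_n p_n in Schur coordinates: no strip with more than |la| boxes
    can be removed from la, so the sum stops there. *)
Definition psop y c la : A := \sum_(1 <= n < (sumn la).+1) y n * rem_strips n 1 c la.

Lemma psop_widen L y c la : (sumn la < L)%N ->
  psop y c la = \sum_(1 <= n < L) y n * rem_strips n 1 c la.
Proof.
move=> laL; rewrite /psop [RHS](big_cat_nat (n := (sumn la).+1)) //=.
rewrite [X in _ = _ + X]big_nat_cond [X in _ = _ + X]big1 ?addr0 // => n.
by rewrite andbT => /andP[nl _]; rewrite rem_strips_gt ?mulr0 // (leq_trans _ nl).
Qed.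

Lemma rem_strips_psop L n x y c la : (0 < n)%N -> (sumn la < L)%N ->
  rem_strips n x (psop y c) la = \sum_(1 <= m < L) y m * rem_strips n x (rem_strips m 1 c) la.
Proof.
move=> n0 laL; rewrite -rem_strips_sum; apply: rem_strips_ext_lt => // mu muL.
by apply: psop_widen; apply: ltn_trans laL.
Qed.

(** The degree operator is a derivation and p_n has degree n. *)
Lemma psop_degop y c la :
  degop (psop y c) la = psop y (degop c) la + psop (fun n => n%:R * y n) c la.
Proof.
rewrite /degop /psop big_distrr -big_split; apply: eq_big_nat => n /andP[n0 _] /=.
by rewrite mulrCA rem_strips_degop // mulrDr (mulrC n%:R (y n)) mulrA.
Qed.

Lemma psop_ext y c c' la : (forall mu, (sumn mu < sumn la)%N -> c mu = c' mu) ->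
  psop y c la = psop y c' la.
Proof.
move=> e; apply: eq_big_nat => n /andP[n0 _]; congr (_ * _).
exact: rem_strips_ext_lt.
Qed.

Lemma psopZ y a c la : psop y (fun mu => a * c mu) la = a * psop y c la.
Proof.
rewrite /psop big_distrr; apply: eq_bigr => n _ /=.
by rewrite rem_stripsZ mulrCA.
Qed.

Definition vac la : A := (la == empty_partition)%:R.

Lemma degop_vac la : degop vac la = 0.
Proof.
by rewrite /degop /vac; case: eqP => [->|_]; rewrite ?mul0r ?mulr0.
Qed.

Hypothesis nat_unit : forall n, (0 < n)%N -> (n%:R : A) \is a GRing.unit.

Let two_unit : (2%:R : A) \is a GRing.unit := nat_unit (isT : 0 < 2)%N.

Lemma psopC y z c la : psop y (psop z c) la = psop z (psop y c) la.
Proof.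
rewrite /psop; under eq_big_nat => n /andP[n0 _].
  by rewrite (rem_strips_psop (L := (sumn la).+1)) // big_distrr /=; over.
rewrite exchange_big; apply: eq_big_nat => m /andP[m0 _] /=.
rewrite (rem_strips_psop (L := (sumn la).+1)) // big_distrr; apply: eq_big_nat => n /andP[n0 _] /=.
rewrite mulrCA; congr (_ * (_ * _)); apply/eqP; rewrite -subr_eq0.
by rewrite rem_strips_comm ?unitr1 // !expr1n subrr mul0r.
Qed.

(** Schur coordinates of exp(sum_n cn_n p_n / n). The k-th power of the exponent starts in degree k,
    so k <= |la| suffices. By the Cauchy identity the value at la is s_la under p_n |-> cn_n, as
    [specializes_schur] confirms. *)
Definition expco (cn : nat -> A) la : A :=
  \sum_(k < (sumn la).+1) k`!%:R^-1 * iter k (psop (fun n => cn n / n%:R)) vac la.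

Section Exp.
Variable cn : nat -> A.
Local Notation Y := (psop (fun n => cn n / n%:R)).
Local Notation Ex := (expco cn).

Lemma iter_psop_degop k la : degop (iter k.+1 Y vac) la = k.+1%:R * psop cn (iter k Y vac) la.
Proof.
have cE c mu : psop (fun n => n%:R * (cn n / n%:R)) c mu = psop cn c mu.
  by apply: eq_big_nat => n /andP[n0 _]; rewrite mulrCA mulrV ?mulr1 // nat_unit.
elim: k la => [|k IHk] la; rewrite [iter _.+1 _ _]/= psop_degop cE.
  rewrite mul1r (@psop_ext _ _ (fun mu => 0 * vac mu)) ?psopZ ?mul0r ?add0r //.
  by move=> mu _; rewrite degop_vac mul0r.
rewrite (@psop_ext _ _ (fun mu => k.+1%:R * psop cn (iter k Y vac) mu)) => [|mu _].
  by rewrite psopZ psopC -[k.+2%:R]natr1 [RHS]mulrDl mul1r.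
exact: IHk.
Qed.

Lemma iter_psop_eq0 y k la : (sumn la < k)%N -> iter k (psop y) vac la = 0.
Proof.
elim: k la => // k IHk la lak /=.
rewrite (@psop_ext _ _ (fun mu => 0 * vac mu)) ?psopZ ?mul0r // => mu mula.
by rewrite IHk ?mul0r // (leq_trans mula).
Qed.

Lemma expcoE L la : (sumn la < L)%N ->
  Ex la = \sum_(0 <= k < L) k`!%:R^-1 * iter k Y vac la.
Proof.
move=> laL; rewrite /expco -(big_mkord xpredT (fun k => k`!%:R^-1 * iter k Y vac la)).
rewrite [RHS](big_cat_nat (n := (sumn la).+1)) //=.
rewrite [X in _ = _ + X]big_nat_cond [X in _ = _ + X]big1 ?addr0 // => n.
by rewrite andbT => /andP[nl _]; rewrite iter_psop_eq0 ?mulr0.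
Qed.

Lemma expco0 : Ex empty_partition = 1.
Proof. by rewrite /expco big_ord1 /= /vac eqxx mulr1 invr1. Qed.

(** Differentiating an exponential multiplies it by the derivative of the exponent, and the degree
    operator turns cn_n p_n / n into cn_n p_n. As [psop] only sees smaller partitions, this is a
    recursion for the coordinates. *)
Lemma expco_euler la : degop Ex la = psop cn Ex la.
Proof.
rewrite /degop (expcoE (ltnSn _)) big_distrr big_nat_recl //=.
rewrite invr1 mul1r -/(degop vac la) degop_vac add0r.
rewrite (@psop_ext _ _ (fun mu =>
    \sum_(0 <= k < sumn la) k`!%:R^-1 * iter k Y vac mu)) => [|mu]; last exact: expcoE.
rewrite /psop; under [RHS]eq_big_nat => n _ do rewrite rem_strips_sum big_distrr /=.
rewrite exchange_big; apply: eq_big_nat => k _ /=.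
rewrite mulrCA -/(degop (Y (iter k Y vac)) la) -[Y (iter _ _ _)]/(iter k.+1 Y vac).
rewrite iter_psop_degop mulrA factS natrM invrM ?nat_unit ?fact_gt0 // divrK ?nat_unit //.
by rewrite /psop big_distrr; apply: eq_bigr => n _ /=; rewrite mulrCA.
Qed.

(* The exponential is a coherent state. *)
Lemma add_strips_expco k la : (0 < k)%N -> add_strips k Ex la = cn k * Ex la.
Proof.
move=> k0; have [d] := ubnP (sumn la); elim: d la => // d IHd la lad.
have u : ((sumn la + k)%:R : A) \is a GRing.unit by rewrite nat_unit // addn_gt0 k0 orbT.
apply: (mulrI u); rewrite -add_strips_degop; pose L := (sumn la + k).+1.
(* After [degop Ex] is expanded, the commutator moves [add_strips k] past each strip removal: the
   commuted terms give cn k * |la| * Ex la by induction, and the central term adds cn k * k * Ex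
   la. *)
have -> : add_strips k (degop Ex) la = \sum_(1 <= n < L) cn n * add_strips k (rem_strips n 1 Ex) la.
  rewrite -add_strips_sum /add_strips big_seq [RHS]big_seq; apply: eq_bigr => mu.
  rewrite mem_parts_of => /eqP e; rewrite expco_euler (psop_widen (L := L)) //.
  by rewrite e.
transitivity (\sum_(1 <= n < L) (cn n * rem_strips n 1 (add_strips k Ex) la +
    (if n == k then cn k * (k%:R * Ex la) else 0))).
  apply: eq_big_nat => n /andP[n0 _].
  have /eqP := add_rem_strips_comm two_unit Ex la k0 n0; rewrite subr_eq => /eqP ->.
  rewrite mulrDr addrC eq_sym; congr (_ + _); case: eqP => [->|_]; first by rewrite mul1r.
  by rewrite mul0r mulr0.
rewrite big_split /= -big_mkcond /=.
rewrite [X in _ + X](_ : _ = cn k * (k%:R * Ex la)); last first.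
  by rewrite big_nat1_eq /L ltnS leq_addl k0.
have -> : \sum_(1 <= n < L) cn n * rem_strips n 1 (add_strips k Ex) la = cn k * degop Ex la.
  rewrite expco_euler (psop_widen (L := L)) /L ?ltnS ?leq_addr // big_distrr.
  apply: eq_big_nat => n /andP[n0 _] /=; rewrite mulrCA; congr (_ * _).
  by rewrite -rem_stripsZ; apply: rem_strips_ext_lt => // mu mula; apply: IHd; lia.
by rewrite /degop natrD; ring.
Qed.

End Exp.
End ExpCoef.

(** N is a sum of two positive integers in N - 1 ways; the vanishing of [g] from L on accounts for
    the pairs with large sum. *)
Lemma sum_antidiag (V : nmodType) (g : nat -> V) L :
    (forall n, (L <= n)%N -> g n = 0) ->
  \sum_(1 <= n < L) \sum_(1 <= m < L) g (n + m)%N = \sum_(1 <= n < L) g n *+ n.-1.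
Proof.
move=> g0; transitivity (\sum_(1 <= n < L) \sum_(1 <= k < L | (n < k)%N) g k).
  apply: eq_big_nat => n /andP[n0 nL].
  rewrite [RHS](big_cat_nat (n := n.+1)) //= [X in _ = X + _]big_nat_cond.
  rewrite [X in _ = X + _]big1 ?add0r => [|k /andP[/andP[_ +] nk]]; last first.
    by rewrite ltnS leqNgt nk.
  transitivity (\sum_(n.+1 <= k < L) g k); last first.
    rewrite [LHS]big_nat_cond [RHS]big_nat_cond; apply: eq_bigl => k.
    by case: (n < k)%N; rewrite ?andbT ?andbF.
  transitivity (\sum_(n.+1 <= k < L + n) g k).
    by rewrite -[n.+1 in RHS]add1n big_addn addnK; apply: eq_bigr => m _; rewrite addnC.
  rewrite (big_cat_nat (n := L)) ?leq_addr //= [X in _ + X]big_nat_cond.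
  by rewrite [X in _ + X]big1 ?addr0 // => k; rewrite andbT => /andP[/g0].
rewrite (exchange_big_dep_nat xpredT) //=; apply: eq_big_nat => k /andP[k0 kL].
transitivity (\sum_(1 <= n < k) g k); last by rewrite sumr_const_nat subn1.
by rewrite [RHS](big_nat_widen _ _ L) // ltnW.
Qed.

Lemma partition_gt0 (la : Defs.partition) : la != empty_partition -> (0 < sumn la)%N.
Proof.
move=> ne; have /andP[_] := partsP la.
have : parts la != [::] by apply: contra ne => /eqP e; apply/eqP/val_inj.
by case: (parts la) => //= -[|x] s //; rewrite mem_head.
Qed.

(** * Content recursions for the two exponentials *)

Section Twist.
Variables (A : idomainType) (v : A).
Hypothesis nat_unit : forall n, (0 < n)%N -> (n%:R : A) \is a GRing.unit.
Hypothesis v_unit : v \is a GRing.unit.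
Hypothesis qint_unit : forall n, (0 < n)%N -> qint v n%:Z \is a GRing.unit.
Implicit Types (c : Defs.partition -> A) (la mu : Defs.partition).
Local Notation q := (v ^+ 2).
Local Notation br n := (qint v n%:Z).

Let two_unit : (2%:R : A) \is a GRing.unit := nat_unit (isT : 0 < 2)%N.
Let q_unit : q \is a GRing.unit. Proof. by rewrite unitrX. Qed.

Lemma qint_pow n : q ^+ n - 1 = v ^+ n * br n.
Proof.
rewrite /qint mulrBr -exprnN mulrV ?unitrX // -exprnP -exprM mul2n -addnn exprD.
by [].
Qed.

Definition contents la : A := \sum_(b <- skew_boxes la [::]) q ^ content b.

(** A strip of n boxes starting at content c adds q^c (q^n - 1)/(q - 1) to [contents], and {1} = (q
    - 1)/v clears the denominator. *)
Lemma contents_comm n c la : (0 < n)%N ->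
  br 1 * (contents la * rem_strips n 1 c la) =
  rem_strips n 1 (fun mu => br 1 * (contents mu * c mu)) la +
    (q ^+ n - 1) / v * rem_strips n q c la.
Proof.
move=> n0; rewrite /rem_strips !big_distrr -big_split /=; apply: eq_bigr => mu _.
case: (eqVneq (strip A n mu la) 0) => [->|s0]; first by rewrite !mul0r !mulr0 addr0.
have [sz sub E] := strip_contents (fun z => q ^ z : A) n0 s0.
have -> : contents la = contents mu + q ^ cmin n mu la * \sum_(t < n) q ^+ t.
  rewrite /contents (big_skew_sub _ sz sub) E big_distrr; congr (_ + _).
  by apply: eq_bigr => t _; rewrite exprzDr.
rewrite exp1rz subrX1; have -> : q - 1 = v * br 1 by have := qint_pow 1; rewrite !expr1.
set S := \sum_(t < n) _; have -> : v * br 1 * S / v = br 1 * S.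
  by rewrite -(mulrA v) mulrC mulKr.
by move: (strip _ _ _ _) S (contents mu) => *; ring.
Qed.

Section Coherent.
Variable cn : nat -> A.
Local Notation Ex := (expco cn).

(** The source terms come from [E_k^x, M_n] = (x^n - 1) E_(k+n)^x, and the last term from the degree
    k of the operator itself. *)
Lemma degop_rem_strips_expco L k x la : (0 < k)%N -> (sumn la < L)%N -> x \is a GRing.unit ->
  degop (rem_strips k x Ex) la = psop cn (rem_strips k x Ex) la +
    \sum_(1 <= n < L) cn n * (x ^+ n - 1) * rem_strips (k + n) x Ex la +
    k%:R * rem_strips k x Ex la.
Proof.
move=> k0 laL xU; rewrite /degop rem_strips_degop //; congr (_ + _).
rewrite (@rem_strips_ext _ _ _ _ (psop cn Ex)) => [|mu _]; last exact: expco_euler.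
rewrite (rem_strips_psop (L := L)) // (psop_widen (L := L)) // -big_split.
apply: eq_big_nat => n /andP[n0 _] /=; rewrite -mulrA -mulrDr; congr (_ * _).
have := rem_strips_comm two_unit Ex la k0 n0 xU (unitr1 _).
by rewrite expr1n mulr1 => /eqP; rewrite subr_eq addrC => /eqP.
Qed.

Lemma degop_contents_expco L la : (sumn la < L)%N ->
  degop (fun mu => br 1 * (contents mu * Ex mu)) la =
  psop cn (fun mu => br 1 * (contents mu * Ex mu)) la +
    \sum_(1 <= n < L) cn n * (q ^+ n - 1) / v * rem_strips n q Ex la.
Proof.
move=> laL; transitivity (br 1 * (contents la * degop Ex la)); first by rewrite /degop; ring.
rewrite expco_euler // !(psop_widen (L := L)) // !big_distrr -big_split.
apply: eq_big_nat => n /andP[n0 _] /=.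
transitivity (cn n * (br 1 * (contents la * rem_strips n 1 Ex la))); first by ring.
by rewrite contents_comm // mulrDr !mulrA.
Qed.

(** The value at la is |la|^(-1) times a combination of values at smaller partitions. This
    uniqueness reduces the recursions below to a comparison of Euler equations. *)
Lemma degop_eq_psop0 c : (forall la, degop c la = psop cn c la) -> c empty_partition = 0 ->
  forall la, c la = 0.
Proof.
move=> E c0 la; have [d] := ubnP (sumn la); elim: d la => // d IHd la lad.
case: (posnP (sumn la)) => [l0|l0].
  by case: (eqVneq la empty_partition) => [->//|/partition_gt0]; rewrite l0.
apply: (mulrI (nat_unit l0)); rewrite mulr0 -/(degop c la) E.
rewrite (@psop_ext _ _ _ (fun mu => 0 * c mu)) ?psopZ ?mul0r // => mu mula.
by rewrite mul0r IHd // (leq_trans mula).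
Qed.

End Coherent.

Lemma contents_empty : contents empty_partition = 0.
Proof. by rewrite /contents big_nil. Qed.

Lemma rem_strips_empty n x c : (0 < n)%N -> rem_strips n x c empty_partition = 0.
Proof. by move=> n0; rewrite rem_strips_gt. Qed.

(** The values p_n(q^rho). [cneg] is their image under the involution omega, which multiplies p_n by
    (-1)^(n-1), and [cneg n / n] is the coefficient in the Baxter exponent at t = 1. *)
Definition cpos n : A := (br n)^-1.
Definition cneg n : A := (-1) ^+ n.-1 * (br n)^-1.

Lemma cposE n : (0 < n)%N -> cpos n * (q ^+ n - 1) = v ^+ n.
Proof. by move=> n0; rewrite /cpos qint_pow mulrCA mulVr ?mulr1 // qint_unit. Qed.

Lemma cnegE n : (0 < n)%N -> cneg n * (q ^+ n - 1) = - (- v) ^+ n.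
Proof.
move=> n0; rewrite /cneg -mulrA -/(cpos n) cposE // [in RHS]exprNn -mulNr.
by congr (_ * _); case: n n0 => // n _; rewrite exprS mulN1r opprK.
Qed.

(** Since cpos_n (q^n - 1) = v^n, both sides satisfy the Euler equation with the same source, the
    sum of v^(n-1) E_n^q: on the left from the commutators with [contents], on the right from those
    of E_1^q, where the index is shifted by one and the degree of E_1^q supplies n = 1. *)
Lemma contents_expco_pos la :
  br 1 * (contents la * expco cpos la) = rem_strips 1 q (expco cpos) la.
Proof.
apply/eqP; rewrite -subr_eq0; apply/eqP.
pose H mu := br 1 * (contents mu * expco cpos mu) - rem_strips 1 q (expco cpos) mu.
rewrite -/(H la); move: la; apply: (@degop_eq_psop0 cpos); last first.
  by rewrite /H contents_empty mul0r mulr0 rem_strips_empty // subrr.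
move=> la; set L := (sumn la).+1; have laL : (sumn la < L)%N by [].
have -> : psop cpos H la = psop cpos (fun mu => br 1 * (contents mu * expco cpos mu)) la -
    psop cpos (rem_strips 1 q (expco cpos)) la.
  by rewrite /psop -sumrB; apply: eq_bigr => n _; rewrite rem_stripsB mulrBr.
have -> : degop H la = degop (fun mu => br 1 * (contents mu * expco cpos mu)) la -
    degop (rem_strips 1 q (expco cpos)) la by rewrite /degop mulrBr.
rewrite (degop_contents_expco _ laL) (degop_rem_strips_expco _ _ laL) //.
set r := fun n => rem_strips n q (expco cpos) la.
have -> : \sum_(1 <= n < L) cpos n * (q ^+ n - 1) / v * rem_strips n q (expco cpos) la =
    \sum_(1 <= n < L.+1) v ^+ n.-1 * r n.
  rewrite [RHS]big_nat_recr //= [r L]rem_strips_gt // mulr0 addr0.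
  apply: eq_big_nat => n /andP[n0 _]; rewrite cposE //; congr (_ * _).
  by case: n n0 => // n _; rewrite exprSr mulrK.
have -> : \sum_(1 <= n < L) cpos n * (q ^+ n - 1) * rem_strips (1 + n) q (expco cpos) la =
    \sum_(1 <= n < L) v ^+ n * r n.+1.
  by apply: eq_big_nat => n /andP[n0 _]; rewrite cposE.
rewrite big_add1 /= big_ltn // expr0 !mul1r.
by rewrite [r 1%N]/(rem_strips 1 q (expco cpos) la); ring.
Qed.

(** The left side is the source that the commutators with [contents] produce for [cneg]. The
    difference J of the two sides satisfies |la| J = psop J + J, so in degree at least 2 it vanishes
    if it does at all smaller partitions. In degree 0 there is nothing to remove, and in degree 1
    the only box has content 0, where q and 1 give the same weight. *)
Lemma expco_neg_content_sum L la : (sumn la < L)%N ->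
  \sum_(1 <= n < L) (- v) ^+ n.-1 * rem_strips n q (expco cneg) la = rem_strips 1 1 (expco cneg) la.
Proof.
pose J mu := \sum_(1 <= n < L) (- v) ^+ n.-1 * rem_strips n q (expco cneg) mu -
  rem_strips 1 1 (expco cneg) mu.
move=> laL; apply/eqP; rewrite -subr_eq0 -/(J la); apply/eqP.
have [d] := ubnP (sumn la); elim: d la laL => // d IHd la laL lad.
case: (posnP (sumn la)) => [l0|l0].
  rewrite /J big_nat_cond big1 => [|n]; first by rewrite rem_strips_gt ?l0 // subrr.
  by rewrite andbT => /andP[n0 _]; rewrite rem_strips_gt ?l0 // mulr0.
case: (eqVneq (sumn la) 1%N) => [l1|l1].
  rewrite /J big_ltn; last by rewrite -l1.
  rewrite big_nat_cond big1 => [|n]; last first.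
    by rewrite andbT => /andP[n0 _]; rewrite rem_strips_gt ?mulr0 ?l1 // ltnW.
  rewrite expr0 mul1r addr0; apply/eqP; rewrite subr_eq0; apply/eqP.
  have sz : (size la <= 1)%N.
    have /andP[_] := partsP la; move: l1.
    by case: (parts la) => [|[|x] [|[|y] s]] //=; rewrite ?inE //; lia.
  rewrite !(rem_strips_alt (N := 0)) //; apply: eq_bigr => i _; congr (_ * _).
  have -> : (beta 1 la i)%:Z - 1%N%:Z - 0%N%:Z = 0.
    rewrite ffunE; have -> : i = ord0 by apply/val_inj; case: i => -[].
    move: l1; have /andP[_] := partsP la.
    by case: (parts la) sz => [|x [|y s]] //= _; rewrite ?inE; lia.
  by rewrite !expr0z.
have EJ : degop J la = psop cneg J la + J la.
  rewrite {1}/degop {1}/J mulrBr big_distrr /=.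
  rewrite -/(degop (rem_strips 1 1 (expco cneg)) la) (degop_rem_strips_expco _ _ laL) ?unitr1 //.
  under eq_big_nat => n /andP[n0 _].
    rewrite mulrCA -/(degop (rem_strips n q (expco cneg)) la).
    rewrite (degop_rem_strips_expco _ n0 laL q_unit).
    rewrite !mulrDr; over.
  rewrite !big_split /=.
  have -> : \sum_(1 <= n < L) cneg n * (1 ^+ n - 1) * rem_strips (1 + n) 1 (expco cneg) la = 0.
    by rewrite big1 // => n _; rewrite expr1n subrr mulr0 mul0r.
  have -> : psop cneg J la =
      \sum_(1 <= n < L) (- v) ^+ n.-1 * psop cneg (rem_strips n q (expco cneg)) la -
      psop cneg (rem_strips 1 1 (expco cneg)) la.
    rewrite (psop_widen (L := L)) // [psop _ (rem_strips 1 1 _) _](psop_widen (L := L)) //.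
    under eq_bigr do rewrite rem_stripsB rem_strips_sum mulrBr big_distrr /=.
    rewrite sumrB; congr (_ - _); rewrite exchange_big; apply: eq_bigr => n _ /=.
    rewrite (psop_widen (L := L)) // big_distrr; apply: eq_bigr => m _ /=.
    by rewrite mulrCA.
  (* The commutators contribute -(N - 1) g N and the degrees of the operators N g N, so one g N is
     left. *)
  pose g N := (- v) ^+ N.-1 * rem_strips N q (expco cneg) la.
  have -> : \sum_(1 <= n < L) (- v) ^+ n.-1 *
      (\sum_(1 <= m < L) cneg m * (q ^+ m - 1) * rem_strips (n + m) q (expco cneg) la) =
      - \sum_(1 <= n < L) g n *+ n.-1.
    rewrite -sum_antidiag => [|n Ln]; last by rewrite /g rem_strips_gt ?mulr0 //; lia.
    rewrite -sumrN; apply: eq_big_nat => n /andP[n0 _]; rewrite big_distrr -sumrN.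
    apply: eq_big_nat => m /andP[m0 _] /=; rewrite cnegE // /g.
    have -> : (n + m).-1 = (n.-1 + m)%N by lia.
    by rewrite exprD; ring.
  have -> : \sum_(1 <= n < L) (- v) ^+ n.-1 * (n%:R * rem_strips n q (expco cneg) la) =
      \sum_(1 <= n < L) g n *+ n.-1 + \sum_(1 <= n < L) g n.
    rewrite -big_split; apply: eq_big_nat => n /andP[n0 _] /=.
    by rewrite -mulrSr prednK // -[RHS]mulr_natl /g mulrCA.
  rewrite /J -/g; set X := \sum_(1 <= n < L) _ *+ _; ring.
have pJ : psop cneg J la = 0.
  rewrite (@psop_ext _ _ _ (fun mu => 0 * J mu)) ?psopZ ?mul0r // => mu mula.
  by rewrite mul0r IHd //; [exact: ltn_trans laL|exact: leq_trans mula lad].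
have l2 : (0 < (sumn la).-1)%N by lia.
apply: (mulrI (nat_unit l2)); rewrite mulr0.
have := EJ; rewrite pJ add0r /degop -[in X in X%:R * _](prednK l0) -natr1 mulrDl mul1r.
by move=> e; apply: (addIr (J la)); rewrite e add0r.
Qed.

(** M_1 commutes with all M_n, so the Euler equation of the right side has M_1 itself as only
    source; the source of the left side is brought to this form by [expco_neg_content_sum]. *)
Lemma contents_expco_neg la :
  br 1 * (contents la * expco cneg la) = rem_strips 1 1 (expco cneg) la.
Proof.
apply/eqP; rewrite -subr_eq0; apply/eqP.
pose H mu := br 1 * (contents mu * expco cneg mu) - rem_strips 1 1 (expco cneg) mu.
rewrite -/(H la); move: la; apply: (@degop_eq_psop0 cneg); last first.
  by rewrite /H contents_empty mul0r mulr0 rem_strips_empty // subrr.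
move=> la; set L := (sumn la).+1; have laL : (sumn la < L)%N by [].
have -> : psop cneg H la = psop cneg (fun mu => br 1 * (contents mu * expco cneg mu)) la -
    psop cneg (rem_strips 1 1 (expco cneg)) la.
  by rewrite /psop -sumrB; apply: eq_bigr => n _; rewrite rem_stripsB mulrBr.
have -> : degop H la = degop (fun mu => br 1 * (contents mu * expco cneg mu)) la -
    degop (rem_strips 1 1 (expco cneg)) la by rewrite /degop mulrBr.
rewrite (degop_contents_expco _ laL) (degop_rem_strips_expco _ _ laL) ?unitr1 //.
have -> : \sum_(1 <= n < L) cneg n * (1 ^+ n - 1) * rem_strips (1 + n) 1 (expco cneg) la = 0.
  by rewrite big1 // => n _; rewrite expr1n subrr mulr0 mul0r.
rewrite -(expco_neg_content_sum laL).
have -> : \sum_(1 <= n < L) cneg n * (q ^+ n - 1) / v * rem_strips n q (expco cneg) la =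
    \sum_(1 <= n < L) (- v) ^+ n.-1 * rem_strips n q (expco cneg) la.
  apply: eq_big_nat => n /andP[n0 _]; rewrite cnegE //; congr (_ * _).
  by case: n n0 => // n _; rewrite exprSr mulrN opprK mulrK.
by rewrite addr0 mul1r; ring.
Qed.

Lemma strip_kappa n la mu : (0 < n)%N -> strip A n la mu != 0 ->
  kappa mu = kappa la + 2 * (n%:Z * cmin n la mu + 'C(n, 2)%:Z).
Proof.
move=> n0 /(strip_contents id n0)[sz sub E].
rewrite !kappa_contents (big_skew_sub _ sz sub) E mulrDr; congr (_ + 2 * _).
rewrite big_split /= sumr_const card_ord -mulr_natl natz; congr (_ + _).
by rewrite -bin2_sum big_mkord (big_morph Posz PoszD (erefl _)).
Qed.

Hypothesis contents_neq0 : forall la, la != empty_partition -> contents la != 0.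

(** Removing a box of content c lowers kappa by 2 c, and v^(2 c) = q^c, so the factor v^(-kappa)
    trades the weight of E_1^q for the weight 1 of M_1. The factor [contents la] cancels in the
    integral domain. *)
Lemma expco_twist la : expco cneg la = v ^ (- kappa la) * expco cpos la.
Proof.
have [d] := ubnP (sumn la); elim: d la => // d IHd la lad.
case: (eqVneq la empty_partition) => [->|ne].
  by rewrite !expco0 mulr1 /kappa big_ord0 oppr0 expr0z.
have b0 : br 1 != 0 by apply: contraTneq (qint_unit (isT : 0 < 1)%N) => ->; rewrite unitr0.
apply: (mulfI b0); apply: (mulfI (contents_neq0 ne)).
rewrite mulrCA contents_expco_neg.
transitivity (v ^ (- kappa la) * rem_strips 1 q (expco cpos) la); last first.
  by rewrite -contents_expco_pos; ring.
rewrite /rem_strips big_distrr big_seq [RHS]big_seq; apply: eq_bigr => mu /=.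
rewrite mem_parts_of => /eqP muE.
case: (eqVneq (strip A 1 mu la) 0) => [->|s0]; first by rewrite !mul0r mulr0.
have [_ _ sE] := strip_neq0 (isT : 0 < 1)%N s0.
rewrite exp1rz mulr1 mulrA mulrCA -mulrA; congr (_ * _).
rewrite IHd; last by lia.
congr (_ * _).
rewrite (strip_kappa (isT : 0 < 1)%N s0) exprnP exprz_exp -exprzDr //.
congr (v ^ _); rewrite bin_small //; lia.
Qed.

End Twist.

(** * Symmetric functions *)

Lemma nth_incr_parts (s : seq nat) i : (forall x, x \in s -> i <= x)%N ->
  (i * size s <= sumn s)%N /\ (sumn s = i * size s -> s = nseq (size s) i)%N.
Proof.
elim: s => [|x s IHs] h; first by rewrite muln0.
have ix := h x (mem_head _ _).
have [|h1 h2] := IHs; first by move=> y ys; apply: h; rewrite inE ys orbT.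
rewrite /= mulnS; split; first by rewrite leq_add.
move=> e; have sE : (sumn s = i * size s)%N by lia.
by rewrite -(h2 sE); congr (_ :: _); lia.
Qed.

Lemma ssyt_entry_ge (mu : Defs.partition) T i x :
  is_ssyt mu T -> x \in trow T i -> (i <= x)%N.
Proof.
move=> [sh _ col] /(nthP 0%N)[j jT <-]; rewrite size_trow sh in jT.
elim: i jT => // i IHi jT; apply: leq_ltn_trans (col i j jT).
by apply: IHi; apply: leq_trans jT (nth_parts_le mu i).
Qed.

(** The statistic n(la), with rows counted from 0. It replaces the dominance order in the
    triangularity of the Kostka matrix. *)
Definition row_weight (la : seq nat) : nat := \sum_(i < size la) i * nth 0 la i.

Lemma sumn_letters u : sumn (letters u) = row_weight u.
Proof.
rewrite /letters sumn_flatten -map_comp sumnE big_map /row_weight.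
rewrite -(big_mkord xpredT (fun i => i * nth 0 u i))%N.
by rewrite /index_iota subn0; apply: eq_bigr => i _; rewrite /= sumn_nseq.
Qed.

(** Entries of row i are at least i, so the sum of all entries is at least [row_weight mu]; equality
    forces every entry of row i to be i. *)
Lemma ssyts_row_weight (mu la : Defs.partition) T : T \in ssyts mu la ->
  (row_weight mu <= row_weight la)%N /\
  (row_weight mu = row_weight la ->
     T = mkseq (fun i => nseq (nth 0 mu i) i) (size mu))%N.
Proof.
case/ssytsP=> sT p; have [sh _ _] := sT; have szT : size T = size mu by rewrite -sh size_map.
have rowP i : (i * nth 0 mu i <= sumn (trow T i))%N /\
    (sumn (trow T i) = i * nth 0 mu i -> trow T i = nseq (nth 0 mu i) i)%N.
  have := @nth_incr_parts (trow T i) i; rewrite size_trow sh; apply=> x.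
  exact: ssyt_entry_ge sT.
have wE : row_weight la = (\sum_(i < size mu) sumn (trow T i))%N.
  rewrite -sumn_letters -(perm_sumn p) sumn_flatten sumnE big_map (big_nth [::]).
  by rewrite szT big_mkord.
rewrite wE; split=> [|e]; first by apply: leq_sum => i _; have [] := rowP i.
apply: (@eq_from_nth _ [::]) => [|i]; rewrite ?size_mkseq // szT => il.
rewrite nth_mkseq //; have [_] := rowP i; apply.
have le : forall j : 'I_(size mu), true -> (j * nth 0 mu j <= sumn (trow T j) ?= iff
    (j * nth 0 mu j == sumn (trow T j)))%N.
  by move=> j _; split=> //; have [] := rowP j.
have [_ /esym] := leqif_sum le; rewrite -/(row_weight mu) e eqxx.
by move/forall_inP/(_ (Ordinal il) isT)/eqP => /=.
Qed.

Lemma ssyts_diag (la : Defs.partition) : size (ssyts la la) = 1%N.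
Proof.
set T0 := mkseq (fun i => nseq (nth 0 la i) i)%N (size la).
have T0S : T0 \in ssyts la la.
  have row i : trow T0 i = nseq (nth 0 la i) i.
    case: (ltnP i (size la)) => il; first by rewrite /trow nth_mkseq.
    by rewrite /trow nth_default ?size_mkseq // nth_default.
  apply/ssytsP; split; last exact: perm_refl.
  split.
  - apply: (@eq_from_nth _ 0%N) => [|i]; rewrite size_map size_mkseq // => il.
    by rewrite -size_trow row size_nseq.
  - apply/(all_nthP [::]) => i _; rewrite -/(trow T0 i) row.
    rewrite (sorted_pairwise leq_trans); elim: (nth _ _ _) => //= d ->.
    by rewrite all_nseq leqnn orbT.
  move=> i j jl; rewrite !row !nth_nseq jl.
  by rewrite (leq_trans jl (nth_parts_le la i)).
have -> : 1%N = size [:: T0] by [].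
apply: perm_size; apply: uniq_perm; rewrite ?undup_uniq // => T; rewrite inE.
apply/idP/eqP => [/ssyts_row_weight[_ ->]//|->//].
Qed.

Lemma letters_inj (la mu : Defs.partition) : perm_eq (letters la) (letters mu) -> la = mu.
Proof.
by move/perm_count_mem => h; apply: partition_ext => i; rewrite -!count_letters.
Qed.

Lemma fsum_seq (V : nmodType) (I : choiceType) (r : seq I) (D : set I) (F : I -> V) : uniq r ->
  (forall i, i \in r -> D i) -> (forall i, D i -> i \notin r -> F i = 0) ->
  \sum_(i \in D) F i = \sum_(i <- r) F i.
Proof.
move=> ur rD F0; rewrite (fsbigE r _ ur rD F0).
rewrite big_mkcond big_seq [RHS]big_seq; apply: eq_bigr => i /rD Di.
by rewrite ifT // inE.
Qed.

(** * Schur expansions and their uniqueness *)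

Section Symfun.
Variable A : comUnitRingType.
Implicit Types (c : Defs.partition -> A) (la mu : Defs.partition) (u : seq nat).
Implicit Types f g : symfun A.

Definition coef f u : A := symfun_series f (mon_of_seq u).

Lemma monom_seq (al : monom) : exists u, al = mon_of_seq u.
Proof.
pose B := (\max_(i <- finsupp al) i).+1; exists (mkseq al B).
apply/eqP/cmP => i; rewrite mon_of_seqE; case: (ltnP i B) => iB; first by rewrite nth_mkseq.
rewrite nth_default ?size_mkseq //; apply/eqP; rewrite cmE_eq0; apply/negP => il.
have : (i <= \max_(i <- finsupp al) i)%N by exact: leq_bigmax_seq.
by rewrite leqNgt iB.
Qed.

Lemma coef_ext f g : (forall u, coef f u = coef g u) -> f = g.
Proof.
move=> e; apply/val_inj/funext => al; have [u ->] := monom_seq al; exact: e.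
Qed.

Lemma coefZ a f u : coef (a *: f) u = a * coef f u.
Proof. by []. Qed.

Lemma coef_lin_sum I (r : seq I) (P : pred I) (F : I -> symfun A) u :
  coef (\sum_(i <- r | P i) F i) u = \sum_(i <- r | P i) coef (F i) u.
Proof. by elim/big_rec2: _ => // i x y _ <-. Qed.

Lemma coef_schur la u : coef (schur A la) u = kostka A u la.
Proof. by []. Qed.

Definition schur_sum c : symfun A := sf_sum setT (fun la => c la *: schur A la).

Lemma coef_sf_sum (I : choiceType) (D : set I) (F : I -> symfun A) u :
  coef (sf_sum D F) u = \sum_(i \in D) coef (F i) u.
Proof. by []. Qed.

Lemma fsum_parts d (F : Defs.partition -> A) : (forall la, sumn la != d -> F la = 0) ->
  \sum_(la \in setT) F la = \sum_(la <- parts_of d) F la.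
Proof.
move=> F0; apply: fsum_seq => // [|la _]; first exact: parts_of_uniq.
by rewrite mem_parts_of; exact: F0.
Qed.

Lemma coef_schur_sum c u :
  coef (schur_sum c) u = \sum_(la <- parts_of (sumn u)) c la * kostka A u la.
Proof.
rewrite coef_sf_sum -fsum_parts // => la ne.
by rewrite kostka_size ?mulr0.
Qed.

(** The Kostka matrix is unitriangular for [row_weight]: at content la, every other shape mu that
    occurs has smaller row weight and is covered by the induction. *)
Lemma schur_sum_inj c c' : schur_sum c = schur_sum c' -> c = c'.
Proof.
move=> e; apply/funext => la; have [w] := ubnP (row_weight la).
elim: w la => // w IHw la law.
have := congr1 (coef^~ (parts la)) e; rewrite !coef_schur_sum.
have lain : la \in parts_of (sumn la) by rewrite mem_parts_of.
rewrite !(bigD1_seq la) ?parts_of_uniq //= kostkaE ssyts_diag !mulr1.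
rewrite [X in _ + X = _](eq_bigr (fun mu => c' mu * kostka A la mu)) => [/addIr//|mu mula].
rewrite kostkaE; case E : (ssyts mu la) => [|T s]; first by rewrite !mulr0.
have TS : T \in ssyts mu la by rewrite E mem_head.
have [le eqw] := ssyts_row_weight TS; congr (_ * _); apply: IHw.
rewrite ltnS in law; apply: leq_trans law; rewrite ltn_neqAle le andbT.
apply: contra mula => /eqP /eqw TE; have /ssytsP[_] := TS.
by rewrite TE => /letters_inj ->.
Qed.

End Symfun.

Arguments coef : simpl never.

Section PowerSums.
Variable A : comUnitRingType.
Hypothesis nat_unit : forall n, (0 < n)%N -> (n%:R : A) \is a GRing.unit.
Implicit Types (c : Defs.partition -> A) (la mu : Defs.partition) (u : seq nat).
Implicit Types f g : symfun A.
Local Notation p_ := (powersum A).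
Local Notation W := (schur A).

Let two_unit : (2%:R : A) \is a GRing.unit := nat_unit (isT : 0 < 2)%N.

Lemma symfun_scalerAr (a : A) f g : f * (a *: g) = a *: (f * g).
Proof. by rewrite mulrC -scalerAl mulrC. Qed.

Lemma coef_powersum_mul n f u : (0 < n)%N ->
  coef (p_ n * f) u = \sum_(j < size u | (n <= nth 0%N u j)%N) coef f (decr_nth u j n).
Proof.
move=> n0; rewrite /coef.
rewrite -[LHS]/(ps_mul (powersum_series A n) (symfun_series f) (mon_of_seq u)) ps_mulE.
have pE (bc : monom * monom) : bc \in fset_set (splits (mon_of_seq u)) ->
    powersum_series A n bc.1 = \sum_(i < size u) (bc.1 == expcmn (ucm (i : nat)) n)%:R.
  rewrite mem_splits => /eqP bcE.
  rewrite -(big_mkord xpredT (fun i => (bc.1 == expcmn (ucm i) n)%:R)).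
  rewrite /powersum_series /ps_sum; apply: fsum_seq => //; first exact: iota_uniq.
  move=> i _; rewrite mem_index_iota /= -leqNgt => ui; rewrite /ps_monom.
  case: eqP => // e; have := congr1 (fun al : monom => al i) bcE.
  by rewrite mulcmE e expcmnE ucmE eqxx mon_of_seqE nth_default //; lia.
rewrite big_seq; under eq_bigr => bc bcS do rewrite pE // big_distrl /=.
rewrite -big_seq exchange_big [RHS]big_mkcond /=; apply: eq_bigr => j _.
case: ifP => nj; last first.
  rewrite big_seq big1 // => bc; rewrite mem_splits => /eqP bcE.
  case: eqP => [e|_]; last by rewrite mul0r.
  have := congr1 (fun al : monom => al (j : nat)) bcE.
  rewrite mulcmE e expcmnE ucmE eqxx mul1n mon_of_seqE => uj.
  by rewrite -uj leq_addr in nj.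
pose x : monom * monom := (expcmn (ucm (j : nat)) n, mon_of_seq (decr_nth u j n)).
have xS : mulcm x.1 x.2 = mon_of_seq u.
  apply/eqP/cmP => k; rewrite mulcmE expcmnE ucmE !mon_of_seqE nth_set_nth /=.
  by rewrite eq_sym; case: eqP => [->|_]; lia.
rewrite (bigD1_seq x) ?fset_uniq //=; last by rewrite mem_splits xS.
rewrite eqxx mul1r big_seq_cond big1 ?addr0 // => bc /andP[].
rewrite mem_splits => /eqP bcE ne; case: (bc.1 =P x.1) => [e|_]; last by rewrite mul0r.
case/eqP: ne; case: bc bcE e => b d /= bcE e; rewrite /x e; congr pair.
apply/eqP/cmP => k; have := congr1 (fun al : monom => al k) (etrans bcE (esym xS)).
by rewrite /= !mulcmE e => /eqP; rewrite eqn_add2l => /eqP.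
Qed.

(** With a strip matrix inside F, this moves a strip operator across a pairing of coordinates:
    [rem_strips] and [add_strips] are transposes. *)
Lemma exchange_parts n d (F : Defs.partition -> Defs.partition -> A) : (n <= d)%N ->
  \sum_(la <- parts_of (d - n)) \sum_(mu <- parts_of (sumn la + n)) F la mu =
  \sum_(mu <- parts_of d) \sum_(la <- parts_of (sumn mu - n)) F la mu.
Proof.
move=> nd; transitivity (\sum_(la <- parts_of (d - n)) \sum_(mu <- parts_of d) F la mu).
  rewrite big_seq [RHS]big_seq; apply: eq_bigr => la.
  by rewrite mem_parts_of => /eqP ->; rewrite subnK.
rewrite exchange_big big_seq [RHS]big_seq; apply: eq_bigr => mu.
by rewrite mem_parts_of => /eqP ->.
Qed.

Lemma coef_powersum_schur n la u : (0 < n)%N ->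
  coef (p_ n * W la) u = add_strips n (kostka A u) la.
Proof. by move=> n0; rewrite coef_powersum_mul // (kostka_add_strips two_unit). Qed.

Lemma powersum_schur_sum n c : (0 < n)%N ->
  p_ n * schur_sum c = schur_sum (rem_strips n 1 c).
Proof.
move=> n0; apply: coef_ext => u; rewrite coef_powersum_mul // coef_schur_sum.
case: (ltnP (sumn u) n) => nu.
  rewrite big1 => [|j nj]; last first.
    by have := sumn_decr_nth (ltn_ord j) nj; lia.
  rewrite big_seq big1 // => la; rewrite mem_parts_of => /eqP e.
  by rewrite rem_strips_gt ?mul0r // e.
transitivity (\sum_(la <- parts_of (sumn u - n)) c la * add_strips n (kostka A u) la).
  under [RHS]eq_bigr do rewrite (kostka_add_strips two_unit) // big_distrr /=.
  rewrite exchange_big; apply: eq_bigr => j nj; rewrite coef_schur_sum.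
  have -> : (sumn u - n = sumn (decr_nth u j n))%N; last by [].
  by rewrite -(sumn_decr_nth (ltn_ord j) nj) addnK.
rewrite /add_strips; under eq_bigr do rewrite big_distrr /=.
rewrite exchange_parts //; apply: eq_bigr => mu _; rewrite /rem_strips big_distrl.
by apply: eq_bigr => la _ /=; rewrite exp1rz; ring.
Qed.

Lemma schur_sum_lin I (r : seq I) (P : pred I) (a : I -> A) (F : I -> Defs.partition -> A) :
  schur_sum (fun la => \sum_(i <- r | P i) a i * F i la) =
  \sum_(i <- r | P i) a i *: schur_sum (F i).
Proof.
apply: coef_ext => u; rewrite coef_lin_sum coef_schur_sum.
under eq_bigr do rewrite big_distrl /=.
rewrite exchange_big; apply: eq_bigr => i _; rewrite coefZ coef_schur_sum big_distrr /=.
by apply: eq_bigr => la _; rewrite mulrA.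
Qed.

Lemma schur_sum_delta la : schur_sum (fun mu => (mu == la)%:R) = W la.
Proof.
apply: coef_ext => u; rewrite coef_schur_sum coef_schur.
transitivity (\sum_(mu <- parts_of (sumn u) | mu == la) kostka A u mu).
  rewrite [RHS]big_mkcond; apply: eq_bigr => mu _.
  by case: eqP => _; rewrite ?mul1r ?mul0r.
by rewrite big_parts_of_eq; case: eqP => // /eqP ne; rewrite kostka_size.
Qed.

Lemma schur_empty : W empty_partition = 1.
Proof.
apply: coef_ext => u; rewrite coef_schur kostkaE.
have -> : coef (1 : symfun A) u = ps_one A (mon_of_seq u) by reflexivity.
rewrite /ps_one.
case: (posnP (sumn u)) => [u0|u0]; last first.
  case E : (ssyts empty_partition u) => [|T s]; last first.
    have TS : T \in ssyts empty_partition u by rewrite E mem_head.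
    by rewrite -(ssyts_size TS) in u0.
  case: eqP => // e; have := size_letters u.
  have /weight_mon_of_seq : weight [::] = mon_of_seq u by rewrite e /weight big_nil.
  by move=> /perm_size <- /= e0; rewrite -e0 in u0.
have l0 : letters u = [::] by apply: size0nil; rewrite size_letters.
have uE : mon_of_seq u = onecm nat.
  apply/eqP/cmP => i; rewrite mon_of_seqE onecmE.
  by rewrite -count_letters l0.
rewrite uE eqxx; congr (_%:R).
transitivity (size [:: ([::] : seq (seq nat))]); last by [].
apply: perm_size; apply: uniq_perm; rewrite ?undup_uniq // => T; rewrite inE.
apply/ssytsP/eqP => [[[sh _ _] _]|->]; first by case: T sh.
by rewrite l0; split.
Qed.

Lemma schur_sum_vac : schur_sum (vac A) = 1.
Proof. by rewrite -schur_empty -schur_sum_delta. Qed.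

(** * Specialization of power sums *)

Section Specialization.
Variable cn : nat -> A.
Local Notation spec := (specializes cn).
Local Notation Ex := (expco cn).

Lemma specializes0 : spec 0 0.
Proof. by exists [::]; rewrite !big_nil; split. Qed.

Lemma specializesD f g r s : spec f r -> spec g s -> spec (f + g) (r + s).
Proof.
move=> [e [e0 -> ->]] [e' [e0' -> ->]]; exists (e ++ e'); rewrite !big_cat.
by split=> // t; rewrite mem_cat => /orP[/e0|/e0'].
Qed.

Lemma specializesZ a f r : spec f r -> spec (a *: f) (a * r).
Proof.
move=> [e [e0 -> ->]]; exists [seq (a * t.1, t.2) | t <- e]; split.
- by move=> ? /mapP[t /e0 te ->].
- by rewrite big_map scaler_sumr; apply: eq_bigr => t _; rewrite scalerA.
- by rewrite big_map big_distrr; apply: eq_bigr => t _ /=; rewrite mulrA.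
Qed.

Lemma specializes_powersum n f r : (0 < n)%N -> spec f r -> spec (p_ n * f) (cn n * r).
Proof.
move=> n0 [e [e0 -> ->]]; exists [seq (t.1, n :: t.2) | t <- e]; split.
- by move=> ? /mapP[t /e0 te ->]; rewrite inE negb_or te andbT eq_sym -lt0n.
- by rewrite big_map big_distrr; apply: eq_bigr => t _ /=; rewrite big_cons symfun_scalerAr.
- by rewrite big_map big_distrr; apply: eq_bigr => t _ /=; rewrite big_cons mulrCA.
Qed.

Lemma specializes_sum (I : eqType) (s : seq I) (F : I -> symfun A) (r : I -> A) :
  (forall i, i \in s -> spec (F i) (r i)) -> spec (\sum_(i <- s) F i) (\sum_(i <- s) r i).
Proof.
elim: s => [|i s IHs] h; first by rewrite !big_nil; exact: specializes0.
rewrite !big_cons; apply: specializesD; first by apply: h; rewrite mem_head.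
by apply: IHs => j js; apply: h; rewrite inE js orbT.
Qed.

(** The identity |la| s_la = sum_n p_n (p_n^perp s_la), obtained from [rem_strips_add_sum] at the
    Kostka numbers. It writes s_la recursively as a polynomial in power sums. *)
Lemma schur_powersums la :
  (sumn la)%:R *: W la = \sum_(1 <= n < (sumn la).+1) p_ n *
    \sum_(mu <- parts_of (sumn la - n)) strip A n mu la *: W mu.
Proof.
apply: coef_ext => u; rewrite coefZ coef_schur -(rem_strips_add_sum two_unit _ (ltnSn _)).
rewrite coef_lin_sum; apply: eq_big_nat => n /andP[n0 _].
rewrite mulr_sumr coef_lin_sum; apply: eq_bigr => mu _.
by rewrite symfun_scalerAr coefZ coef_powersum_schur // exp1rz mulr1.
Qed.

(** Under p_n |-> cn_n the recursion [schur_powersums] becomes the recursion [expco_euler]. *)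
Lemma specializes_schur la : spec (W la) (Ex la).
Proof.
have [d] := ubnP (sumn la); elim: d la => // d IHd la lad.
case: (eqVneq la empty_partition) => [->|ne].
  rewrite schur_empty expco0; exists [:: (1, [::])]; rewrite !big_seq1 !big_nil.
  by split; rewrite ?mulr1 ?scale1r // => t; rewrite inE => /eqP ->.
have l0 := partition_gt0 ne.
have -> : W la = (sumn la)%:R^-1 *: ((sumn la)%:R *: W la).
  by rewrite scalerA mulVr ?scale1r ?nat_unit.
have -> : Ex la = (sumn la)%:R^-1 * degop Ex la by rewrite /degop mulKr ?nat_unit.
apply: specializesZ; rewrite schur_powersums expco_euler //.
apply: specializes_sum => n; rewrite mem_index_iota => /andP[n0 _].
apply: specializes_powersum => //; apply: specializes_sum => mu.
rewrite mem_parts_of => /eqP muE; rewrite exp1rz mulr1; apply: specializesZ.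
by apply: IHd; lia.
Qed.

(** By the Frobenius formula these are the values of the symmetric group characters at cycle type
    k. *)
Definition powersum_coefs (k : seq nat) : Defs.partition -> A :=
  foldr (fun n => rem_strips n 1) (vac A) k.

Lemma powersum_coefsP (k : seq nat) : 0%N \notin k ->
  \prod_(n <- k) p_ n = schur_sum (powersum_coefs k).
Proof.
elim: k => [|n k IHk]; first by rewrite big_nil schur_sum_vac.
rewrite inE negb_or eq_sym -lt0n big_cons => /andP[n0 /IHk ->].
by rewrite powersum_schur_sum.
Qed.

Lemma powersum_coefs_size k la : 0%N \notin k -> sumn la != sumn k -> powersum_coefs k la = 0.
Proof.
elim: k la => [|n k IHk] la /=.
  by rewrite /vac => _; apply: contraNeq; case: (la =P _) => [->//|]; rewrite eqxx.
rewrite inE negb_or eq_sym -lt0n => /andP[n0 k0] ne.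
case: (ltnP (sumn la) n) => nla; first by rewrite rem_strips_gt.
rewrite /rem_strips big_seq big1 // => mu; rewrite mem_parts_of => /eqP muE.
by rewrite IHk ?mulr0 // muE; lia.
Qed.

(** Each M_n moves across the pairing to its transpose, for which the exponential is an eigenvector
    of eigenvalue cn_n. *)
Lemma powersum_coefs_pair k : 0%N \notin k ->
  \sum_(la <- parts_of (sumn k)) powersum_coefs k la * Ex la = \prod_(n <- k) cn n.
Proof.
elim: k => [|n k IHk] /=.
  move=> _; rewrite big_nil; transitivity (\sum_(la <- parts_of 0 | la == empty_partition) Ex la).
    rewrite [RHS]big_mkcond; apply: eq_bigr => la _; rewrite /vac.
    by case: eqP => _; rewrite ?mul1r ?mul0r.
  by rewrite big_parts_of_eq expco0.
rewrite inE negb_or eq_sym -lt0n => /andP[n0 k0]; rewrite big_cons -IHk //.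
transitivity (\sum_(la <- parts_of (sumn k)) powersum_coefs k la * add_strips n Ex la); last first.
  rewrite big_distrr; apply: eq_bigr => la _ /=.
  by rewrite (add_strips_expco nat_unit) // mulrCA.
rewrite -[in RHS](addKn n (sumn k)).
rewrite /add_strips; under [RHS]eq_bigr do rewrite big_distrr /=.
rewrite exchange_parts ?leq_addr //; apply: eq_bigr => mu _; rewrite /rem_strips big_distrl.
by apply: eq_bigr => la _ /=; rewrite exp1rz; ring.
Qed.

(** Pairing Schur coordinates with [Ex] computes the specialization of any polynomial in the power
    sums, so the result depends only on the symmetric function and not on the polynomial chosen. *)
Lemma specializes_unique la r : spec (W la) r -> r = Ex la.
Proof.
move=> [e [e0 We ->]].
have dE : (fun mu => (mu == la)%:R) = (fun mu => \sum_(t <- e) t.1 * powersum_coefs t.2 mu).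
  apply: schur_sum_inj; rewrite schur_sum_delta We schur_sum_lin big_seq [RHS]big_seq.
  by apply: eq_bigr => t te; rewrite powersum_coefsP ?e0.
(* D exceeds the degrees of [W la] and of all terms of [e], so the pairing is a finite sum that
   covers them. *)
pose D := (maxn (sumn la) (\max_(t <- e) sumn t.2)).+1.
pose pair c := \sum_(s < D) \sum_(mu <- parts_of s) c mu * Ex mu.
have pairE s c : (s < D)%N -> (forall mu, sumn mu != s -> c mu = 0) ->
    pair c = \sum_(mu <- parts_of s) c mu * Ex mu.
  move=> sD cs; rewrite /pair (bigD1 (Ordinal sD)) //= [X in _ + X]big1 ?addr0 // => s' ne.
  rewrite big_seq big1 // => mu; rewrite mem_parts_of => /eqP e'.
  by rewrite cs ?mul0r // e'.
have -> : Ex la = pair (fun mu => (mu == la)%:R).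
  rewrite (@pairE (sumn la)) ?ltnS ?leq_maxl // => [|mu ne];
    last by case: (mu =P la) ne => [->|//]; rewrite eqxx.
  transitivity (\sum_(mu <- parts_of (sumn la) | mu == la) Ex mu).
    by rewrite big_parts_of_eq eqxx.
  rewrite big_mkcond; apply: eq_bigr => mu _.
  by case: eqP => _; rewrite ?mul1r ?mul0r.
rewrite dE /pair; under [RHS]eq_bigr do under eq_bigr do rewrite big_distrl /=.
under [RHS]eq_bigr do rewrite exchange_big /=.
rewrite exchange_big big_seq [RHS]big_seq; apply: eq_bigr => t te /=.
rewrite -(powersum_coefs_pair (e0 t te)).
transitivity (t.1 * pair (powersum_coefs t.2)).
  congr (_ * _); rewrite (@pairE (sumn t.2)) // => [|mu].
    have := @leq_bigmax_seq _ e xpredT (fun t : A * seq nat => sumn t.2) t te isT.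
    by rewrite ltnS leq_max orbC => ->.
  by apply: powersum_coefs_size; exact: e0.
rewrite /pair big_distrr; apply: eq_bigr => s _; rewrite big_distrr.
by apply: eq_bigr => mu _ /=; rewrite mulrA.
Qed.

End Specialization.

Lemma at_qrho_schur (v : A) la : at_qrho v (W la) = expco (fun k => (qint v k%:Z)^-1) la.
Proof.
apply: specializes_unique; apply: (xgetPex 0).
by exists (expco (fun k => (qint v k%:Z)^-1) la); exact: specializes_schur.
Qed.

End PowerSums.

(** * The Baxter operator *)

Section Baxter.
Variables (A : idomainType) (v a : A).
Hypothesis nat_unit : forall n, (0 < n)%N -> (n%:R : A) \is a GRing.unit.
Hypothesis v_unit : v \is a GRing.unit.
Hypothesis a_unit : a \is a GRing.unit.
Hypothesis qint_unit : forall k : int, k != 0 -> qint v k \is a GRing.unit.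
Hypothesis contents_neq0 : forall la, la != empty_partition -> contents v la != 0.
Implicit Types (c : Defs.partition -> A) (la mu : Defs.partition) (u : seq nat).
Local Notation q := (v ^+ 2).

Definition framing (p : int) c la : A := v ^ (p * kappa la) * c la.

Lemma framingK p c : framing p (framing (- p) c) = c.
Proof.
apply/funext => la; rewrite /framing mulrA -exprzDr // mulNr subrr expr0z.
by rewrite mul1r.
Qed.

Lemma framing_vac p : framing p (vac A) = vac A.
Proof.
apply/funext => la; rewrite /framing /vac; case: eqP => [->|_]; last by rewrite mulr0.
by rewrite mulr1 /kappa big_ord0 mulr0 expr0z.
Qed.

Lemma schur_coord_sum c : schur_coord (schur_sum c) = c.
Proof.
apply: (xget_unique (fun=> 0)) => //= c' e.
by apply/esym/schur_sum_inj.
Qed.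

(** As q^k - 1 = v^k {k}, the geometric sum over the contents of a strip cancels the prefactor of
    P_(m,n) up to a power of v. *)
Lemma qint_geometric (m : int) n : (0 < n)%N -> m != 0 ->
  qint v m / qint v (m * n%:Z) * \sum_(t < n) (q ^ m) ^+ t = v ^ (m * (n%:Z - 1)).
Proof.
move=> n0 m0; have qb k : q ^ k - 1 = v ^ k * qint v k.
  rewrite /qint mulrBr -!exprzDr // subrr expr0z exprnP exprz_exp.
  by congr (v ^ _ - _); lia.
have mn0 : m * n%:Z != 0 by rewrite mulf_neq0 // eqz_nat -lt0n.
apply: (mulIr (qint_unit mn0)); rewrite mulrAC divrK ?qint_unit //.
apply: (mulrI (unitrXz m v_unit)); rewrite [LHS]mulrA -(qb m) -subrX1 exprnP exprz_exp qb.
by rewrite mulrA -exprzDr //; congr (v ^ _ * _); lia.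
Qed.

(** With c the smallest content of the strip, the exponent of v is m (2 c + n - 1). For m = p n it
    equals p (2 n c + n (n - 1)) = p (kappa mu - kappa la), and such a difference is what
    conjugation produces. *)
Lemma coef_skein_W p n la u : (0 < n)%N -> p != 0 ->
  coef (skein_W v a (p * n%:Z) n la) u = a ^ (p * n%:Z) *
    \sum_(mu <- parts_of (sumn la + n))
      strip A n la mu * v ^ (p * (kappa mu - kappa la)) * kostka A u mu.
Proof.
move=> n0 p0; set m := p * n%:Z.
have m0 : m != 0 by rewrite mulf_neq0 // eqz_nat -lt0n.
have s_ne mu : add_strip la n mu -> strip A n la mu != 0.
  by rewrite /strip => h; case: asboolP => // _; rewrite signr_eq0.
have fsE (V : nmodType) (F : Defs.partition -> V) :
    \sum_(mu \in add_strip la n) F mu =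
    \sum_(mu <- parts_of (sumn la + n) | `[< add_strip la n mu >]) F mu.
  rewrite -[RHS]big_filter; set r := [seq mu <- _ | _].
  have ur : uniq r by rewrite filter_uniq ?parts_of_uniq.
  have rD mu : mu \in r -> add_strip la n mu.
    by rewrite mem_filter => /andP[/asboolP].
  apply: fsum_seq => // mu h.
  rewrite mem_filter mem_parts_of; have [_ _ ->] := strip_neq0 n0 (s_ne _ h).
  by rewrite eqxx andbT; case: asboolP.
rewrite /skein_W coefZ -mulrA fsE coef_lin_sum; congr (_ * _).
rewrite big_distrr big_mkcond; apply: eq_bigr => mu _ /=.
case: (asboolP (add_strip la n mu)) => h; last first.
  by rewrite /strip; case: asboolP => // _; rewrite !mul0r.
have sn := s_ne _ h; rewrite coefZ coef_schur !mulrA; congr (_ * _).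
have [_ _ ->] := strip_contents (fun z => q ^ (m * z) : A) n0 sn.
rewrite /strip; case: asboolP => // _; rewrite [_ * (-1) ^+ _]mulrC -[LHS]mulrA.
congr (_ * _); rewrite (strip_kappa n0 sn).
have -> : \sum_(t < n) q ^ (m * (cmin n la mu + t%:Z)) =
    q ^ (m * cmin n la mu) * \sum_(t < n) (q ^ m) ^+ t.
  rewrite big_distrr; apply: eq_bigr => t _ /=.
  by rewrite mulrDr exprzDr ?unitrX // [in RHS]exprnP exprz_exp.
rewrite mulrCA qint_geometric // exprnP exprz_exp -exprzDr //; congr (v ^ _).
have nC : n%:Z * (n%:Z - 1) = 2 * 'C(n, 2)%:Z.
  by have := mul_bin_diag n 1; rewrite bin1; case: (n) n0 => // k _ /=; lia.
transitivity (2 * (p * n%:Z * cmin n la mu) + p * (n%:Z * (n%:Z - 1))).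
  by rewrite /m; ring.
by rewrite nC; ring.
Qed.

Lemma skein_P_schur_sum p n c : (0 < n)%N ->
  skein_P v a (p * n%:Z) n (schur_sum c) =
  a ^ (p * n%:Z) *: schur_sum (framing p (rem_strips n 1 (framing (- p) c))).
Proof.
move=> n0; have nz : n%:Z != 0 by rewrite eqz_nat -lt0n.
(* At p = 0 the operator is multiplication by p_n by definition, so this case is separate. *)
rewrite /skein_P mulf_eq0 (negPf nz) orbF; case: (eqVneq p 0) => [->|p0].
  have f0 (c' : Defs.partition -> A) : framing 0 c' = c'.
    by apply/funext => la; rewrite /framing mul0r expr0z mul1r.
  by rewrite mul0r expr0z scale1r oppr0 !f0 powersum_schur_sum.
apply: coef_ext => u; rewrite schur_coord_sum coefZ coef_schur_sum coef_sf_sum.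
have cE la : coef (c la *: skein_W v a (p * n%:Z) n la) u = a ^ (p * n%:Z) *
    \sum_(mu <- parts_of (sumn la + n))
      (c la * strip A n la mu * v ^ (p * (kappa mu - kappa la)) * kostka A u mu).
  rewrite coefZ coef_skein_W // mulrCA big_distrr; congr (_ * _).
  by apply: eq_bigr => mu _ /=; rewrite !mulrA.
under eq_fsbigr do rewrite cE.
have c0 la : (sumn la + n != sumn u)%N -> a ^ (p * n%:Z) *
    \sum_(mu <- parts_of (sumn la + n))
      (c la * strip A n la mu * v ^ (p * (kappa mu - kappa la)) * kostka A u mu) = 0.
  move=> ne; rewrite big_seq big1 ?mulr0 // => mu; rewrite mem_parts_of => /eqP e.
  by rewrite kostka_size ?mulr0 // e.
case: (ltnP (sumn u) n) => nu.
  rewrite fsbig1 => [|la _]; last by apply: c0; lia.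
  rewrite big_seq big1 ?mulr0 // => la; rewrite mem_parts_of => /eqP e.
  by rewrite /framing rem_strips_gt ?mulr0 ?mul0r // e.
rewrite (@fsum_parts _ (sumn u - n)%N) => [|la ne]; last by apply: c0; lia.
rewrite -big_distrr exchange_parts //; congr (_ * _); apply: eq_bigr => mu _.
rewrite {1}/framing /rem_strips [X in _ = X * _]mulr_sumr mulr_suml; apply: eq_bigr => la _.
rewrite /framing exp1rz mulr1 mulrBr exprzDr // mulNr.
by move: (v ^ _) (v ^ _) => x y; ring.
Qed.

Definition baxter_log (p : int) (t : A) (f : symfun A) : symfun A :=
  sf_sum [set n | (0 < n)%N]%classic (fun n =>
    (- (- t) ^+ n / (n%:R * qint v n%:Z)) *: skein_P v a (p * n%:Z) n f).

Local Notation Y := (psop (fun n => cneg v n / n%:R)).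

Lemma baxter_log_schur_sum p c :
  baxter_log p (a ^ (- p)) (schur_sum c) = schur_sum (framing p (Y (framing (- p) c))).
Proof.
apply: coef_ext => u; rewrite coef_sf_sum coef_schur_sum.
rewrite (@fsum_seq _ _ (index_iota 1 (sumn u).+1)); first last.
- move=> n /= n0; rewrite mem_index_iota n0 ltnS -ltnNge => nu.
  rewrite coefZ skein_P_schur_sum // coefZ coef_schur_sum big_seq big1 ?mulr0 // => la.
  by rewrite mem_parts_of => /eqP e; rewrite /framing rem_strips_gt ?mulr0 ?mul0r // e.
- by move=> n; rewrite mem_index_iota => /andP[].
- exact: iota_uniq.
transitivity (\sum_(1 <= n < (sumn u).+1) \sum_(la <- parts_of (sumn u))
    (cneg v n / n%:R) * (framing p (rem_strips n 1 (framing (- p) c)) la * kostka A u la)).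
  apply: eq_big_nat => n /andP[n0 _].
  rewrite coefZ skein_P_schur_sum // coefZ coef_schur_sum mulrA big_distrr.
  apply: eq_bigr => la _ /=; congr (_ * _).
  (* The choice t = a^(-p) cancels the factor a^(p n) of P_(pn,n). *)
  have an : (- a ^ (- p)) ^+ n * a ^ (p * n%:Z) = (-1) ^+ n.
    rewrite [X in X * _]exprNn -mulrA [X in _ * X](_ : _ = 1) ?mulr1 //.
    rewrite exprnP exprz_exp -exprzDr // (_ : _ + _ = 0) ?expr0z //; lia.
  have qn : qint v n%:Z \is a GRing.unit by rewrite qint_unit // eqz_nat -lt0n.
  rewrite invrM ?nat_unit // mulrAC [- _ * a ^ _]mulNr an /cneg mulrA.
  congr (_ / _ / _); case: n n0 {an qn} => // n _.
  by rewrite exprS mulN1r opprK.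
rewrite exchange_big big_seq [RHS]big_seq; apply: eq_bigr => la.
rewrite mem_parts_of => /eqP lau.
rewrite -[framing p (Y _) la]/(v ^ (p * kappa la) * Y (framing (- p) c) la) /psop lau.
rewrite [X in _ = X * _]mulr_sumr mulr_suml.
by apply: eq_bigr => n _ /=; rewrite /framing; ring.
Qed.

(** The framings between successive factors cancel and the vacuum is fixed by every framing, so only
    the outermost one remains. *)
Lemma iter_baxter_log p k :
  iter k (baxter_log p (a ^ (- p))) 1 = schur_sum (framing p (iter k Y (vac A))).
Proof.
elim: k => [|k IHk]; first by rewrite /= framing_vac schur_sum_vac.
rewrite iterS IHk baxter_log_schur_sum.
by have := framingK (- p) (iter k Y (vac A)); rewrite opprK => ->.
Qed.

Lemma baxter_vac p :
  baxter v a p (a ^ (- p)) 1 = schur_sum (framing p (expco (cneg v))).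
Proof.
rewrite -[LHS]/(sf_exp (baxter_log p (a ^ (- p))) 1).
apply: coef_ext => u; rewrite coef_sf_sum coef_schur_sum.
rewrite (@fsum_seq _ _ (index_iota 0 (sumn u).+1)); first last.
- move=> k _; rewrite mem_index_iota /= -leqNgt => uk.
  rewrite coefZ iter_baxter_log coef_schur_sum big_seq big1 ?mulr0 // => la.
  rewrite mem_parts_of => /eqP e; rewrite /framing iter_psop_eq0 ?mulr0 ?mul0r //.
  by rewrite e.
- by [].
- exact: iota_uniq.
under eq_bigr do rewrite coefZ iter_baxter_log coef_schur_sum big_distrr /=.
rewrite exchange_big big_seq [RHS]big_seq; apply: eq_bigr => la.
rewrite mem_parts_of => /eqP lau.
rewrite -[framing p (expco _) la]/(v ^ (p * kappa la) * expco (cneg v) la).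
rewrite (@expcoE _ _ (sumn u).+1) ?lau // [X in _ = X * _]mulr_sumr mulr_suml.
by apply: eq_bigr => k _ /=; rewrite /framing; ring.
Qed.

Lemma baxter_vertex p : baxter v a p (a ^ (- p)) 1 = vertex v (p - 1).
Proof.
rewrite baxter_vac; apply: coef_ext => u; rewrite coef_schur_sum coef_sf_sum.
rewrite (@fsum_parts _ (sumn u)) => [|la ne]; last first.
  by rewrite coefZ coef_schur kostka_size ?mulr0.
apply: eq_bigr => la _; rewrite coefZ coef_schur; congr (_ * _).
(* The twist v^(-kappa) relating the two exponentials lowers the framing from p to p - 1. *)
rewrite at_qrho_schur // /framing expco_twist //; last first.
  by move=> n n0; rewrite qint_unit // eqz_nat -lt0n.
by rewrite mulrA -exprzDr // mulrBl mul1r.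
Qed.

End Baxter.

(* The content generating function is a Laurent polynomial in q with nonnegative
   coefficients, so evaluating at q = 1 shows that it does not vanish. *)
Lemma skein_contents_neq0 (K : realType) (la : Defs.partition) :
  la != empty_partition -> contents (qhalf K) la != 0.
Proof.
move=> ne; pose e (b : nat * nat) := (2 * (b.2 + size la - b.1))%N.
have eE b : b \in skew_boxes la [::] -> (e b)%:Z = 2%:Z * content b + 2%:Z * (size la)%:Z.
  case: b => i j; rewrite mem_skew_boxes => /andP[_ jl]; rewrite /e /content /=.
  have : (i < size la)%N by rewrite ltnNge; apply: contraL jl => h; rewrite nth_default.
  by lia.
apply/eqP => c0; have : \sum_(b <- skew_boxes la [::]) qhalf K ^+ e b = 0.
  transitivity (contents (qhalf K) la * qhalf K ^ (2%:Z * (size la)%:Z)); last by rewrite c0 mul0r.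
  rewrite /contents mulr_suml big_seq [RHS]big_seq; apply: eq_bigr => b bb.
  by rewrite exprnP eE // exprzDr ?qhalf_unit // [in RHS]exprnP exprz_exp.
have vX k : val (qhalf K ^+ k) = FracField.tofrac ('X ^+ k : {poly K[i]})%:P.
  by rewrite !rmorphXn.
have vS : val (\sum_(b <- skew_boxes la [::]) qhalf K ^+ e b) =
    FracField.tofrac (\sum_(b <- skew_boxes la [::]) 'X ^+ e b : {poly K[i]})%:P.
  by rewrite !rmorph_sum; apply: eq_bigr => b _; exact: vX.
move=> /(congr1 val); rewrite vS rmorph0 => /eqP; rewrite tofrac_eq0 polyC_eq0 => /eqP.
move=> /(congr1 (fun f : {poly _} => f.[1])); rewrite horner_sum horner0.
under eq_bigr do rewrite hornerXn expr1n.
rewrite big_const_seq count_predT iter_addr addr0 => /eqP; rewrite pnatr_eq0.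
apply/negP; rewrite -lt0n; have := partition_gt0 ne.
case E : (skew_boxes la [::]) => //=.
have /andP[_ la0] := partsP la.
case: (parts la) la0 E => [|x s] //= ; rewrite inE negb_or => /andP[x0 _] E.
have : (0%N, 0%N) \in skew_boxes (x :: s) [::] by rewrite mem_skew_boxes /= lt0n eq_sym.
by rewrite E.
Qed.

Theorem proposition7p6 (K : realType) (p : int) :
  baxter (qhalf K) (avar K) p (avar K ^ (- p)) 1 = vertex (qhalf K) (p - 1).
Proof.
apply: baxter_vertex.
- exact: skein_natr_unit.
- exact: qhalf_unit.
- exact: avar_unit.
- exact: qint_unit.
- exact: skein_contents_neq0.
Qed.
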